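(* Let $\mathbb{F}\in\{\mathbb{R},\mathbb{C}\}$, let $A_1,\dots,A_n$ be fixed positive-semidefinite $d\times d$ matrices over $\mathbb{F}$, and let $W_1,\dots,W_n$ be independent real random variables with $W_i\ge0$ and $\mathbb{E}W_i^2<+\infty$. Set $X=\sum_{i=1}^nW_iA_i$, $H_i=(\mathbb{E}W_i^2)^{1/2}A_i$, and $Z=\sum_{i=1}^n\gamma_iH_i$ with $\gamma_1,\dots,\gamma_n$ iid real standard normal variables. Let $\sigma_*^2(Z)=\max_{\|u\|=1}\sum_{i=1}^n(u^*H_iu)^2$. Fix an arbitrary self-adjoint $\Delta\in\mathbb{F}^{d\times d}$. Then \[ \mathbb{E}\,\lambda_{\min}(X-\mathbb{E}X+\Delta)\ge\mathbb{E}\,\lambda_{\min}(Z+\Delta)-\sqrt{2\sigma_*^2(Z)\log d}, \] and for all $t\ge0$, \[ \mathbb{P}\big\{\lambda_{\min}(X-\mathbb{E}X+\Delta)\le\mathbb{E}\,\lambda_{\min}(Z+\Delta)-t\big\}\le d\cdot e^{-t^2/(2\sigma_*^2(Z))}. \]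
   Context: $\lambda_{\min}$ is the minimum eigenvalue; maximum over unit vectors $u\in\mathbb{F}^d$. *)

(* Defs.v *)
From HB Require Import structures.
From mathcomp Require Import all_boot all_order all_algebra.
From mathcomp Require Import all_classical all_reals all_analysis.
From mathcomp Require Import complex.

Set Implicit Arguments.
Unset Strict Implicit.
Unset Printing Implicit Defensive.

Import Order.TTheory GRing.Theory Num.Theory.
Import numFieldNormedType.Exports.

Local Open Scope classical_set_scope.
Local Open Scope ring_scope.

Inductive scalars := RealF | ComplexF.

Definition Fld (R : realType) (k : scalars) : numFieldType :=
  match k with
  | RealF => (R : numFieldType)
  | ComplexF => (R[i] : numFieldType)
  end.

Definition conjF (R : realType) (k : scalars) : Fld R k -> Fld R k :=
  match k as k0 return Fld R k0 -> Fld R k0 with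
  | RealF => fun x => x
  | ComplexF => fun x => @conjc R x
  end.

Definition ofR (R : realType) (k : scalars) : R -> Fld R k :=
  match k as k0 return R -> Fld R k0 with
  | RealF => fun x => x
  | ComplexF => fun x => (x%:C)%C
  end.

Definition reF (R : realType) (k : scalars) : Fld R k -> R :=
  match k as k0 return Fld R k0 -> R with
  | RealF => fun x => x
  | ComplexF => fun x => @complex.Re R x
  end.

Definition adj (R : realType) (k : scalars) (m n : nat) (M : 'M[Fld R k]_(m, n))
  : 'M[Fld R k]_(n, m) := (map_mx (@conjF R k) M)^T.

Definition self_adjoint (R : realType) (k : scalars) (d : nat)
  (M : 'M[Fld R k]_d) : Prop := adj M = M.

Definition psd (R : realType) (k : scalars) (d : nat) (A : 'M[Fld R k]_d) : Prop :=
  self_adjoint A /\ forall u : 'cV[Fld R k]_d, 0 <= (adj u *m A *m u) 0 0.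

(** minimum eigenvalue of a self-adjoint matrix (whose eigenvalues are real) *)
Definition lambda_min (R : realType) (k : scalars) (d : nat) (M : 'M[Fld R k]_d) : R :=
  inf [set a : R | eigenvalue M (ofR k a)].

Definition unit_vec (R : realType) (k : scalars) (d : nat) (u : 'cV[Fld R k]_d) : Prop :=
  adj u *m u = 1%:M.

Definition sigma_star2 (R : realType) (k : scalars) (d n : nat)
  (H : 'I_n -> 'M[Fld R k]_d) : R :=
  sup [set \sum_(i < n) (reF ((adj u *m H i *m u) 0 0)) ^+ 2 | u in @unit_vec R k d].

Definition independent_rvs d (T : measurableType d) (R : realType)
  (P : probability T R) (n : nat) (X : 'I_n -> {RV P >-> R}) : Prop :=
  forall (J : {set 'I_n}) (B : 'I_n -> set R),
    (forall i, measurable (B i)) ->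
    P (\bigcap_(i in [set` J]) (X i @^-1` B i)) = (\prod_(i in J) P (X i @^-1` B i))%E.

(* Main.v *)
(** Exponential moments: for [theta > 0], [exp (- theta * lambda_min M)] lies
    between [tr exp (- theta M) / d] and [tr exp (- theta M)].

    Comparison of [tr exp]: the function [f(x) = tr exp (- (B + x A))], with
    [A] positive semidefinite, is convex with [f''' <= 0] (the third-order case
    of the BMV conjecture, proved directly on the powers [(1 - M / n)^n] by a
    positive Schur-type kernel).  Hence [f(x + w) <= f(x) + w f'(x) + w^2/2 f''(x)]
    for [w >= 0], and interpolating between [W - E W] and a Gaussian of variance
    [E W^2] along the heat semigroup gives [E f(W - E W) <= E f(sqrt(E W^2) gamma)].
    By independence the coordinates can be replaced one at a time.

    Gaussian concentration: [- theta lambda_min(Z + Delta)] is a supremum of affine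
    functions of the Gaussian vector with slopes of length at most
    [theta sigma_star]; the sharp bound on its exponential moment follows from the
    infimum-convolution inequality, i.e. the Prekopa-Leindler inequality in
    dimension one, which tensorizes. *)
Require Import Defs.
From HB Require Import structures.
From mathcomp Require Import all_boot all_order all_algebra.
From mathcomp Require Import all_classical all_reals all_analysis.
From mathcomp Require Import measurable_realfun polyrcf complex.
From mathcomp Require Import ring lra.

Set Implicit Arguments.
Unset Strict Implicit.
Unset Printing Implicit Defensive.

Import Order.TTheory GRing.Theory Num.Theory.
Import numFieldNormedType.Exports.
Local Open Scope classical_set_scope.
Local Open Scope ring_scope.
Local Open Scope sesquilinear_scope.

(** * Triangular parts and a positive cyclic sum *)

(** The third derivative of the trace of a power is a cyclic sum of [A i j * A j k * A k i] weighted
    by a complete homogeneous polynomial, that is, by a second divided difference of a power. Powers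
    are positive mixtures of the functions max(x - s, 0)^2, so a single kernel settles every
    exponent. For it, the signs of the eigenvalues minus s cut [A] into blocks, and the obstacle is
    a negative term from the mixed block; it is absorbed by testing [A] on the strict lower
    triangular part of the positive block, in a Schur basis. The comparison involves E W^2, not the
    variance. Its path is b W - s E W plus a centred Gaussian of variance (1 - s) E W^2, with b an
    independent Bernoulli variable of mean s: convexity splits b into two independent pieces, and
    the one-sided Taylor bound trades the small piece for Gaussian variance. Steps are finite, so no
    derivative of the limit [trexp] is used. In the concentration bound the infimum-convolution
    inequality has a parameter [s] in (0, 1); the sharp constant appears as [s] tends to 0. *)

Section TriangularPart.
Variables (C : numClosedFieldType) (d : nat).
Implicit Types (A B P G N X U : 'M[C]_d).

Lemma trig_mulmx A B : is_trig_mx A -> is_trig_mx B -> is_trig_mx (A *m B).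
Proof.
move=> /is_trig_mxP tA /is_trig_mxP tB; apply/is_trig_mxP => i j ij.
rewrite mxE big1// => k _; have [ik|ki] := ltnP i k; first by rewrite tA ?mul0r.
by rewrite tB ?mulr0// (leq_ltn_trans ki).
Qed.

Lemma trig_mulmx_diag A B i : is_trig_mx A -> is_trig_mx B ->
  (A *m B) i i = A i i * B i i.
Proof.
move=> /is_trig_mxP tA /is_trig_mxP tB; rewrite mxE (bigD1 i)//= big1 ?addr0// => k ki.
have [ik|ki'] := ltnP i k; first by rewrite tA ?mul0r.
by rewrite tB ?mulr0// ltn_neqAle ki ki'.
Qed.

Definition tr A : C := \tr A.

Lemma trD A B : tr (A + B) = tr A + tr B. Proof. exact: mxtraceD. Qed.

Lemma trC A B : tr (A *m B) = tr (B *m A). Proof. exact: mxtrace_mulC. Qed.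

Lemma trig_mxtrace_mul A B : is_trig_mx A -> is_trig_mx B ->
  tr (A *m B) = \sum_i A i i * B i i.
Proof. by move=> tA tB; apply: eq_bigr => i _; rewrite trig_mulmx_diag. Qed.

Lemma mxtrace_adj A : tr (A ^t*) = (tr A)^*.
Proof. by rewrite /tr /mxtrace rmorph_sum; apply: eq_bigr => i _; rewrite !mxE. Qed.

Lemma adj_mulmx m n p (A : 'M[C]_(m, n)) (B : 'M[C]_(n, p)) :
  (A *m B) ^t* = B ^t* *m A ^t*.
Proof. by rewrite trmx_mul map_mxM. Qed.

Lemma adj_mxD m n (A B : 'M[C]_(m, n)) : (A + B) ^t* = A ^t* + B ^t*.
Proof. by apply/matrixP => i j; rewrite !mxE rmorphD. Qed.

Definition strict_lower P : 'M[C]_d := \matrix_(i, j) (if (j < i)%N then P i j else 0).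
Definition diag_part P : 'M[C]_d := \matrix_(i, j) (if i == j then P i i else 0).

Lemma strict_lower_decomp P : P ^t* = P ->
  P = strict_lower P + diag_part P + (strict_lower P)^t*.
Proof.
move=> /matrixP hP; apply/matrixP => i j; rewrite !mxE.
have [ij|ij|/val_inj ->] := ltngtP i j.
- rewrite (_ : (i == j) = false) ?add0r; last by apply/eqP => e; rewrite e ltnn in ij.
  by rewrite -[LHS]hP !mxE.
- rewrite (_ : (i == j) = false) ?rmorph0 ?addr0//.
  by apply/eqP => e; rewrite e ltnn in ij.
- by rewrite eqxx rmorph0 addr0 add0r.
Qed.

Lemma strict_lower_trig P : is_trig_mx (strict_lower P).
Proof. by apply/is_trig_mxP => i j ij; rewrite mxE ltnNge (ltnW ij). Qed.

Lemma diag_part_trig P : is_trig_mx (diag_part P).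
Proof. by apply/is_trig_mxP => i j ij; rewrite mxE; case: eqP => // e; rewrite e ltnn in ij. Qed.

Lemma trig_mxD A B : is_trig_mx A -> is_trig_mx B -> is_trig_mx (A + B).
Proof.
move=> /is_trig_mxP tA /is_trig_mxP tB; apply/is_trig_mxP => i j ij.
by rewrite mxE tA// tB// addr0.
Qed.

Lemma adj_diag_part P : P ^t* = P -> (diag_part P)^t* = diag_part P.
Proof.
move=> hP; apply/matrixP => i j; rewrite !mxE eq_sym; case: eqP => [->|_].
  by rewrite -[in RHS]hP !mxE.
by rewrite rmorph0.
Qed.

Lemma mxtrace_cubeD U A :
  tr ((U + A) *m (U + A) *m (U + A)) = tr (U *m U *m U) + 3 * tr (A *m U *m U)
    + 3 * tr (A *m A *m U) + tr (A *m A *m A).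
Proof.
rewrite !(mulmxDl, mulmxDr) !trD.
have -> : tr (U *m U *m A) = tr (A *m U *m U) by rewrite trC mulmxA.
have -> : tr (U *m A *m U) = tr (A *m U *m U) by rewrite -mulmxA trC.
have -> : tr (U *m A *m A) = tr (A *m A *m U) by rewrite -mulmxA trC.
have -> : tr (A *m U *m A) = tr (A *m A *m U) by rewrite trC mulmxA.
ring.
Qed.

(** A product of lower triangular matrices with a strictly lower factor has trace zero, and likewise
    for adjoints. This kills every word except the cube of [D] and those containing both [X] and its
    adjoint; the latter regroup around a middle factor [P], with one leftover ending in [D]. *)
Lemma mxtrace_cube_strict_lower P (X := strict_lower P) (D := diag_part P) :
  P ^t* = P ->
  tr (P *m P *m P) = tr (D *m D *m D) + 3 * tr (X ^t* *m P *m X)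
     + 3 * tr (X ^t* *m X *m D).
Proof.
move=> hP; pose U := X + D; pose Y := X ^t*.
have dX i : X i i = 0 by rewrite mxE ltnn.
have tX : is_trig_mx X by exact: strict_lower_trig.
have tD : is_trig_mx D by exact: diag_part_trig.
have tU : is_trig_mx U by exact: trig_mxD.
have eP : P = U + Y by rewrite {1}(strict_lower_decomp hP).
have tr0 (B : 'M[C]_d) : is_trig_mx B -> tr (X *m B) = 0.
  by move=> tB; rewrite trig_mxtrace_mul// big1// => i _; rewrite dX mul0r.
have hD : D ^t* = D by exact: adj_diag_part.
have tr0' (B : 'M[C]_d) : is_trig_mx B -> tr (Y *m B ^t*) = 0.
  by move=> tB; rewrite trC -adj_mulmx mxtrace_adj tr0// rmorph0.
have e1 : tr (U *m U *m U) = tr (D *m D *m D).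
  rewrite !trig_mxtrace_mul ?trig_mulmx//; apply: eq_bigr => i _.
  by rewrite !trig_mulmx_diag// !mxE ltnn add0r.
have YYY : tr (Y *m Y *m Y) = 0 by rewrite -mulmxA -adj_mulmx tr0'// trig_mulmx.
have YYD : tr (Y *m Y *m D) = 0 by rewrite -mulmxA -[in D]hD -adj_mulmx tr0'// trig_mulmx.
have YDD : tr (Y *m D *m D) = 0.
  by rewrite -mulmxA -[D in X in X = _]hD -adj_mulmx tr0'// trig_mulmx.
have YUU : tr (Y *m U *m U) = tr (Y *m U *m X) + tr (Y *m X *m D).
  rewrite {2}/U mulmxDr trD; congr (_ + _).
  by rewrite /U mulmxDr mulmxDl trD YDD addr0.
have YYU : tr (Y *m Y *m U) = tr (Y *m Y *m X).
  by rewrite /U mulmxDr trD YYD addr0.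
have -> : tr (P *m P *m P) = tr (U *m U *m U) + 3 * tr (Y *m U *m U)
    + 3 * tr (Y *m Y *m U) + tr (Y *m Y *m Y).
  by rewrite eP mxtrace_cubeD.
have YPX : tr (Y *m P *m X) = tr (Y *m U *m X) + tr (Y *m Y *m X).
  by rewrite [in LHS]eP (mulmxDr Y U Y) mulmxDl trD.
by rewrite e1 YYY YUU YYU -/Y YPX; ring.
Qed.

(** The expansion of the cube of [P] cancels the term quadratic in [X] exactly. Since [X *m N] has
    trace zero, the terms linear in [X] reduce the rest to traces against the diagonal [D] of [P]:
    one of [D *m G] and two of [D *m N], up to the factor 3. All remaining traces are
    nonnegative. *)
Lemma strict_lower_core P G N (X := strict_lower P) (M := G + N) :
  P ^t* = P -> G ^t* = G -> (forall i, 0 <= P i i) -> (forall i, 0 <= G i i) ->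
  is_trig_mx N -> (forall i, 0 <= N i i) ->
  0 <= tr (P *m P *m P) + 3 * (tr (P *m M) + tr (P *m M ^t*) - tr (P *m G))
       - 3 * tr (X ^t* *m P *m X) - 3 * (tr (X ^t* *m M) + tr (M ^t* *m X)).
Proof.
move=> hP hG P0 G0 tN N0; pose D := diag_part P.
have hD : D ^t* = D by exact: adj_diag_part.
have tX : is_trig_mx X by exact: strict_lower_trig.
have tD : is_trig_mx D by exact: diag_part_trig.
have eP : P = X + D + X ^t* by exact: strict_lower_decomp.
have trDg B : tr (D *m B) = \sum_i P i i * B i i.
  apply: eq_bigr => i _; rewrite mxE (bigD1 i)//= big1 ?addr0 ?mxE ?eqxx// => k ki.
  by rewrite mxE eq_sym (negbTE ki) mul0r.
have e1 : tr (P *m M) - tr (X ^t* *m M) = tr (X *m G) + tr (D *m G) + tr (D *m N).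
  rewrite {1}eP !mulmxDl /M !mulmxDr !trD.
  have -> : tr (X *m N) = 0.
    by rewrite trig_mxtrace_mul// big1// => i _; rewrite mxE ltnn mul0r.
  by ring.
have e2 : tr (P *m M ^t*) - tr (M ^t* *m X) =
    tr (X ^t* *m G) + tr (D *m G) + tr (D *m N).
  have -> : tr (P *m M ^t*) - tr (M ^t* *m X) = (tr (P *m M) - tr (X ^t* *m M))^*.
    rewrite rmorphB/= -!mxtrace_adj !adj_mulmx hP trmxCK; congr (_ - _).
    by rewrite trC.
  rewrite e1 !rmorphD/= -!mxtrace_adj !adj_mulmx hG hD.
  rewrite (trC G (X^t*)) (trC G D); congr (_ + _).
  rewrite trC !trDg; apply: eq_bigr => i _.
  by rewrite !mxE (CrealP _)// ger0_real.
have e3 : tr (P *m G) = tr (X *m G) + tr (D *m G) + tr (X ^t* *m G).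
  by rewrite {1}eP !mulmxDl !trD.
rewrite (mxtrace_cube_strict_lower hP) -/D -/X.
set a := tr (D *m D *m D); set b := tr (X ^t* *m P *m X).
set c := tr (_ *m X *m D).
have -> : a + 3 * b + 3 * c + 3 * (tr (P *m M) + tr (P *m M ^t*) - tr (P *m G)) -
    3 * b - 3 * (tr (X ^t* *m M) + tr (M ^t* *m X)) =
    a + 3 * c + 3 * ((tr (P *m M) - tr (X ^t* *m M)) +
      (tr (P *m M ^t*) - tr (M ^t* *m X)) - tr (P *m G)) by ring.
rewrite e1 e2 e3.
have -> : tr (X *m G) + tr (D *m G) + tr (D *m N) +
   (tr (X ^t* *m G) + tr (D *m G) + tr (D *m N)) -
   (tr (X *m G) + tr (D *m G) + tr (X ^t* *m G)) =
   tr (D *m G) + 2 * tr (D *m N) by ring.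
have h1 : 0 <= a.
  rewrite /a -mulmxA trDg sumr_ge0// => i _; rewrite mulr_ge0// trig_mulmx_diag//.
  by rewrite !mxE eqxx mulr_ge0.
have h2 : 0 <= c.
  rewrite /c trC trDg sumr_ge0// => i _; rewrite mulr_ge0// mxE sumr_ge0// => k _.
  by rewrite !mxE mulrC -normCK exprn_ge0.
have h3 : 0 <= tr (D *m G) by rewrite trDg sumr_ge0// => i _; rewrite mulr_ge0.
have h4 : 0 <= tr (D *m N) by rewrite trDg sumr_ge0// => i _; rewrite mulr_ge0.
by rewrite !addr_ge0// mulr_ge0// addr_ge0// mulr_ge0.
Qed.

End TriangularPart.

(** * Positive semidefinite matrices and Schur form *)

Section PsdMatrix.
Variable C : numClosedFieldType.

Definition psdC (d : nat) (A : 'M[C]_d) : Prop :=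
  A ^t* = A /\ forall u : 'cV[C]_d, 0 <= (u ^t* *m A *m u) 0 0.

Lemma psdC_congr d m (A : 'M[C]_d) (V : 'M[C]_(d, m)) :
  psdC A -> psdC (V ^t* *m A *m V).
Proof.
move=> [hA pA]; split=> [|u]; first by rewrite !adj_mulmx trmxCK hA mulmxA.
by have := pA (V *m u); rewrite adj_mulmx !mulmxA.
Qed.

Lemma psdC_congr' d m (A : 'M[C]_d) (V : 'M[C]_(m, d)) :
  psdC A -> psdC (V *m A *m V ^t*).
Proof. by move=> /(psdC_congr (V ^t*)); rewrite trmxCK. Qed.

Lemma psdC_diag d (A : 'M[C]_d) i : psdC A -> 0 <= A i i.
Proof.
move=> [_ /(_ (delta_mx i 0))]; congr (0 <= _).
rewrite (_ : (delta_mx i 0)^t* = delta_mx 0 i); last first.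
  by apply/matrixP => a b; rewrite !mxE andbC; case: (_ && _); rewrite ?rmorph1 ?rmorph0.
by rewrite -rowE -colE !mxE.
Qed.

Lemma psdC_tr d (A : 'M[C]_d) : psdC A -> 0 <= tr A.
Proof. by move=> pA; apply: sumr_ge0 => i _; exact: psdC_diag. Qed.

Lemma psdC_mulmx_adj d m (Y : 'M[C]_(d, m)) : psdC (Y *m Y ^t*).
Proof.
split=> [|u]; first by rewrite adj_mulmx trmxCK.
rewrite mulmxA -(mulmxA (_ *m _)) -[Y in u^t* *m Y]trmxCK -adj_mulmx mxE.
by apply: sumr_ge0 => i _; rewrite !mxE mulrC -normCK exprn_ge0.
Qed.

Lemma psdC_diag_mx d (r : 'rV[C]_d) : (forall i, 0 <= r 0 i) -> psdC (diag_mx r).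
Proof.
move=> r0; split=> [|u].
  apply/matrixP => i j; rewrite !mxE eq_sym; case: eqP => [->|_]; last by rewrite rmorph0.
  by rewrite !mulr1n (CrealP _)// ger0_real.
rewrite mul_mx_diag mxE sumr_ge0// => i _; rewrite !mxE mulrAC mulr_ge0//.
by rewrite mulrC -normCK exprn_ge0.
Qed.

(** For a left eigenvector [v] of [L *m K], the quadratic form of [K] at [v *m L] equals [a] times
    the form of [L] at [v], which is positive. *)
Lemma eigenvalue_mul_psd d (L K : 'M[C]_d) (a : C) :
  (forall v : 'rV[C]_d, v != 0 -> 0 < (v *m L *m v ^t*) 0 0) -> L ^t* = L ->
  psdC K -> eigenvalue (L *m K) a -> 0 <= a.
Proof.
move=> pL hL [_ pK] /eigenvalueP[v va v0].
have := pK ((v *m L)^t*); rewrite trmxCK adj_mulmx hL => h.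
have e : (v *m L *m K *m (L *m v ^t*)) 0 0 = a * (v *m L *m v ^t*) 0 0.
  by rewrite -(mulmxA v L K) va -scalemxAl mxE mulmxA.
by rewrite e pmulr_lge0 ?pL in h.
Qed.

Lemma Schur_diag_ge0 d (N : 'M[C]_d) : (forall a, eigenvalue N a -> 0 <= a) ->
  exists2 U : 'M[C]_d, U \is unitarymx &
    is_trig_mx (U *m N *m U ^t*) /\ forall i, 0 <= (U *m N *m U ^t*) i i.
Proof.
case: d N => [|d] N N0.
  exists 1%:M; first by apply/unitarymxP; apply/matrixP => -[].
  by split=> [|[]//]; apply/is_trig_mxP => -[].
have [U uU] := Schur N isT; rewrite /similar_to conjymx// => tU.
exists U => //; split=> // i; apply: N0.
have UU : U ^t* *m U = 1%:M by rewrite -invmx_unitary// mulVmx// unitarymx_unit.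
have : eigenvalue (U *m N *m U ^t*) ((U *m N *m U ^t*) i i).
  by rewrite eigenvalue_root_char char_poly_trig// /root horner_prod (bigD1 i)//= hornerXsubC subrr mul0r.
move=> /eigenvalueP[v vT v0]; apply/eigenvalueP; exists (v *m U).
  by rewrite scalemxAl -vT -[LHS]mulmx1 -UU !mulmxA.
by apply: contraNneq v0 => vU; rewrite -[v](mulmxtVK _ uU) vU mul0mx.
Qed.

End PsdMatrix.

(** * Positivity of the cyclic sum for squared hinge functions *)

Section HingeKernel.

Definition hinge_one (F : numFieldType) (p q r : F) : F :=
  [&& 0 < p, ~~ (0 < q) & ~~ (0 < r)]%:R * (p ^+ 2 / ((p - q) * (p - r))).

Definition hinge_two (F : numFieldType) (p q r : F) : F :=
  [&& 0 < p, 0 < q & ~~ (0 < r)]%:R * (1 - r ^+ 2 / ((p - r) * (q - r))).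

(** Closed form of the second divided difference of [x |-> max(x, 0) ^ 2],
  by the number of positive arguments; it also covers coinciding arguments. *)
Definition hinge_kernel (F : numFieldType) (p q r : F) : F :=
  [&& 0 < p, 0 < q & 0 < r]%:R
  + (hinge_two p q r + hinge_two q r p + hinge_two r p q)
  + (hinge_one p q r + hinge_one q r p + hinge_one r p q).

Variables (C : numClosedFieldType) (d : nat).

Definition cyc_sum (A : 'M[C]_d) (f : 'I_d -> 'I_d -> 'I_d -> C) : C :=
  \sum_i \sum_j \sum_k A i j * A j k * A k i * f i j k.

Lemma cyc_sumC A f : cyc_sum A (fun i j k => f j k i) = cyc_sum A f.
Proof.
rewrite /cyc_sum exchange_big; apply: eq_bigr => i _ /=.
rewrite exchange_big; apply: eq_bigr => j _ /=; apply: eq_bigr => k _.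
by congr (_ * _); rewrite -mulrA mulrC.
Qed.

Lemma cyc_sumD A f g : cyc_sum A (fun i j k => f i j k + g i j k) = cyc_sum A f + cyc_sum A g.
Proof.
rewrite /cyc_sum -big_split; apply: eq_bigr => i _ /=; rewrite -big_split.
by apply: eq_bigr => j _ /=; rewrite -big_split; apply: eq_bigr => k _; rewrite mulrDr.
Qed.

Lemma eq_cyc_sum A f g : (forall i j k, f i j k = g i j k) -> cyc_sum A f = cyc_sum A g.
Proof. by move=> fg; do 3!apply: eq_bigr => ? _; rewrite fg. Qed.

Lemma tr3E (X Y Z : 'M[C]_d) :
  tr (X *m Y *m Z) = \sum_i \sum_j \sum_k X i j * Y j k * Z k i.
Proof.
apply: eq_bigr => i _; rewrite mxE exchange_big; apply: eq_bigr => k _ /=.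
by rewrite mxE mulr_suml.
Qed.

(** Split the indices by the sign of [c]: [P], [Q], [S] are the blocks of [A], and [Y], [Z] are [Q]
    with entrywise weights adding up to 1. The kernel turns into traces, of which the one with [S]
    is bounded below by testing [A] on a matrix with a free parameter [X]; the [X] that works is the
    strict lower part of [P] in a basis where [N] is triangular. *)
Theorem cyc_sum_hinge_ge0 (A : 'M[C]_d) (c : 'I_d -> C) :
  (forall i, c i \is Num.real) -> psdC A ->
  0 <= cyc_sum A (fun i j k => hinge_kernel (c i) (c j) (c k)).
Proof.
move=> cR pA; have [hA _] := pA.
have AE i j : (A j i)^* = A i j by rewrite -[in RHS]hA !mxE.
pose b i := 0 < c i.
have nb i : ~~ b i -> c i <= 0 by rewrite /b -real_leNgt// ?real0.
have bc i j : b i -> ~~ b j -> 0 < c i - c j.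
  by move=> bi /nb cj; rewrite subr_gt0 (le_lt_trans cj).
have cc i : (c i)^* = c i by apply: CrealP.
pose Pi : 'M[C]_d := diag_mx (\row_i (b i)%:R).
pose P : 'M[C]_d := \matrix_(i, j) ((b i && b j)%:R * A i j).
pose Q : 'M[C]_d := \matrix_(i, j) ((b i && ~~ b j)%:R * A i j).
pose Y : 'M[C]_d := \matrix_(i, j) ((b i && ~~ b j)%:R * (c i / (c i - c j)) * A i j).
pose Z : 'M[C]_d := \matrix_(i, j) ((b i && ~~ b j)%:R * (- c j / (c i - c j)) * A i j).
pose S : 'M[C]_d := \matrix_(i, j) ((~~ b i && ~~ b j)%:R * A i j).
have QE : Q = Y + Z.
  apply/matrixP => i j; rewrite !mxE; case: (boolP (b i && ~~ b j)) => [/andP[bi bj]|_]; last first.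
    by rewrite !mul0r addr0.
  rewrite -mulrDl -mulrDr -mulrDl divff ?mulr1//.
  by rewrite gt_eqF// bc.
(* Each factor 3 collects the three cyclic rotations of a mixed sign pattern, which have equal
   sums. *)
have -> : cyc_sum A (fun i j k => hinge_kernel (c i) (c j) (c k)) =
    tr (P *m P *m P) + 3 * (tr (P *m Q *m Q ^t*) - tr (P *m Z *m Z ^t*)) + 3 * tr (Y *m S *m Y ^t*).
  have H2 := cyc_sumC A (fun i j k => hinge_two (c i) (c j) (c k)).
  have H2' := cyc_sumC A (fun i j k => hinge_two (c j) (c k) (c i)).
  have H1 := cyc_sumC A (fun i j k => hinge_one (c i) (c j) (c k)).
  have H1' := cyc_sumC A (fun i j k => hinge_one (c j) (c k) (c i)).
  rewrite /hinge_kernel !cyc_sumD H2' H1' H2 H1.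
  have -> : tr (P *m P *m P) = cyc_sum A (fun i j k => [&& 0 < c i, 0 < c j & 0 < c k]%:R).
    rewrite tr3E; do 3!apply: eq_bigr => ? _; rewrite !mxE -/(b _) -/(b _) -/(b _).
    by do 3!case: (b _); rewrite /= ?(mul0r, mulr0, mul1r, mulr1).
  have -> : tr (P *m Q *m Q ^t*) - tr (P *m Z *m Z ^t*) =
      cyc_sum A (fun i j k => hinge_two (c i) (c j) (c k)).
    rewrite !tr3E -sumrB; apply: eq_bigr => i _; rewrite -sumrB; apply: eq_bigr => j _.
    rewrite -sumrB; apply: eq_bigr => k _; rewrite !mxE !rmorphM/= AE !fmorphV !rmorphN/= !rmorphB/= !cc !rmorph_nat.
    rewrite /hinge_two -/(b i) -/(b j) -/(b k).
    case bi: (b i); case bj: (b j); case bk: (b k); rewrite /= ?(mul0r, mulr0, mul1r, mulr1, subrr)//.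
    have := bc i k; rewrite bi bk => /(_ isT isT) /lt0r_neq0 ik.
    have := bc j k; rewrite bj bk => /(_ isT isT) /lt0r_neq0 jk.
    by field; rewrite ik jk.
  have -> : tr (Y *m S *m Y ^t*) = cyc_sum A (fun i j k => hinge_one (c i) (c j) (c k)).
    rewrite !tr3E; apply: eq_bigr => i _; apply: eq_bigr => j _; apply: eq_bigr => k _.
    rewrite !mxE !rmorphM/= AE !fmorphV/= !rmorphB/= !cc !rmorph_nat.
    rewrite /hinge_one -/(b i) -/(b j) -/(b k).
    case bi: (b i); case bj: (b j); case bk: (b k); rewrite /= ?(mul0r, mulr0, mul1r, mulr1, subrr)//.
    have := bc i k; rewrite bi bk => /(_ isT isT) /lt0r_neq0 ik.
    have := bc i j; rewrite bi bj => /(_ isT isT) /lt0r_neq0 ij.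
    by field; rewrite ik ij.
  ring.
(* [M] is the cross term produced by testing [A] on [Pi *m X + Y ^t*]. It splits into the psd part
   [G] and the part [N], which need not be Hermitian but has nonnegative spectrum. *)
pose M := Q *m Y ^t*; pose G := Y *m Y ^t*; pose N := Z *m Y ^t*.
have MGN : M = G + N by rewrite /M QE mulmxDl.
(* The entry [Z i j] is [Y i j] times [- c j / c i], whence [N = L *m K]. The value 1 at the other
   indices only keeps [L] positive definite. *)
pose L : 'M[C]_d := diag_mx (\row_i (if b i then (c i)^-1 else 1)).
pose Lam : 'rV[C]_d := \row_j (if b j then 0 else - c j).
pose K := Y *m diag_mx Lam *m Y ^t*.
have NLK : N = L *m K.
  rewrite /N /K !mulmxA; congr (_ *m _); rewrite mul_mx_diag mul_diag_mx.
  apply/matrixP => i j; rewrite !mxE.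
  case bi: (b i); case bj: (b j); rewrite /= ?(mul0r, mulr0)// !mul1r.
  have := bc i j; rewrite bi bj => /(_ isT isT) /lt0r_neq0 ij.
  have i0 : c i != 0 by rewrite gt_eqF// -/(b i).
  by field; rewrite ij i0.
have Lam0 i : 0 <= Lam 0 i by rewrite mxE; case: ifPn => // /nb; rewrite oppr_ge0.
have pK : psdC K by apply: psdC_congr'; exact: psdC_diag_mx.
have pG : psdC G by exact: psdC_mulmx_adj.
have L0 i : 0 < (if b i then (c i)^-1 else 1) by case: ifP => // bi; rewrite invr_gt0.
have pL : psdC L by apply: psdC_diag_mx => i; rewrite mxE ltW.
have [U uU [tN N0]] : exists2 U : 'M[C]_d, U \is unitarymx &
    is_trig_mx (U *m N *m U ^t*) /\ forall i, 0 <= (U *m N *m U ^t*) i i.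
  apply: Schur_diag_ge0 => a; rewrite NLK; apply: eigenvalue_mul_psd => //; last by have [] := pL.
  move=> v /rV0Pn[i vi]; rewrite mul_mx_diag mxE (bigD1 i)//= ltr_wpDr//.
    apply: sumr_ge0 => k _; rewrite !mxE mulrAC mulr_ge0 ?(ltW (L0 _))//.
    by rewrite -normCK exprn_ge0.
  by rewrite !mxE mulrAC mulr_gt0// -normCK exprn_gt0// normr_gt0.
have PiE : P = Pi *m A *m Pi.
  rewrite mul_diag_mx mul_mx_diag; apply/matrixP => i j; rewrite !mxE.
  by case: (b i); case: (b j); rewrite /= ?(mul0r, mulr0, mul1r, mulr1).
have hPi : Pi ^t* = Pi.
  by apply: (proj1 (psdC_diag_mx _)) => i; rewrite mxE ler0n.
have pP : psdC P by rewrite PiE -{2}hPi; exact: psdC_congr'.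
have UU : U ^t* *m U = 1%:M by rewrite -invmx_unitary// mulVmx// unitarymx_unit.
pose f B := U *m B *m U ^t*.
have fM B B' : f (B *m B') = f B *m f B'.
  by rewrite /f !mulmxA -(mulmxA (U *m B) (U ^t*) U) UU mulmx1.
have ftr B : tr (f B) = tr B by rewrite /f trC mulmxA UU mul1mx.
have fadj B : f (B ^t*) = (f B) ^t* by rewrite /f !adj_mulmx trmxCK mulmxA.
have fD B B' : f (B + B') = f B + f B' by rewrite /f mulmxDr mulmxDl.
(* The strict lower part is taken in the Schur basis of [N], then carried back. *)
pose X := U ^t* *m strict_lower (f P) *m U.
have fX : f X = strict_lower (f P).
  by rewrite /f /X !mulmxA (unitarymxP uU) mul1mx mulmxtVK.
have core := @strict_lower_core C d (f P) (f G) (f N).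
have pfP : psdC (f P) by exact: psdC_congr'.
have pfG : psdC (f G) by exact: psdC_congr'.
have := core (proj1 pfP) (proj1 pfG) (fun i => psdC_diag i pfP) (fun i => psdC_diag i pfG) tN N0.
rewrite -fX -fD -MGN -!fadj -!fM !ftr => {}core.
(* Trace of the compression of [A] by [Pi *m X + Y ^t*], expanded into blocks; it bounds the trace
   with [S] from below. *)
have YSY : 0 <= tr (X ^t* *m P *m X) + (tr (X ^t* *m M) + tr (M ^t* *m X)) + tr (Y *m S *m Y ^t*).
  pose Pi' : 'M[C]_d := diag_mx (\row_i (~~ b i)%:R).
  have hPi' : Pi' ^t* = Pi' by apply: (proj1 (psdC_diag_mx _)) => i; rewrite mxE ler0n.
  have YPi : Y *m Pi' = Y.
    rewrite mul_mx_diag; apply/matrixP => i j; rewrite !mxE.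
    by case: (b i); case: (b j); rewrite /= ?(mul0r, mulr0, mul1r, mulr1).
  have PiY : Y ^t* = Pi' *m Y ^t* by rewrite -[in LHS]YPi adj_mulmx hPi'.
  have QPi : Pi *m A *m Pi' = Q.
    rewrite mul_diag_mx mul_mx_diag; apply/matrixP => i j; rewrite !mxE.
    by case: (b i); case: (b j); rewrite /= ?(mul0r, mulr0, mul1r, mulr1).
  have SPi : Pi' *m A *m Pi' = S.
    rewrite mul_diag_mx mul_mx_diag; apply/matrixP => i j; rewrite !mxE.
    by case: (b i); case: (b j); rewrite /= ?(mul0r, mulr0, mul1r, mulr1).
  have e1 : X ^t* *m Pi *m A *m (Pi *m X) = X ^t* *m P *m X by rewrite PiE !mulmxA.
  have e2 : X ^t* *m Pi *m A *m Y ^t* = X ^t* *m M by rewrite /M -QPi [in LHS]PiY !mulmxA.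
  have e3 : Y *m A *m (Pi *m X) = M ^t* *m X.
    by rewrite /M -QPi !adj_mulmx hA hPi hPi' trmxCK !mulmxA YPi.
  have e4 : Y *m A *m Y ^t* = Y *m S *m Y ^t* by rewrite -SPi !mulmxA YPi -!mulmxA -PiY.
  have := psdC_tr (psdC_congr (Pi *m X + Y ^t*) pA).
  rewrite adj_mxD adj_mulmx hPi trmxCK !(mulmxDl, mulmxDr) !trD e1 e2 e3 e4.
  by congr (0 <= _); ring.
have -> : tr (P *m Q *m Q ^t*) - tr (P *m Z *m Z ^t*) = tr (P *m M) + tr (P *m M ^t*) - tr (P *m G).
  have ZE : Z = Q - Y by rewrite QE addrC addKr.
  have -> : tr (P *m Z *m Z ^t*) = tr (P *m (Q - Y) *m (Q - Y) ^t*) by rewrite ZE.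
  have -> : (Q - Y) ^t* = Q ^t* - Y ^t* by apply/matrixP => i j; rewrite !mxE rmorphB.
  rewrite !(mulmxBl, mulmxBr) /M /G adj_mulmx trmxCK -!mulmxA /tr !raddfB/= -/(tr _) -/(tr _) -/(tr _) -/(tr _).
  ring.
apply: le_trans (addr_ge0 core (mulr_ge0 (ler0n _ 3) YSY)) _.
rewrite le_eqVlt; apply/orP; left; apply/eqP; ring.
Qed.

End HingeKernel.

(** * Complete homogeneous polynomials as divided differences *)

Section CompleteHomogeneous.
Variable R : comNzRingType.
Implicit Types p q r : R.

(** Divided difference of [x ^+ n.+1] at [p], [q], with the derivative as value on the diagonal;
    [hsym3 n] is the second divided difference of [x ^+ n.+2]. *)
Definition hsym2 n p q : R := \sum_(i < n.+1) p ^+ i * q ^+ (n - i).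
Definition hsym3 n p q r : R := \sum_(i < n.+1) p ^+ i * hsym2 (n - i) q r.

Lemma hsym2Sl n p q : hsym2 n.+1 p q = q ^+ n.+1 + p * hsym2 n p q.
Proof.
rewrite /hsym2 big_ord_recl /= mul1r subn0; congr (_ + _).
by rewrite mulr_sumr; apply: eq_bigr => i _; rewrite /bump /= add1n exprS mulrA subSS.
Qed.

Lemma hsym2Sr n p q : hsym2 n.+1 p q = p ^+ n.+1 + q * hsym2 n p q.
Proof.
rewrite /hsym2 big_ord_recr /= subnn mulr1 addrC; congr (_ + _).
rewrite mulr_sumr; apply: eq_bigr => i _; rewrite mulrCA -exprS subSn//.
by rewrite -ltnS.
Qed.

Lemma hsym3S n p q r : hsym3 n.+1 p q r = hsym2 n.+1 q r + p * hsym3 n p q r.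
Proof.
rewrite /hsym3 big_ord_recl /= mul1r subn0; congr (_ + _).
by rewrite mulr_sumr; apply: eq_bigr => i _; rewrite /bump /= add1n exprS mulrA subSS.
Qed.

Lemma mulB_hsym2 n p q : (p - q) * hsym2 n p q = p ^+ n.+1 - q ^+ n.+1.
Proof.
rewrite mulrBl; have := hsym2Sl n p q; rewrite hsym2Sr => e.
by rewrite -[p * _](addKr (q ^+ n.+1)) -e; ring.
Qed.

Let hsym20 p q : hsym2 0 p q = 1.
Proof. by rewrite /hsym2 big_ord1 mulr1. Qed.

Let hsym30 p q r : hsym3 0 p q r = 1.
Proof. by rewrite /hsym3 big_ord1 hsym20 mulr1. Qed.

Lemma mulB_hsym3 n p q r :
  (p - r) * hsym3 n p q r = hsym2 n.+1 p q - hsym2 n.+1 q r.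
Proof.
elim: n => [|n IH]; first by rewrite hsym30 !hsym2Sl !hsym20; ring.
rewrite hsym3S mulrDr mulrCA IH (hsym2Sl n.+1 p q) (hsym2Sr n.+1 q r); ring.
Qed.

(** The same recursion along another pair of arguments, for the case where [p = r] but [p != q]. *)
Lemma mulB_hsym3' n p q r :
  (p - q) * hsym3 n p q r = hsym2 n.+1 r p - hsym2 n.+1 q r.
Proof.
elim: n => [|n IH]; first by rewrite hsym30 !hsym2Sl !hsym20; ring.
rewrite hsym3S mulrDr mulrCA IH (hsym2Sr n.+1 r p) (hsym2Sl n.+1 q r); ring.
Qed.

Lemma hsym2_diag n p : hsym2 n p p = n.+1%:R * p ^+ n.
Proof.
elim: n => [|n IH]; first by rewrite hsym20 mulr1.
by rewrite hsym2Sl IH exprS -[in RHS](addn1 n.+1) natrD; ring.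
Qed.

Lemma hsym3_diag n p : 2 * hsym3 n p p p = (n.+1 * n.+2)%:R * p ^+ n.
Proof.
elim: n => [|n IH]; first by rewrite hsym30.
rewrite hsym3S mulrDr mulrCA IH hsym2_diag exprS !natrM.
by rewrite -(addn1 n.+2) -(addn1 n.+1) !natrD; ring.
Qed.

End CompleteHomogeneous.

(** * Powers as mixtures of squared hinge functions *)

Section HingeIntegral.
Variable R : realType.
Local Notation mu := (@lebesgue_measure R).
Implicit Types (p q r x L : R).

(** Integrability and value travel together, so that linear identities between integrands transfer
    in one step. *)
Definition has_int L (f : R -> R) (v : R) : Prop :=
  mu.-integrable `[0, L] (EFin \o f) /\ (\int[mu]_(x in `[0, L]) f x)%R = v.

Lemma has_intD L f g v w : has_int L f v -> has_int L g w ->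
  has_int L (fun x => f x + g x) (v + w).
Proof.
move=> [f1 f2] [g1 g2]; split; last by rewrite RintegralD// f2 g2.
by rewrite (_ : _ \o _ = (EFin \o f) \+ (EFin \o g))%E//; exact: integrableD.
Qed.

Lemma has_intZ L c f v : has_int L f v -> has_int L (fun x => c * f x) (c * v).
Proof.
move=> [f1 f2]; split; last by rewrite RintegralZl// f2.
rewrite (_ : _ \o _ = (fun x => c%:E * (EFin \o f) x)%E); first exact: integrableZl.
by apply/funext => x /=; rewrite EFinM.
Qed.

Lemma eq_has_int L f g v w : (forall x, f x = g x) -> v = w -> has_int L f v -> has_int L g w.
Proof. by move=> /funext -> ->. Qed.

Lemma has_int_sum L (I : Type) (s : seq I) (f : I -> R -> R) (v : I -> R) :
  (forall i, has_int L (f i) (v i)) ->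
  has_int L (fun x => \sum_(i <- s) f i x) (\sum_(i <- s) v i).
Proof.
move=> fv; elim: s => [|i s IH].
  rewrite big_nil; apply: (@eq_has_int _ (fun=> 0) _ 0) => // [x|]; first by rewrite big_nil.
  split; last by rewrite Rintegral_cst// mul0r.
  exact: integrable0.
rewrite big_cons; apply: eq_has_int (has_intD (fv i) IH) => // x.
by rewrite big_cons.
Qed.

Lemma has_int_ge0 L f v : (forall x, 0 <= x -> 0 <= f x) -> has_int L f v -> 0 <= v.
Proof.
move=> f0 [_ <-]; apply: Rintegral_ge0 => x /=; rewrite in_itv/= => /andP[x0 _].
exact: f0.
Qed.

Lemma has_int_poly (F : {poly R}) p L : 0 <= p -> p <= L ->
  has_int L (fun x => (x < p)%R%:R * F^`().[x]) (F.[p] - F.[0]).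
Proof.
move=> p0 pL.
have e (x : R) : ((horner F^`()) \_ `]-oo, p[) x = (x < p)%R%:R * F^`().[x].
  rewrite /patch mem_setE in_itv/=.
  by case: (x < p); rewrite ?mul1r ?mul0r.
have icont a b : mu.-integrable `[a, b] (EFin \o horner F^`()).
  apply: continuous_compact_integrable; first exact: segment_compact.
  by apply: continuous_subspaceT; exact: continuous_horner.
have setI : `[0, L]%classic `&` `]-oo, p[%classic = `[0, p[%classic :> set R.
  apply/seteqP; split=> x /=; rewrite !in_itv/=; first by case=> /andP[-> _] ->.
  by move=> /andP[-> xp]; split=> //=; rewrite (le_trans (ltW xp)).
have i0p : mu.-integrable `[0, p[ (EFin \o horner F^`()).
  by apply: integrableS (icont 0 p) => // x /=; rewrite !in_itv/= => /andP[-> /ltW ->].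
apply: (eq_has_int e erefl); split.
  rewrite -restrict_EFin; apply/integrable_restrict => //.
  by rewrite setI.
rewrite -Rintegral_mkcondr setI Rintegral_itv_bndo_bndc//.
move: p0; rewrite le_eqVlt => /predU1P[<-|p0].
  by rewrite set_itv1 Rintegral_set1 subrr.
rewrite /Rintegral (@continuous_FTC2 _ (horner F^`()) (horner F))//.
- by apply: continuous_subspaceT; exact: continuous_horner.
- split=> [x _|//|]; first exact: derivable_horner.
  + by apply: cvg_at_right_filter; exact: continuous_horner.
  + by apply: cvg_at_left_filter; exact: continuous_horner.
- by move=> x _; rewrite derivE.
Qed.

End HingeIntegral.

Section HingeKernelIntegral.
Variable R : realType.
Implicit Types p q r x L : R.

(** First divided difference of max(x, 0)^2, by sign pattern; on the diagonal it is the
    derivative. *)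
Definition hinge_pair p q : R :=
  ((0 < p) && (0 < q))%:R * (p + q) + ((0 < p) && ~~ (0 < q))%:R * (p ^+ 2 / (p - q))
  + ((0 < q) && ~~ (0 < p))%:R * (q ^+ 2 / (q - p)).

Lemma mulB_hinge_pair p q :
  (p - q) * hinge_pair p q = (0 < p)%R%:R * p ^+ 2 - (0 < q)%R%:R * q ^+ 2.
Proof.
rewrite /hinge_pair; case: (ltP 0 p) => p0; case: (ltP 0 q) => q0; rewrite /= ?mul0r ?mul1r ?addr0 ?add0r.
- ring.
- by field; lra.
- by field; lra.
- ring.
Qed.

Lemma hinge_pair_diag p : hinge_pair p p = (0 < p)%R%:R * (2 * p).
Proof. by rewrite /hinge_pair; case: (ltP 0 p) => p0 /=; ring. Qed.

Lemma mulB_hinge_kernel p q r :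
  (p - r) * hinge_kernel p q r = hinge_pair p q - hinge_pair q r.
Proof.
rewrite /hinge_pair /hinge_kernel /hinge_one /hinge_two.
case: (ltP 0 p) => p0; case: (ltP 0 q) => q0; case: (ltP 0 r) => r0;
  rewrite /= ?mul0r ?mul1r ?addr0 ?add0r; try ring.
all: field; lra.
Qed.

Lemma hinge_kernelC p q r : hinge_kernel p q r = hinge_kernel q r p.
Proof. by rewrite /hinge_kernel; case: (0 < p); case: (0 < q); case: (0 < r) => /=; ring. Qed.

Lemma mulB_hinge_kernel' p q r :
  (p - q) * hinge_kernel p q r = hinge_pair r p - hinge_pair q r.
Proof.
rewrite hinge_kernelC -[p - q]opprB mulNr mulB_hinge_kernel; ring.
Qed.

Lemma hinge_kernel_diag p : hinge_kernel p p p = (0 < p)%R%:R.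
Proof.
by rewrite /hinge_kernel /hinge_one /hinge_two; case: (ltP 0 p) => p0 /=; rewrite ?mul0r ?addr0.
Qed.

Lemma has_int_hinge0 n p L : 0 <= p -> p <= L ->
  has_int L (fun x => x ^+ n * (0 < p - x)%R%:R) (p ^+ n.+1 / n.+1%:R).
Proof.
move=> p0 pL; have := has_int_poly (n.+1%:R^-1 *: 'X^(n.+1)) p0 pL.
have n0 : n.+1%:R != 0 :> R by rewrite pnatr_eq0.
apply: eq_has_int => [x|]; last by rewrite !hornerE expr0n mulr0 subr0 mulrC.
rewrite derivZ derivXn hornerZ hornerMn hornerXn subr_gt0 mulrC; congr (_ * _).
by rewrite -[x ^+ n *+ n.+1]mulr_natl mulKf.
Qed.

Lemma has_int_hinge1 n p L : 0 <= p -> p <= L ->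
  has_int L (fun x => x ^+ n * ((0 < p - x)%R%:R * (p - x)))
    (p ^+ n.+2 / (n.+1 * n.+2)%:R).
Proof.
move=> p0 pL.
have := has_intD (has_intZ p (has_int_hinge0 n p0 pL)) (has_intZ (-1) (has_int_hinge0 n.+1 p0 pL)).
have n0 : n.+1%:R != 0 :> R by rewrite pnatr_eq0.
have n1 : n.+2%:R != 0 :> R by rewrite pnatr_eq0.
apply: eq_has_int => [x|]; first by rewrite exprS; ring.
rewrite natrM !exprS; have e : n.+2%:R = n.+1%:R + 1 :> R by rewrite -natr1.
have n0' : 0 < n.+1%:R :> R by rewrite ltr0n.
by rewrite e; field; lra.
Qed.

Lemma has_int_hinge2 n p L : 0 <= p -> p <= L ->
  has_int L (fun x => x ^+ n * ((0 < p - x)%R%:R * (p - x) ^+ 2))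
    (p ^+ n.+3 * (2 / (n.+1 * n.+2 * n.+3)%:R)).
Proof.
move=> p0 pL.
have := has_intD (has_intZ p (has_int_hinge1 n p0 pL)) (has_intZ (-1) (has_int_hinge1 n.+1 p0 pL)).
have n0 : n.+1%:R != 0 :> R by rewrite pnatr_eq0.
have n1 : n.+2%:R != 0 :> R by rewrite pnatr_eq0.
have n2 : n.+3%:R != 0 :> R by rewrite pnatr_eq0.
apply: eq_has_int => [x|]; first by rewrite exprS; ring.
rewrite !natrM !exprS; have e : n.+2%:R = n.+1%:R + 1 :> R by rewrite -natr1.
have e' : n.+3%:R = n.+1%:R + 2 :> R by rewrite -natr1 e -addrA.
have n0' : 0 < n.+1%:R :> R by rewrite ltr0n.
by rewrite e e'; field; lra.
Qed.

(** Inverse of the integral of [x ^+ n * (1 - x) ^+ 2] over [0, 1]: with this factor the squared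
    hinges at [p] integrate to [p ^+ n.+3]. *)
Let w n : R := (n.+1 * n.+2 * n.+3)%:R / 2.

Let w0 n z : 2 * (w n * (z / n.+1%:R)) = (n.+2 * n.+3)%:R * z.
Proof.
have : n.+1%:R != 0 :> R by rewrite pnatr_eq0.
by rewrite /w !natrM; move: (n.+1%:R : R) (n.+2%:R : R) (n.+3%:R : R) => a b c a0; field.
Qed.

Let w1 n z : 2 * w n * (z / (n.+1 * n.+2)%:R) = n.+3%:R * z.
Proof.
have : n.+1%:R != 0 :> R by rewrite pnatr_eq0.
have : n.+2%:R != 0 :> R by rewrite pnatr_eq0.
rewrite /w !natrM; move: (n.+1%:R : R) (n.+2%:R : R) (n.+3%:R : R) => a b c b0 a0.
by field; rewrite a0 b0.
Qed.

Let w2 n : w n * (2 / (n.+1 * n.+2 * n.+3)%:R) = 1.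
Proof.
by rewrite /w mulrA divfK ?pnatr_eq0// divff// pnatr_eq0 !muln_eq0.
Qed.

Lemma has_int_hinge_pair n p q L : 0 <= p -> p <= L -> 0 <= q -> q <= L ->
  has_int L (fun x => w n * x ^+ n * hinge_pair (p - x) (q - x)) (hsym2 n.+2 p q).
Proof.
move=> p0 pL q0 qL.
have [pq|pq] := eqVneq p q.
  have := has_intZ (2 * w n) (has_int_hinge1 n p0 pL).
  apply: eq_has_int => [x|]; first by rewrite -pq hinge_pair_diag; ring.
  by rewrite -pq hsym2_diag w1.
have pq0 : p - q != 0 by rewrite subr_eq0.
have := has_intZ ((p - q)^-1 * w n)
  (has_intD (has_int_hinge2 n p0 pL) (has_intZ (-1) (has_int_hinge2 n q0 qL))).
apply: eq_has_int => [x|].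
  have := mulB_hinge_pair (p - x) (q - x).
  rewrite (_ : p - x - (q - x) = p - q); last by ring.
  move=> /(canRL (mulKf pq0)) ->; ring.
have /(canRL (mulKf pq0)) -> := mulB_hsym2 n.+2 p q.
rewrite -mulrA; congr (_ * _); rewrite -[RHS]mul1r -[in RHS](w2 n); ring.
Qed.

(** Divided differences are linear, so the representation of [p ^+ n.+3] as a mixture of squared
    hinges passes to second divided differences. The cases are [p != r], then [p = r] with [p != q],
    then three equal arguments, where the confluent values are compared directly. *)
Lemma has_int_hinge_kernel n p q r L : 0 <= p -> p <= L -> 0 <= q -> q <= L ->
  0 <= r -> r <= L ->
  has_int L (fun x => w n * x ^+ n * hinge_kernel (p - x) (q - x) (r - x)) (hsym3 n.+1 p q r).
Proof.
move=> p0 pL q0 qL r0 rL.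
have [pr|pr] := eqVneq p r; last first.
  have pr0 : p - r != 0 by rewrite subr_eq0.
  have := has_intZ (p - r)^-1 (has_intD (has_int_hinge_pair n p0 pL q0 qL)
    (has_intZ (-1) (has_int_hinge_pair n q0 qL r0 rL))).
  apply: eq_has_int => [x|].
    have := mulB_hinge_kernel (p - x) (q - x) (r - x).
    rewrite (_ : p - x - (r - x) = p - r); last by ring.
    move=> /(canRL (mulKf pr0)) ->; ring.
  have /(canRL (mulKf pr0)) -> := mulB_hsym3 n.+1 p q r; ring.
have [pq|pq] := eqVneq p q; last first.
  have pr0 : p - q != 0 by rewrite subr_eq0.
  have := has_intZ (p - q)^-1 (has_intD (has_int_hinge_pair n r0 rL p0 pL)
    (has_intZ (-1) (has_int_hinge_pair n q0 qL r0 rL))).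
  apply: eq_has_int => [x|].
    have := mulB_hinge_kernel' (p - x) (q - x) (r - x).
    rewrite (_ : p - x - (q - x) = p - q); last by ring.
    move=> /(canRL (mulKf pr0)) ->; ring.
  have /(canRL (mulKf pr0)) -> := mulB_hsym3' n.+1 p q r; ring.
rewrite -pq -pr.
have := has_intZ (w n) (has_int_hinge0 n p0 pL).
apply: eq_has_int => [x|]; first by rewrite hinge_kernel_diag; ring.
apply: (mulfI (_ : 2 != 0)); first by rewrite pnatr_eq0.
by rewrite hsym3_diag w0.
Qed.

End HingeKernelIntegral.

Section CubicTrace.
Variables (R : realType) (d : nat).
Local Notation C := R[i].

Let lt0C (x : R) : (0 < x%:C%C :> C) = (0 < x).
Proof. by rewrite ltcE /= eqxx. Qed.

Lemma hinge_oneC_real (p q r : R) :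
  hinge_one p%:C%C q%:C%C r%:C%C = (hinge_one p q r)%:C%C :> C.
Proof.
rewrite /hinge_one !lt0C [RHS]rmorphM/= rmorph_nat fmorph_div/= rmorphXn/=.
by rewrite [in RHS]rmorphM/= !rmorphB.
Qed.

Lemma hinge_twoC_real (p q r : R) :
  hinge_two p%:C%C q%:C%C r%:C%C = (hinge_two p q r)%:C%C :> C.
Proof.
rewrite /hinge_two !lt0C [RHS]rmorphM/= rmorph_nat; congr (_ * _).
rewrite [RHS]rmorphB/= rmorph1 fmorph_div/= rmorphXn/=.
by rewrite [in RHS]rmorphM/= !rmorphB.
Qed.

Lemma hinge_kernelC_real (p q r : R) :
  hinge_kernel p%:C%C q%:C%C r%:C%C = (hinge_kernel p q r)%:C%C :> C.
Proof.
rewrite /hinge_kernel !lt0C !hinge_oneC_real !hinge_twoC_real.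
by rewrite -!rmorphD/= [RHS]rmorphD/= [in RHS]rmorphD/= rmorph_nat -addrA -rmorphD.
Qed.

(** The third-order case of the BMV conjecture, for powers: all third
  derivatives of [t |-> tr (N + t A) ^ K] are nonnegative. *)
Lemma cyc_sum_hsym3_ge0 (A : 'M[C]_d) (nu : 'I_d -> R) m :
  psdC A -> (forall i, 0 <= nu i) ->
  0 <= complex.Re (cyc_sum A (fun i j k => (hsym3 m.+1 (nu i) (nu j) (nu k))%:C%C)).
Proof.
move=> pA nu0; pose L := \sum_i nu i.
have nuL i : nu i <= L by rewrite /L (bigD1 i)//= lerDl sumr_ge0.
pose a i j k := complex.Re (A i j * A j k * A k i).
have ReM (z : C) (t : R) : complex.Re (z * t%:C%C) = complex.Re z * t.
  by case: z => x y /=; rewrite mulr0 subr0.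
have Re_cyc (f : 'I_d -> 'I_d -> 'I_d -> R) :
    complex.Re (cyc_sum A (fun i j k => (f i j k)%:C%C)) = \sum_i \sum_j \sum_k a i j k * f i j k.
  rewrite /cyc_sum raddf_sum; apply: eq_bigr => i _; rewrite raddf_sum; apply: eq_bigr => j _.
  by rewrite raddf_sum; apply: eq_bigr => k _; exact: ReM.
rewrite Re_cyc.
(* The integrand is nonnegative pointwise: for each [x] it is a cyclic sum with the hinge kernel at
   the real, possibly negative, numbers [nu i - x]. *)
apply: (@has_int_ge0 R L (fun x => (m.+1 * m.+2 * m.+3)%:R / 2 * x ^+ m *
  \sum_i \sum_j \sum_k a i j k * hinge_kernel (nu i - x) (nu j - x) (nu k - x))).
  move=> x x0; rewrite mulr_ge0// ?mulr_ge0 ?exprn_ge0//.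
  rewrite -Re_cyc; under eq_cyc_sum do rewrite -hinge_kernelC_real.
  have : 0 <= cyc_sum A (fun i j k => hinge_kernel (nu i - x)%:C%C (nu j - x)%:C%C (nu k - x)%:C%C).
    by apply: (cyc_sum_hinge_ge0 (c := fun i => (nu i - x)%:C%C)) => // i; apply/complex_realP; eexists.
  by rewrite lecE => /andP[].
apply: (eq_has_int (f := fun x => \sum_i \sum_j \sum_k a i j k *
   ((m.+1 * m.+2 * m.+3)%:R / 2 * x ^+ m * hinge_kernel (nu i - x) (nu j - x) (nu k - x)))).
- move=> x; rewrite mulr_sumr; apply: eq_bigr => i _; rewrite mulr_sumr.
  by apply: eq_bigr => j _; rewrite mulr_sumr; apply: eq_bigr => k _; rewrite mulrCA.
- reflexivity.
do 3!apply: has_int_sum => ?.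
by apply: has_intZ; exact: has_int_hinge_kernel.
Qed.

End CubicTrace.

(** * Derivatives of traces of matrix powers *)

Section MatrixPolynomial.
Variables (F : fieldType) (d : nat).
Local Notation mxpoly := 'M[{poly F}]_d.
Implicit Types (X Y : mxpoly).

Definition deriv_mx X : mxpoly := map_mx (@deriv F) X.

Lemma deriv_mxM X Y : deriv_mx (X * Y) = deriv_mx X * Y + X * deriv_mx Y.
Proof.
apply/matrixP => i j; rewrite !mxE raddf_sum -big_split; apply: eq_bigr => k _ /=.
by rewrite !mxE derivM.
Qed.

Lemma deriv_mx1 : deriv_mx 1 = 0.
Proof. by apply/matrixP => i j; rewrite !mxE; case: (i == j); rewrite ?derivC. Qed.

Lemma deriv_mxXn X n : deriv_mx (X ^+ n.+1) = \sum_(i < n.+1) X ^+ i * deriv_mx X * X ^+ (n - i).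
Proof.
elim: n => [|n IH]; first by rewrite big_ord1 /= expr0 mul1r mulr1 expr1.
rewrite exprS deriv_mxM IH [RHS]big_ord_recl /= mul1r subn0; congr (_ + _).
rewrite mulr_sumr; apply: eq_bigr => i _.
by rewrite /bump /= add1n exprS !mulrA subSS.
Qed.

Lemma deriv_mxtrace X : (\tr X)^`() = \tr (deriv_mx X).
Proof. by rewrite /mxtrace raddf_sum; apply: eq_bigr => i _; rewrite /= mxE. Qed.

Variables (N0 E0 : 'M[F]_d).
Let E : mxpoly := map_mx polyC E0.
Let X : mxpoly := map_mx polyC N0 + 'X *: E.

(** Working over [{poly F}] makes differentiation in the parameter purely algebraic; values are
    recovered by evaluation. *)
Definition trpow n : {poly F} := \tr (X ^+ n).

Let dE : deriv_mx E = 0.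
Proof. by apply/matrixP => i j; rewrite !mxE derivC. Qed.

Let dX : deriv_mx X = E.
Proof. by apply/matrixP => i j; rewrite !mxE derivD derivM derivX !derivC mul1r mulr0 add0r addr0. Qed.

Let mxtraceC (Y Z : mxpoly) : \tr (Y * Z) = \tr (Z * Y).
Proof. exact: mxtrace_mulC. Qed.

Lemma deriv_trpow n : (trpow n.+1)^`() = n.+1%:R * \tr (E * X ^+ n).
Proof.
rewrite deriv_mxtrace deriv_mxXn dX raddf_sum /=.
transitivity (\sum_(i < n.+1) \tr (E * X ^+ n)); last by rewrite sumr_const card_ord mulr_natl.
apply: eq_bigr => i _.
by rewrite -mulrA (mxtraceC (X ^+ i)) -mulrA -exprD subnK// -ltnS.
Qed.

Lemma deriv2_trpow n : (trpow n.+2)^`(2) =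
  n.+2%:R * \sum_(i < n.+1) \tr (E * X ^+ i * E * X ^+ (n - i)).
Proof.
rewrite derivnS derivn1 deriv_trpow mulr_natl derivMn -[LHS]mulr_natl; congr (_ * _).
rewrite deriv_mxtrace deriv_mxM dE mul0r add0r deriv_mxXn dX mulr_sumr raddf_sum /=.
by apply: eq_bigr => i _; rewrite !mulrA.
Qed.

(** The last derivative falls on either of the two powers of [X] in [deriv2_trpow]. A term with an
    empty power contributes nothing, which shifts the ranges. *)
Lemma deriv3_trpow n : (trpow n.+3)^`(3) =
  n.+3%:R * (\sum_(i < n.+1) \sum_(j < i.+1) \tr (E * X ^+ j * E * X ^+ (i - j) * E * X ^+ (n - i))
    + \sum_(i < n.+1) \sum_(j < (n - i).+1) \tr (E * X ^+ i * E * X ^+ j * E * X ^+ (n - i - j))).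
Proof.
rewrite derivnS deriv2_trpow mulr_natl derivMn -[LHS]mulr_natl raddf_sum/=; congr (_ * _).
under eq_bigr do rewrite deriv_mxtrace deriv_mxM deriv_mxM deriv_mxM dE mul0r add0r mulr0 addr0 raddfD/=.
rewrite big_split /=; congr (_ + _).
  rewrite big_ord_recl /= [in X in X + _](_ : deriv_mx (X ^+ 0) = 0) ?expr0 ?deriv_mx1//.
  rewrite mulr0 !mul0r mxtrace0 add0r; apply: eq_bigr => i _.
  rewrite /bump /= add1n deriv_mxXn dX mulr_sumr !mulr_suml raddf_sum /= subSS.
  by apply: eq_bigr => j _; rewrite !mulrA.
rewrite big_ord_recr /= subnn expr0 deriv_mx1 mulr0 mxtrace0 addr0.
apply: eq_bigr => i _; rewrite (subSn (ltn_ord i : (i <= n)%N)) deriv_mxXn dX mulr_sumr raddf_sum /=.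
by apply: eq_bigr => j _; rewrite !mulrA.
Qed.

End MatrixPolynomial.

Section EigenTrace.
Variables (R : realType) (d : nat).
Local Notation C := R[i].
Implicit Types (A B M N U : 'M[C]_d).

Definition spectral_of M U (lam : 'I_d -> R) : Prop :=
  U \is unitarymx /\ U *m M *m U ^t* = diag_mx (\row_i (lam i)%:C%C).

Lemma unitary_adjM U : U \is unitarymx -> U ^t* *m U = 1%:M.
Proof. by move=> uU; rewrite -invmx_unitary// mulVmx// unitarymx_unit. Qed.

Lemma spectral_ofP M : M ^t* = M -> exists U lam, spectral_of M U lam.
Proof.
move=> hM; exists (spectralmx M).
have nM : M \is normalmx by apply/normalmxP; rewrite hM.
have hH : M \is hermsymmx.
  by apply/is_hermitianmxP; rewrite expr0 scale1r hM.
have := hermitian_spectral_diag_real hH => /mxOverP re.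
exists (fun i => complex.Re (spectral_diag M 0 i)); split; first exact: spectral_unitarymx.
have uS := spectral_unitarymx M.
have := orthomx_spectralP nM; rewrite invmx_unitary//.
move: (spectralmx M) uS (spectral_diag M) re => P uP D re ->.
rewrite !mulmxA (unitarymxP uP) mul1mx -mulmxA (unitarymxP uP) mulmx1; congr diag_mx.
by apply/rowP => i; rewrite mxE RRe_real.
Qed.

Lemma trace_conj U M : U \is unitarymx -> \tr (U *m M *m U ^t*) = \tr M.
Proof. by move=> uU; rewrite mxtrace_mulC mulmxA unitary_adjM// mul1mx. Qed.

Lemma conjM U M N : U \is unitarymx ->
  U *m (M *m N) *m U ^t* = (U *m M *m U ^t*) *m (U *m N *m U ^t*).
Proof.
move=> /unitary_adjM; move: (U ^t*) => V VU.
by rewrite -[RHS]mulmxA (mulmxA V) (mulmxA V) VU mul1mx !mulmxA.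
Qed.

Lemma conjX U M n : U \is unitarymx -> U *m (M ^+ n) *m U ^t* = (U *m M *m U ^t*) ^+ n.
Proof.
move=> uU; elim: n => [|n IH]; first by rewrite !expr0 mulmx1; exact/unitarymxP.
by rewrite [RHS]exprS -IH exprS; exact: conjM.
Qed.

Lemma diag_mxX (r : 'I_d -> C) n : diag_mx (\row_i r i) ^+ n = diag_mx (\row_i r i ^+ n).
Proof.
elim: n => [|n IH].
  by rewrite expr0; apply/matrixP => i j; rewrite !mxE expr0; case: (i == j).
rewrite exprS IH -[LHS]/(_ *m _) mulmx_diag; congr diag_mx.
by apply/rowP => i; rewrite !mxE exprS.
Qed.

Section Powers.
Variables (N E U : 'M[C]_d) (nu : 'I_d -> R).
Hypothesis sN : spectral_of N U nu.
Let E' := U *m E *m U ^t*.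

Lemma trace_pow_eigen n : \tr (N ^+ n) = \sum_i ((nu i) ^+ n)%:C%C.
Proof.
have [uU dN] := sN.
rewrite -(trace_conj _ uU) conjX// dN diag_mxX mxtrace_diag.
by apply: eq_bigr => i _; rewrite mxE rmorphXn.
Qed.

Lemma trace_word2_eigen a b :
  \tr (E * N ^+ a * E * N ^+ b) = \sum_i \sum_j E' i j * E' j i * (nu j ^+ a * nu i ^+ b)%:C%C.
Proof.
have [uU dN] := sN.
rewrite -(trace_conj _ uU) -[E * _ * E * _]/(E *m _ *m E *m _) !conjM// !conjX// dN !diag_mxX.
rewrite -mulmxA !mul_mx_diag; apply: eq_bigr => i _; rewrite !mxE; apply: eq_bigr => j _.
by rewrite !mxE rmorphM !rmorphXn /=; ring.
Qed.

Lemma trace_word3_eigen a b c :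
  \tr (E * N ^+ a * E * N ^+ b * E * N ^+ c) =
  cyc_sum E' (fun i j k => (nu j ^+ a * nu k ^+ b * nu i ^+ c)%:C%C).
Proof.
have [uU dN] := sN.
rewrite -(trace_conj _ uU) -[E * _ * E * _ * E * _]/(E *m _ *m E *m _ *m E *m _).
rewrite !conjM// !conjX// dN !diag_mxX -/E'.
have assoc (X Y Z : 'M[C]_d) :
    E' *m X *m E' *m Y *m E' *m Z = (E' *m X) *m (E' *m Y) *m (E' *m Z) by rewrite !mulmxA.
rewrite assoc !mul_mx_diag -[LHS]/(tr _) tr3E /cyc_sum.
apply: eq_bigr => i _; apply: eq_bigr => j _; apply: eq_bigr => k _.
by rewrite !mxE !rmorphM !rmorphXn /=; ring.
Qed.

End Powers.

End EigenTrace.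

Section TracePowerDerivatives.
Variables (R : realType) (d : nat).
Local Notation C := R[i].
Implicit Types (A B M N U E : 'M[C]_d).

Section Evaluation.
Variables (N0 E0 : 'M[C]_d) (x : C).
Let h := @horner_eval C x.
Let X : 'M[{poly C}]_d := map_mx polyC N0 + 'X *: map_mx polyC E0.
Let N : 'M[C]_d := N0 + x *: E0.

Let hX : map_mx h X = N.
Proof. by apply/matrixP => i j; rewrite !mxE /h /horner_eval !hornerE. Qed.

Let hE : map_mx h (map_mx polyC E0) = E0.
Proof. by apply/matrixP => i j; rewrite !mxE /h /horner_eval !hornerE. Qed.

Let hM (Y Z : 'M[{poly C}]_d) : map_mx h (Y * Z) = map_mx h Y * map_mx h Z.
Proof. exact: map_mxM. Qed.

Let hXn n : map_mx h (X ^+ n) = N ^+ n.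
Proof. by elim: n => [|n IH]; rewrite ?expr0 ?map_mx1// !exprS hM hX IH. Qed.

Let htr (Y : 'M[{poly C}]_d) : (\tr Y).[x] = \tr (map_mx h Y).
Proof. by rewrite trace_map_mx. Qed.

Lemma horner_trpow n : (trpow N0 E0 n).[x] = \tr (N ^+ n).
Proof. by rewrite htr hXn. Qed.

Lemma horner_deriv2_trpow n : ((trpow N0 E0 n.+2)^`(2)).[x] =
  n.+2%:R * \sum_(i < n.+1) \tr (E0 * N ^+ i * E0 * N ^+ (n - i)).
Proof.
rewrite deriv2_trpow hornerM -polyC_natr hornerC horner_sum; congr (_ * _).
by apply: eq_bigr => i _; rewrite htr !hM !hXn hE.
Qed.

Lemma horner_deriv3_trpow n (U : 'M[C]_d) nu : spectral_of N U nu ->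
  ((trpow N0 E0 n.+3)^`(3)).[x] =
  n.+3%:R * (2 * cyc_sum (U *m E0 *m U ^t*) (fun i j k => (hsym3 n (nu i) (nu j) (nu k))%:C%C)).
Proof.
move=> sN; rewrite deriv3_trpow hornerM -polyC_natr hornerC; congr (_ * _).
rewrite hornerD !horner_sum mulr2n mulrDl mul1r.
set A := U *m E0 *m U ^t*.
have cyc_sum_big m (f : 'I_m -> 'I_d -> 'I_d -> 'I_d -> C) :
    \sum_(i < m) cyc_sum A (f i) = cyc_sum A (fun a b c => \sum_(i < m) f i a b c).
  rewrite /cyc_sum exchange_big; apply: eq_bigr => a _ /=.
  rewrite exchange_big; apply: eq_bigr => b _ /=.
  by rewrite exchange_big; apply: eq_bigr => c _ /=; rewrite mulr_sumr.
congr (_ + _).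
  under eq_bigr => i _.
    rewrite horner_sum; under eq_bigr do rewrite htr !hM !hXn hE (trace_word3_eigen E0 sN).
    rewrite cyc_sum_big; over.
  rewrite cyc_sum_big; apply: eq_cyc_sum => a b c.
  rewrite /hsym3 (reindex_inj rev_ord_inj) rmorph_sum; apply: eq_bigr => i _ /=.
  rewrite subSS /hsym2 mulr_sumr rmorph_sum subKn; last by rewrite -ltnS.
  by apply: eq_bigr => j _; rewrite mulrC.
(* The second family of words matches [hsym3] after one cyclic rotation of the indices, so both
   families give the same sum. *)
rewrite -cyc_sumC.
under eq_bigr => i _.
  rewrite horner_sum; under eq_bigr do rewrite htr !hM !hXn hE (trace_word3_eigen E0 sN).
  rewrite cyc_sum_big; over.
rewrite cyc_sum_big; apply: eq_cyc_sum => a b c.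
rewrite /hsym3 rmorph_sum; apply: eq_bigr => i _ /=.
rewrite /hsym2 mulr_sumr rmorph_sum.
by apply: eq_bigr => j _; rewrite mulrA.
Qed.

End Evaluation.

Definition real_part_poly (p : {poly C}) : {poly R} := map_poly (@complex.Re R) p.

Let coef_real_part p i : (real_part_poly p)`_i = complex.Re p`_i.
Proof. by rewrite coef_map_id0. Qed.

Lemma horner_real_part (p : {poly C}) (x : R) : (real_part_poly p).[x] = complex.Re p.[x%:C%C].
Proof.
have sz : (size (real_part_poly p) <= size p)%N by exact: size_poly.
rewrite (horner_coef_wide _ sz) horner_coef raddf_sum; apply: eq_bigr => i _ /=.
by rewrite coef_real_part -rmorphXn/=; case: (p`_i) => a b /=; rewrite mulr0 subr0.
Qed.

Lemma deriv_real_part p : (real_part_poly p)^`() = real_part_poly p^`().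
Proof. by apply/polyP => i; rewrite coef_deriv !coef_real_part coef_deriv raddfMn. Qed.

Lemma derivn_real_part p n : (real_part_poly p)^`(n) = real_part_poly p^`(n).
Proof. by elim: n => // n IH; rewrite !derivnS IH deriv_real_part. Qed.

End TracePowerDerivatives.

Section FrobeniusBound.
Variables (R : realType) (d : nat).
Local Notation C := R[i].
Implicit Types (A B M N U E : 'M[C]_d).

Definition frob A : R := Num.sqrt (complex.Re (\tr (A *m A ^t*))).

Lemma frob_ge0 A : 0 <= frob A. Proof. exact: sqrtr_ge0. Qed.

Lemma frob_entry A i j : `|A i j| <= (frob A)%:C%C.
Proof.
have AA : \tr (A *m A ^t*) = \sum_i \sum_j `|A i j| ^+ 2.
  by do 2!(rewrite ?mxE; apply: eq_bigr => ? _); rewrite !mxE -normCK.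
have le1 : `|A i j| ^+ 2 <= \tr (A *m A ^t*).
  rewrite AA (bigD1 i)//= (bigD1 j)//= -addrA lerDl addr_ge0//.
    by apply: sumr_ge0 => k _; rewrite exprn_ge0.
  by do 2!(apply: sumr_ge0 => ? _); rewrite exprn_ge0.
have tr_real : \tr (A *m A ^t*) = (complex.Re (\tr (A *m A ^t*)))%:C%C.
  rewrite RRe_real// ger0_real// AA sumr_ge0// => k _.
  by rewrite sumr_ge0// => l _; rewrite exprn_ge0.
have n0 : 0 <= complex.Re (\tr (A *m A ^t*)).
  by rewrite -ler0c -tr_real; apply: le_trans le1; rewrite exprn_ge0.
rewrite -(@ler_pXn2r _ 2)// ?nnegrE ?ler0c ?frob_ge0//.
suff -> : (frob A)%:C%C ^+ 2 = \tr (A *m A ^t*) by [].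
rewrite tr_real -rmorphXn; congr (_%:C%C); exact: sqr_sqrtr.
Qed.

Lemma frob_conj A U : U \is unitarymx -> frob (U *m A *m U ^t*) = frob A.
Proof.
move=> uU; rewrite /frob !adj_mulmx trmxCK.
have -> : U *m A *m U ^t* *m (U *m (A ^t* *m U ^t*)) = U *m (A *m A ^t*) *m U ^t*.
  by rewrite conjM// !mulmxA.
by rewrite trace_conj.
Qed.

Lemma Re_le_norm (z : C) : `|complex.Re z| %:C%C <= `|z|.
Proof.
case: z => a b; rewrite normc_def lecR /= -sqrtr_sqr ler_wsqrtr// lerDl sqr_ge0 //.
Qed.

End FrobeniusBound.

(** * Sign and size of the derivatives of the trace of (1 - M / K)^K *)

Section TraceResolventPower.
Variables (R : realType) (d : nat).
Local Notation C := R[i].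
Implicit Types (M U : 'M[C]_d).

Lemma ReMr (a : R) (z : C) : complex.Re (a%:C%C * z) = a * complex.Re z.
Proof. by case: z => x y /=; rewrite mul0r subr0. Qed.

Lemma hsym2_bound (v p q : R) n : 0 <= p <= v -> 0 <= q <= v ->
  0 <= hsym2 n p q <= n.+1%:R * v ^+ n.
Proof.
move=> /andP[p0 pv] /andP[q0 qv]; apply/andP; split.
  by apply: sumr_ge0 => i _; rewrite mulr_ge0 ?exprn_ge0.
have v0 : 0 <= v by exact: le_trans pv.
have -> : n.+1%:R * v ^+ n = \sum_(i < n.+1) v ^+ n by rewrite sumr_const card_ord mulr_natl.
apply: ler_sum => i _; rewrite -[in leRHS](@subnKC i n); last by rewrite -ltnS.
by rewrite exprD ler_pM ?exprn_ge0// lerXn2r ?nnegrE.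
Qed.

Lemma hsym3_bound (v p q r : R) n : 0 <= p <= v -> 0 <= q <= v -> 0 <= r <= v ->
  0 <= hsym3 n p q r <= n.+1%:R ^+ 2 * v ^+ n.
Proof.
move=> pv qv rv; have h k := hsym2_bound k qv rv.
have /andP[p0 pv'] := pv; have v0 : 0 <= v by exact: le_trans pv'.
apply/andP; split.
  by apply: sumr_ge0 => i _; rewrite mulr_ge0 ?exprn_ge0//; case/andP: (h (n - i)%N).
have -> : n.+1%:R ^+ 2 * v ^+ n = \sum_(i < n.+1) n.+1%:R * v ^+ n.
  by rewrite sumr_const card_ord -[RHS]mulr_natl mulrA -expr2.
apply: ler_sum => i _; have /andP[h0 h1] := h (n - i)%N.
apply: (@le_trans _ _ (v ^+ i * (n.+1%:R * v ^+ (n - i)))).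
  rewrite ler_pM ?exprn_ge0// ?lerXn2r ?nnegrE//.
  by apply: le_trans h1 _; rewrite ler_wpM2r ?exprn_ge0// ler_nat ltnS leq_subr.
by rewrite mulrCA -exprD subnKC// -ltnS.
Qed.

Lemma cyc_sumZ (a : C) (A : 'M[C]_d) f : cyc_sum (a *: A) f = a ^+ 3 * cyc_sum A f.
Proof.
rewrite /cyc_sum mulr_sumr; apply: eq_bigr => i _; rewrite mulr_sumr.
apply: eq_bigr => j _; rewrite mulr_sumr; apply: eq_bigr => k _.
by rewrite !mxE; ring.
Qed.

Lemma cyc_sum_norm (al c : R) (A : 'M[C]_d) f : 0 <= al ->
  (forall i j, `|A i j| <= al%:C%C) -> (forall i j k, `|f i j k| <= c%:C%C) ->
  `|cyc_sum A f| <= (d%:R ^+ 3 * al ^+ 3 * c)%:C%C.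
Proof.
move=> al0 Aal fc; rewrite /cyc_sum.
have -> : (d%:R ^+ 3 * al ^+ 3 * c)%:C%C =
   \sum_(i < d) \sum_(j < d) \sum_(k < d) (al%:C%C * al%:C%C * al%:C%C * c%:C%C) :> C.
  by rewrite !sumr_const card_ord -!mulrnA -[RHS]mulr_natl !natrM !rmorphM/= !rmorph_nat; ring.
apply: le_trans (ler_norm_sum _ _ _) _; apply: ler_sum => i _.
apply: le_trans (ler_norm_sum _ _ _) _; apply: ler_sum => j _.
apply: le_trans (ler_norm_sum _ _ _) _; apply: ler_sum => k _.
by rewrite !normrM !ler_pM// !mulr_ge0.
Qed.

Variables (A B : 'M[C]_d).
Hypotheses (hB : B ^t* = B) (pA : psdC A).

Definition pencil (x : R) : 'M[C]_d := B + x%:C%C *: A.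

Lemma adj_pencil x : (pencil x) ^t* = pencil x.
Proof.
have [hA _] := pA; rewrite adj_mxD hB; congr (_ + _).
apply/matrixP => i j; rewrite -[in RHS]hA !mxE rmorphM; congr (_ * _).
exact: conjc_real.
Qed.

(** The second bound is one-sided: for [x >= 0] the psd term cannot lower the spectrum, so only
    negative [x] costs something. This later keeps the Taylor remainder bounded along the
    nonnegative variable [W], which has only two moments. *)
Lemma pencil_spectrum x U lam i : spectral_of (pencil x) U lam ->
  `|lam i| <= frob B + `|x| * frob A /\ - lam i <= frob B + Num.max (- x) 0 * frob A.
Proof.
move=> [uU dU].
have lamE : (lam i)%:C%C = (U *m B *m U ^t*) i i + x%:C%C * (U *m A *m U ^t*) i i.
  have -> : (lam i)%:C%C = (U *m pencil x *m U ^t*) i i by rewrite dU !mxE eqxx mulr1n.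
  by rewrite /pencil mulmxDr mulmxDl -scalemxAr -scalemxAl mxE [in X in _ + X]mxE.
pose b := complex.Re ((U *m B *m U ^t*) i i); pose a := complex.Re ((U *m A *m U ^t*) i i).
have lamE' : lam i = b + x * a.
  by have := congr1 (@complex.Re R) lamE; rewrite /= raddfD/= ReMr.
have bB : `|b| <= frob B.
  by rewrite -lecR; apply: le_trans (Re_le_norm _) _; rewrite -(frob_conj B uU); exact: frob_entry.
have aA : `|a| <= frob A.
  by rewrite -lecR; apply: le_trans (Re_le_norm _) _; rewrite -(frob_conj A uU); exact: frob_entry.
have a0 : 0 <= a.
  by have := psdC_diag i (psdC_congr' U pA); rewrite lecE => /andP[].
rewrite lamE' {lamE lamE' dU uU}; move: (frob A) (frob B) b a bB aA a0 => fA fB b a bB aA a0.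
have afA : a <= fA by exact: le_trans (ler_norm a) aA.
split.
  by apply: (le_trans (ler_normD _ _)); rewrite normrM; apply: lerD => //; exact: ler_wpM2l.
rewrite opprD; apply: lerD; first by apply: le_trans bB; rewrite -normrN; exact: ler_norm.
have m0 : 0 <= Num.max (- x) 0 by rewrite le_max lexx orbT.
rewrite -mulNr; apply: (@le_trans _ _ (Num.max (- x) 0 * a)); last exact: ler_wpM2l.
by apply: ler_wpM2r => //; rewrite le_max lexx.
Qed.

(** In the exponent [n.+4], three factors are consumed by the third derivative; the remaining degree
    [n.+1] is positive, as [cyc_sum_hsym3_ge0] requires. *)
Definition respow n : {poly R} :=
  real_part_poly (trpow (1%:M - (n.+4%:R^-1)%:C%C *: B) (- (n.+4%:R^-1)%:C%C *: A) n.+4).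

Variables (n : nat) (x : R) (U : 'M[C]_d) (lam : 'I_d -> R).
Hypothesis sM : spectral_of (pencil x) U lam.
Let k : R := n.+4%:R^-1.
Let nu i := 1 - k * lam i.
Let N : 'M[C]_d := (1%:M - k%:C%C *: B) + x%:C%C *: (- k%:C%C *: A).

Let sN : spectral_of N U nu.
Proof.
have [uU dU] := sM; split=> //.
have -> : N = 1%:M - k%:C%C *: pencil x.
  apply/matrixP => i j; rewrite /N /pencil !mxE; ring.
rewrite mulmxBr mulmxBl mulmx1 (unitarymxP uU) -scalemxAr -scalemxAl dU.
apply/matrixP => i j; rewrite !mxE; case: (i == j); rewrite ?mulr1n ?mulr0n ?mulr0 ?subrr//.
by rewrite /nu rmorphB rmorphM rmorph1.
Qed.

Lemma horner_respow : (respow n).[x] = \sum_i (1 - lam i / n.+4%:R) ^+ n.+4.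
Proof.
rewrite /respow horner_real_part horner_trpow (trace_pow_eigen sN) raddf_sum /=.
by apply: eq_bigr => i _; rewrite /nu [k * _]mulrC.
Qed.

(** Makes the eigenvalues [nu i] of [N] nonnegative; for [x] in a bounded set it holds as soon as
    [n] is large. *)
Hypothesis lamK : forall i, lam i <= n.+4%:R.

Let nu0 i : 0 <= nu i.
Proof. by rewrite subr_ge0 /k mulrC ler_pdivrMr ?ltr0n// mul1r. Qed.

Lemma deriv2_respow_ge0 : 0 <= ((respow n)^`(2)).[x].
Proof.
have [uU dU] := sM; have [hA _] := pA.
rewrite /respow derivn_real_part horner_real_part horner_deriv2_trpow.
rewrite -(rmorph_nat (real_complex R)) ReMr mulr_ge0// raddf_sum /=.
apply: sumr_ge0 => i _; rewrite (trace_word2_eigen _ sN) raddf_sum; apply: sumr_ge0 => a _.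
rewrite raddf_sum; apply: sumr_ge0 => b _ /=.
rewrite mulrC ReMr mulr_ge0// ?mulr_ge0 ?exprn_ge0//.
rewrite -scalemxAr -scalemxAl; set A' := U *m A *m U ^t*.
have hA' : A' ^t* = A' by rewrite /A' !adj_mulmx trmxCK hA mulmxA.
have -> : (- k%:C%C *: A') a b * (- k%:C%C *: A') b a = (k ^+ 2)%:C%C * `|A' a b| ^+ 2.
  have Aba : A' b a = (A' a b)^* by rewrite -[in LHS]hA' !mxE.
  have sE (c : C) (Y : 'M[C]_d) i' j : (c *: Y) i' j = c * Y i' j by rewrite mxE.
  by rewrite !sE Aba normCK expr2 rmorphM /=; ring.
rewrite ReMr mulr_ge0 ?sqr_ge0//.
by have : 0 <= `|A' a b| ^+ 2 by [rewrite exprn_ge0]; rewrite lecE => /andP[].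
Qed.

(** The coefficient is the exponent [k^-1] from differentiating, times 2, times [(- k) ^+ 3] from
    the scaled direction [- k *: A]. *)
Let deriv3E : ((respow n)^`(3)).[x] = - (2 * k ^+ 2) * complex.Re
   (cyc_sum (U *m A *m U ^t*) (fun a b c => (hsym3 n.+1 (nu a) (nu b) (nu c))%:C%C)).
Proof.
rewrite /respow derivn_real_part horner_real_part (horner_deriv3_trpow _ sN).
rewrite -scalemxAr -scalemxAl cyc_sumZ -(rmorph_nat (real_complex R) n.+4).
rewrite (_ : _ * (2 * _) = (- (2 * k ^+ 2))%:C%C *
  (cyc_sum (U *m A *m U ^t*) (fun a b c => (hsym3 n.+1 (nu a) (nu b) (nu c))%:C%C))) ?ReMr//.
rewrite mulrA mulrA; congr (_ * _).
rewrite exprNn -(rmorph_nat (real_complex R) 2) -rmorphXn/= -signr_odd/= expr1 mulN1r mulrN.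
rewrite rmorphN -!rmorphM/=; congr (- (_%:C%C)).
have kn : k * n.+4%:R = 1 by rewrite mulVf ?pnatr_eq0.
transitivity (2 * k ^+ 2 * (k * n.+4%:R)); last by rewrite kn mulr1.
ring.
Qed.

Lemma deriv3_respow_le0 : ((respow n)^`(3)).[x] <= 0.
Proof.
have [uU dU] := sM.
rewrite deriv3E mulNr oppr_le0; apply: mulr_ge0; first by rewrite mulr_ge0 ?sqr_ge0.
exact: (cyc_sum_hsym3_ge0 n (psdC_congr' U pA) nu0).
Qed.

(** Each [nu i] is at most [expR (k * La)], whose power [n.+1] stays below [expR La]; the square of
    [n.+4] that bounds the number of monomials cancels [k ^+ 2]. Hence the bound does not depend on
    [n]. *)
Lemma deriv3_respow_ge :
  - (2 * d%:R ^+ 3 * frob A ^+ 3 * expR (frob B + Num.max (- x) 0 * frob A))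
  <= ((respow n)^`(3)).[x].
Proof.
have [uU dU] := sM.
pose La := frob B + Num.max (- x) 0 * frob A.
have La0 : 0 <= La by rewrite addr_ge0 ?frob_ge0// mulr_ge0 ?frob_ge0// le_max lexx orbT.
have k0 : 0 < k by rewrite invr_gt0 ltr0n.
have nuv i : 0 <= nu i <= expR (k * La).
  rewrite nu0/= /nu; apply: le_trans (expR_ge1Dx _); rewrite lerD2l -mulrN ler_wpM2l ?(ltW k0)//.
  by have [] := pencil_spectrum i sM.
have hb a b c : `|(hsym3 n.+1 (nu a) (nu b) (nu c))%:C%C| <= (n.+4%:R ^+ 2 * expR La)%:C%C :> C.
  have /andP[h0 h1] := hsym3_bound n.+1 (nuv a) (nuv b) (nuv c).
  rewrite ger0_norm ?ler0c// lecR; apply: le_trans h1 _; apply: ler_pM; rewrite ?exprn_ge0 ?expR_ge0//.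
    by rewrite lerXn2r ?nnegrE ?ler0n// ler_nat -(addn2 n.+2) leq_addr.
  rewrite -expRM_natl ler_expR mulrA ler_piMl// /k ler_pdivrMr ?ltr0n// mul1r ler_nat.
  by rewrite -(addn3 n.+1) leq_addr.
have Aal i j : `|(U *m A *m U ^t*) i j| <= (frob A)%:C%C.
  by rewrite -(frob_conj A uU) frob_entry.
have := cyc_sum_norm (frob_ge0 A) Aal hb; move: (cyc_sum _ _) deriv3E => z -> zb.
have : complex.Re z <= d%:R ^+ 3 * frob A ^+ 3 * (n.+4%:R ^+ 2 * expR La).
  by apply: le_trans (ler_norm _) _; rewrite -lecR; apply: le_trans (Re_le_norm _) zb.
rewrite mulNr lerN2 -/La.
have kn : k * n.+4%:R = 1 by rewrite mulVf ?pnatr_eq0.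
have -> : 2 * d%:R ^+ 3 * frob A ^+ 3 * expR La =
  2 * k ^+ 2 * (d%:R ^+ 3 * frob A ^+ 3 * (n.+4%:R ^+ 2 * expR La)).
  transitivity (2 * d%:R ^+ 3 * frob A ^+ 3 * expR La * (k * n.+4%:R) ^+ 2).
    by rewrite kn expr1n mulr1.
  ring.
by apply: ler_wpM2l; rewrite mulr_ge0 ?sqr_ge0.
Qed.

End TraceResolventPower.

(** * The trace exponential *)

Section PolynomialTaylor.
Variable R : realType.
Implicit Types (g p : {poly R}) (a b w x y c : R).

Lemma poly_ge_mono g a b : a <= b -> (forall s, a <= s <= b -> 0 <= g^`().[s]) -> g.[a] <= g.[b].
Proof.
rewrite le_eqVlt => /predU1P[->//|ab] g0.
have [s] := poly_mvt g ab; rewrite in_itv/= => /andP[/ltW as_ /ltW sb] e.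
by rewrite -subr_ge0 e mulr_ge0 ?g0 ?as_ ?subr_ge0 ?(ltW ab).
Qed.

(** Subtract the Taylor polynomial: the remainder and its first two derivatives vanish at 0, and
    monotonicity is used three times. *)
Lemma poly_ge_taylor3 g w : 0 <= w -> (forall s, 0 <= s <= w -> 0 <= (g^`(3)).[s]) ->
  g.[0] + w * g^`().[0] + w ^+ 2 / 2 * (g^`(2)).[0] <= g.[w].
Proof.
move=> w0 g3.
pose g2 : {poly R} := g^`(2) - (g^`(2)).[0]%:P.
pose g1 : {poly R} := g^`() - (g^`()).[0]%:P - (g^`(2)).[0] *: 'X.
pose g0 : {poly R} := g - g.[0]%:P - (g^`()).[0] *: 'X - ((g^`(2)).[0] / 2) *: 'X^2.
have d2 : g2^`() = g^`(3) by rewrite derivB derivC subr0.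
have d1 : g1^`() = g2 by rewrite !derivB derivC subr0 derivZ derivX alg_polyC.
have d0 : g0^`() = g1.
  rewrite !derivB derivC subr0 !derivZ derivX derivXn /= expr1 alg_polyC -scalerMnr scalerMnl.
  by rewrite -mulr_natr divfK.
have h2 s : 0 <= s <= w -> 0 <= g2.[s].
  move=> /andP[s0 sw]; have -> : 0 = g2.[0] by rewrite !hornerE; ring.
  by apply: poly_ge_mono => // t /andP[t0 ts]; rewrite d2 g3// t0 (le_trans ts).
have h1 s : 0 <= s <= w -> 0 <= g1.[s].
  move=> /andP[s0 sw]; have -> : 0 = g1.[0] by rewrite !hornerE; ring.
  by apply: poly_ge_mono => // t /andP[t0 ts]; rewrite d1 h2// t0 (le_trans ts).
have : g0.[0] <= g0.[w] by apply: poly_ge_mono => // t tw; rewrite d0 h1.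
rewrite !(hornerD, hornerN, hornerZ, hornerC, hornerX, hornerXn) expr0n /=; lra.
Qed.

Lemma taylor3_le p x w : 0 <= w -> (forall s, x <= s <= x + w -> (p^`(3)).[s] <= 0) ->
  p.[x + w] <= p.[x] + w * p^`().[x] + w ^+ 2 / 2 * (p^`(2)).[x].
Proof.
move=> w0 p3; pose g : {poly R} := - (p \Po ('X + x%:P)).
have dg q : (q \Po ('X + x%:P))^`() = q^`() \Po ('X + x%:P).
  by rewrite deriv_comp derivD derivX derivC addr0 mulr1.
have gE q s : (q \Po ('X + x%:P)).[s] = q.[x + s] by rewrite horner_comp !hornerE addrC.
have := @poly_ge_taylor3 g w w0.
rewrite !derivnS derivn0 !derivN !dg !hornerN !gE !addr0 => H.
have : forall s, 0 <= s <= w -> 0 <= (- (p^`(3) \Po ('X + x%:P))).[s].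
  by move=> s /andP[s0 sw]; rewrite hornerN gE oppr_ge0 p3// lerDl s0 lerD2l.
by rewrite !derivnS derivn0 => /H; lra.
Qed.

(** Reflection reverses the sign of the third derivative, so to the left the Taylor polynomial is a
    lower bound without remainder; only steps to the right call for [taylor3_ge]. *)
Lemma taylor3_ge_left p x w : 0 <= w -> (forall s, x - w <= s <= x -> (p^`(3)).[s] <= 0) ->
  p.[x] - w * p^`().[x] + w ^+ 2 / 2 * (p^`(2)).[x] <= p.[x - w].
Proof.
move=> w0 p3; pose h : {poly R} := x%:P - 'X.
have dg q : (q \Po h)^`() = - (q^`() \Po h).
  by rewrite deriv_comp derivB derivX derivC sub0r mulrN1.
have gE q s : (q \Po h).[s] = q.[x - s] by rewrite horner_comp !hornerE.
have := @poly_ge_taylor3 (p \Po h) w w0.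
rewrite !derivnS derivn0 !(dg, derivN) !hornerN !gE !subr0 => H.
have : forall s, 0 <= s <= w -> 0 <= (- - - (p^`(3) \Po h)).[s].
  by move=> s /andP[s0 sw]; rewrite !hornerN gE opprK oppr_ge0 p3//; lra.
by rewrite !derivnS derivn0 => /H; rewrite opprK; lra.
Qed.

Lemma taylor3_ge p x w G : 0 <= w -> (forall s, x <= s <= x + w -> - G <= (p^`(3)).[s]) ->
  p.[x] + w * p^`().[x] + w ^+ 2 / 2 * (p^`(2)).[x] - G / 6 * w ^+ 3 <= p.[x + w].
Proof.
move=> w0 p3; pose h : {poly R} := 'X + x%:P; pose r : {poly R} := (G / 6) *: 'X^3.
have dg q : (q \Po h)^`() = q^`() \Po h.
  by rewrite deriv_comp derivD derivX derivC addr0 mulr1.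
have gE q s : (q \Po h).[s] = q.[x + s] by rewrite horner_comp !hornerE addrC.
have r1 : r^`() = (G / 2) *: 'X^2.
  by rewrite derivZ derivXn /= -scalerMnr scalerMnl; congr (_ *: _); rewrite -mulr_natr; field.
have r2 : r^`(2) = G *: 'X.
  by rewrite derivnS derivn1 r1 derivZ derivXn /= expr1 -scalerMnr scalerMnl; congr (_ *: _); rewrite -mulr_natr; field.
have r3 : r^`(3) = G%:P by rewrite derivnS r2 derivZ derivX alg_polyC.
have d1 : (p \Po h + r)^`() = p^`() \Po h + (G / 2) *: 'X^2 by rewrite derivD dg r1.
have d2 : (p \Po h + r)^`(2) = p^`(2) \Po h + G *: 'X.
  by rewrite derivnS derivn1 d1 derivD dg -r1; congr (_ + _).
have d3 : (p \Po h + r)^`(3) = p^`(3) \Po h + G%:P.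
  by rewrite derivnS d2 derivD dg -r2; congr (_ + _).
have := @poly_ge_taylor3 (p \Po h + r) w w0.
rewrite d1 d2 d3 !hornerD !gE addr0 !(hornerZ, hornerC, hornerX, hornerXn) !expr0n /= => H.
have : forall s, 0 <= s <= w -> 0 <= (p^`(3) \Po h + G%:P).[s].
  move=> s /andP[s0 sw]; rewrite hornerD gE hornerC.
  by have := p3 (x + s); rewrite lerDl s0 lerD2l sw => /(_ isT); lra.
by move=> /H; lra.
Qed.

End PolynomialTaylor.

Section LimitTaylor.
Variable R : realType.
Implicit Types (x y w b c a : R).

(** Convexity as monotonicity of increments, a form that passes to pointwise limits and to
    averages. *)
Definition supermodular_on_pos (f : R -> R) : Prop :=
  forall x w w', 0 <= w -> 0 <= w' -> f (x + w) + f (x + w') <= f x + f (x + w + w').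

(** [f1] and [f2] stand in for the first two derivatives at [x], so that differentiability of a
    limit function is never in question. The weight [Num.max (- x) 0] makes the cubic error uniform
    over [x >= 0]. *)
Definition second_order_jet c b a (f : R -> R) x : Prop :=
  exists f1 f2, [/\ 0 <= f2,
    forall w, 0 <= w -> f (x + w) <= f x + w * f1 + w ^+ 2 / 2 * f2 &
    forall y, f x + y * f1 + y ^+ 2 / 2 * f2
      - c / 6 * expR (b + Num.max (- x) 0 * a) * `|y| ^+ 3 <= f (x + y)].

Variables (p : nat -> {poly R}) (f : R -> R) (c b a : R).
Hypotheses (c0 : 0 <= c) (a0 : 0 <= a).
Hypothesis pf : forall x, (p n).[x] @[n --> \oo] --> f x.
Hypothesis psign : forall r : R, exists N, forall n, (N <= n)%N -> forall x, `|x| <= r ->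
  [/\ 0 <= ((p n)^`(2)).[x], ((p n)^`(3)).[x] <= 0 &
      - (c * expR (b + Num.max (- x) 0 * a)) <= ((p n)^`(3)).[x]].

Lemma limit_supermodular : supermodular_on_pos f.
Proof.
move=> x w w' w0 w'0.
have [N hN] := psign (`|x| + w + w').
have c1 : (p n).[x + w] + (p n).[x + w'] @[n --> \oo] --> f (x + w) + f (x + w').
  by apply: cvgD.
have c2 : (p n).[x] + (p n).[x + w + w'] @[n --> \oo] --> f x + f (x + w + w').
  by apply: cvgD.
apply: (ler_cvg_to c1 c2); exists N => // n /= Nn.
pose h : {poly R} := p n \Po ('X + w%:P) - p n.
have := @poly_ge_mono R h x (x + w'); rewrite lerDl => /(_ w'0).
have hE s : h.[s] = (p n).[s + w] - (p n).[s] by rewrite !hornerE horner_comp !hornerE.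
rewrite !hE => H.
suff : forall s, x <= s <= x + w' -> 0 <= h^`().[s].
  by move=> /H; rewrite (addrAC x w'); lra.
move=> s /andP[xs sw].
rewrite derivB deriv_comp derivD derivX derivC addr0 mulr1 hornerD hornerN horner_comp !hornerE subr_ge0.
apply: poly_ge_mono; first by rewrite lerDl.
move=> t /andP[st tsw]; have [] // := hN n Nn t.
rewrite ler_norml; apply/andP; split.
  by have := ler_norm (- x); rewrite normrN; lra.
by have := ler_norm x; lra.
Qed.

Let G x := c * expR (b + Num.max (- x) 0 * a).

Let G_anti x y : x <= y -> G y <= G x.
Proof.
move=> xy; rewrite /G ler_wpM2l// ler_expR lerD2l ler_wpM2r//.
rewrite ge_max !le_max lexx orbT andbT; apply/orP; left; lra.
Qed.

(** The Taylor inequalities with step 1 bound the first two derivatives of [p n] at [x] by values of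
    [p n], which converge. Bolzano-Weierstrass, applied twice, extracts [f1] and [f2] along a
    subsequence, and the inequalities pass to the limit. *)
Lemma limit_second_order_jet x : second_order_jet c b a f x.
Proof.
have bnd (r : R) : exists N, forall n, (N <= n)%N -> forall w, 0 <= w <= r ->
   [/\ (p n).[x + w] <= (p n).[x] + w * (p n)^`().[x] + w ^+ 2 / 2 * ((p n)^`(2)).[x],
       (p n).[x] - w * (p n)^`().[x] + w ^+ 2 / 2 * ((p n)^`(2)).[x] <= (p n).[x - w],
       (p n).[x] + w * (p n)^`().[x] + w ^+ 2 / 2 * ((p n)^`(2)).[x] - G x / 6 * w ^+ 3 <= (p n).[x + w] &
       0 <= ((p n)^`(2)).[x]].
  have [N hN] := psign (`|x| + `|r|); exists N => n Nn w /andP[w0 wr].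
  have xin s : x - w <= s <= x + w -> `|s| <= `|x| + `|r|.
    move=> /andP[s1 s2]; rewrite ler_norml.
    have := ler_norm (- x); have := ler_norm x; have := ler_norm r; rewrite normrN => h1 h2 h3.
    by apply/andP; split; lra.
  split.
  - apply: taylor3_le => // s /andP[s1 s2]; have [] // := hN n Nn s.
    by apply: xin; lra.
  - apply: taylor3_ge_left => // s /andP[s1 s2]; have [] // := hN n Nn s.
    by apply: xin; lra.
  - apply: taylor3_ge => // s /andP[s1 s2]; have [] // := hN n Nn s.
      by apply: xin; lra.
    by move=> _ _; apply: le_trans; rewrite lerN2; exact: G_anti.
  - by have [] // := hN n Nn x; rewrite lerDl.
have [N hN] := bnd 1.
pose u n := (p (n + N)%N)^`().[x]; pose v n := ((p (n + N)%N)^`(2)).[x].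
have shift y : (p (n + N)%N).[y] @[n --> \oo] --> f y.
  by rewrite (cvg_shiftn N (fun n => (p n).[y])).
have bseq y : exists M : R, forall n, `|(p (n + N)%N).[y]| <= M.
  have cy : cvgn (fun n => (p (n + N)%N).[y]) by apply/cvg_ex; exists (f y).
  have [M [_ hM]] := cvg_seq_bounded cy.
  by exists (M + 1) => n; apply: (hM (M + 1)) => //; rewrite ltrDl.
have [Ml hMl] := bseq (x - 1); have [M hM] := bseq x; have [Mr hMr] := bseq (x + 1).
pose Bd : R := Ml + 2 * M + Mr + G x.
have uvB n : - Bd <= u n <= Bd /\ - Bd <= v n <= Bd.
  have [|h1 h2 h3 h4] := hN (n + N)%N (leq_addl _ _) 1; first by rewrite ler01 lexx.
  move: h1 h2 h3 h4; rewrite -/(u n) -/(v n) !expr1n !mul1r => h1 h2 h3 h4.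
  have := hMl n; have := hM n; have := hMr n; rewrite !ler_norml => /andP[? ?] /andP[? ?] /andP[? ?].
  have G0 : 0 <= G x by rewrite mulr_ge0// expR_ge0.
  by split; apply/andP; rewrite /Bd; split; lra.
have bu : bounded_fun u.
  exists Bd; split; first by rewrite num_real.
  by move=> z zM n _ /=; apply: le_trans (ltW zM); rewrite ler_norml; have [] := uvB n.
have [s1 is1 /cvg_ex[f1 uf1]] := bolzano_weierstrass bu.
have bv : bounded_fun (v \o s1).
  exists Bd; split; first by rewrite num_real.
  by move=> z zM n _ /=; apply: le_trans (ltW zM); rewrite ler_norml; have [] := uvB (s1 n).
have [s2 is2 /cvg_ex[f2 vf2]] := bolzano_weierstrass bv.
have ge_id (s : nat -> nat) : increasing_seq s -> forall n, (n <= s n)%N.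
  move=> ms; elim=> // n IH; apply: leq_ltn_trans IH _.
  rewrite ltnNge; apply/negP => h.
  by have : (n.+1 <= n)%N by [rewrite -ms; exact: h]; rewrite ltnn.
have soo (s : nat -> nat) : increasing_seq s -> s n @[n --> \oo] --> \oo.
  move=> ms B [m _ hB]; exists m => // n /= mn; apply: hB => /=.
  exact: leq_trans (ge_id _ ms n).
pose s := s1 \o s2.
have sinf : s n @[n --> \oo] --> \oo by apply: cvg_comp (soo _ is2) (soo _ is1).
have cp y : (p (s n + N)%N).[y] @[n --> \oo] --> f y by exact: cvg_comp sinf (shift y).
have cu : u (s n) @[n --> \oo] --> f1 by exact: cvg_comp (soo _ is2) uf1.
have cv : v (s n) @[n --> \oo] --> f2 by exact: vf2.
have eventually r (Q : nat -> Prop) : (forall n, (r <= s n)%N -> Q n) -> \forall n \near \oo, Q n.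
  by move=> hQ; exists r => // n /= rn; apply: hQ; apply: leq_trans rn _; exact: leq_trans (ge_id _ is2 n) (ge_id _ is1 _).
have cquad y : (p (s n + N)%N).[x] + y * u (s n) + y ^+ 2 / 2 * v (s n) @[n --> \oo] -->
    f x + y * f1 + y ^+ 2 / 2 * f2.
  by apply: cvgD; [apply: cvgD => //; exact: cvgZr|exact: cvgZr].
exists f1, f2; split.
- apply: (@ler_cvg_to _ \oo _ _ (fun=> 0) _ _ _ (cvg_cst _) cv).
  apply: (eventually 0%N) => n _; have [|//] := hN (s n + N)%N (leq_addl _ _) 1.
  by rewrite ler01 lexx.
- move=> w w0; have [N' hN'] := bnd w.
  apply: (ler_cvg_to (cp (x + w)) (cquad w)); apply: (eventually N') => n sn.
  have [|//] := hN' (s n + N)%N (leq_trans sn (leq_addr _ _)) w.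
  by rewrite w0 lexx.
- move=> y; have [N' hN'] := bnd `|y|.
  have cc : (p (s n + N)%N).[x] + y * u (s n) + y ^+ 2 / 2 * v (s n) -
     c / 6 * expR (b + Num.max (- x) 0 * a) * `|y| ^+ 3 @[n --> \oo] -->
     f x + y * f1 + y ^+ 2 / 2 * f2 - c / 6 * expR (b + Num.max (- x) 0 * a) * `|y| ^+ 3.
    by apply: cvgB => //; exact: cvg_cst.
  apply: (ler_cvg_to cc (cp (x + y))); apply: (eventually N') => n sn.
  have [|_ h1 h2 _] := hN' (s n + N)%N (leq_trans sn (leq_addr _ _)) `|y|.
    by rewrite normr_ge0 lexx.
  have Gy : 0 <= G x * `|y| ^+ 3 by rewrite mulr_ge0 ?exprn_ge0// mulr_ge0// expR_ge0.
  rewrite -/(u (s n)) -/(v (s n)) in h1 h2.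
  have [y0|y0] := leP 0 y.
    by move: h2 Gy; rewrite /G (ger0_norm y0); lra.
  move: h1 Gy; rewrite /G (ltr0_norm y0) opprK sqrrN; lra.
Qed.

End LimitTaylor.

Section ExponentialLimit.
Variable R : realType.

Lemma ge_1B_natM (y : R) n : 0 <= y <= 1 -> 1 - n%:R * y <= (1 - y) ^+ n.
Proof.
move=> /andP[y0 y1]; elim: n => [|n IH]; first by rewrite mul0r subr0 expr0.
rewrite exprS; apply: (@le_trans _ _ ((1 - y) * (1 - n%:R * y))).
  rewrite -natr1 -subr_ge0.
  have -> : (1 - y) * (1 - n%:R * y) - (1 - (n%:R + 1) * y) = n%:R * (y * y) by ring.
  by rewrite !mulr_ge0.
by rewrite ler_wpM2l// subr_ge0.
Qed.

(** For the lower bound, [(1 - u) * expR u <= 1] gives [(1 - u ^+ 2) * expR u <= 1 + u]; take powers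
    and apply Bernoulli's inequality. *)
Lemma expR_pow_bounds (z : R) n : (0 < n)%N -> `|z| < n%:R ->
  (1 - z ^+ 2 / n%:R) * expR z <= (1 + z / n%:R) ^+ n <= expR z.
Proof.
move=> n0 zn; pose u := z / n%:R.
have nR : 0 < n%:R :> R by rewrite ltr0n.
have u1 : `|u| < 1 by rewrite /u normrM normfV (ger0_norm (ltW nR)) ltr_pdivrMr// mul1r.
have /andP[um up] : - 1 < u < 1 by rewrite -ltr_norml.
have zu : expR z = expR u ^+ n by rewrite -expRM_natl /u mulrCA mulfV ?gt_eqF// mulr1.
have u1p : 0 <= 1 + u by lra.
apply/andP; split; last first.
  by rewrite zu lerXn2r ?nnegrE ?expR_ge0// expR_ge1Dx.
have uu : 0 <= u ^+ 2 <= 1.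
  rewrite sqr_ge0 -real_normK ?num_real// expr_le1 ?normr_ge0// ltW//.
have h : (1 - u ^+ 2) * expR u <= 1 + u.
  have : (1 - u) * expR u <= 1.
    by rewrite -[leRHS](mulVf (lt0r_neq0 (expR_gt0 u))) ler_wpM2r ?expR_ge0// -expRN expR_ge1Dx.
  move=> h; have -> : (1 - u ^+ 2) * expR u = (1 + u) * ((1 - u) * expR u) by ring.
  by rewrite ler_piMr.
apply: (@le_trans _ _ (((1 - u ^+ 2) * expR u) ^+ n)); last first.
  by rewrite lerXn2r ?nnegrE// mulr_ge0 ?expR_ge0// subr_ge0; case/andP: uu.
rewrite exprMn -zu ler_wpM2r ?expR_ge0//.
apply: le_trans (ge_1B_natM n uu); rewrite lerD2l lerN2 le_eqVlt; apply/orP; left; apply/eqP.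
by rewrite /u; move: (n%:R : R) (lt0r_neq0 nR) => m m0; field.
Qed.

Lemma cvg_nat4_inv : (n.+4%:R^-1 : R) @[n --> \oo] --> 0.
Proof.
have /(cvg_comp _ _) : (n + 3)%N @[n --> \oo] --> \oo by exact: cvg_addnr.
move=> /(_ _ harmonic _ (@cvg_harmonic R)); apply: cvg_trans.
by apply: near_eq_cvg; near=> n; rewrite /harmonic /= addn3.
Unshelve. all: by end_near. Qed.

Lemma cvg_expR_pow (l : R) : (1 - l / n.+4%:R) ^+ n.+4 @[n --> \oo] --> expR (- l).
Proof.
have : (1 - l ^+ 2 * n.+4%:R^-1) * expR (- l) @[n --> \oo] --> (1 - l ^+ 2 * 0) * expR (- l).
  apply: cvgM; last exact: cvg_cst.
  apply: cvgB; first exact: cvg_cst.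
  by apply: cvgM; [exact: cvg_cst|exact: cvg_nat4_inv].
rewrite mulr0 subr0 mul1r => lo.
apply: (squeeze_cvgr _ lo (cvg_cst _)).
have [N lN] : exists N : nat, `|l| < N%:R by exists (Num.trunc `|l|).+1; exact: truncnS_gt.
exists N => // n /= Nn.
have := @expR_pow_bounds (- l) n.+4 isT; rewrite normrN sqrrN mulNr; apply.
by apply: lt_le_trans lN _; rewrite ler_nat (leq_trans Nn)// -(addn4 n) leq_addr.
Qed.

End ExponentialLimit.

Lemma cvg_finite_sum (R : realType) (I : Type) (s : seq I) (f : I -> nat -> R) (l : I -> R) :
  (forall i, f i n @[n --> \oo] --> l i) ->
  \sum_(i <- s) f i n @[n --> \oo] --> \sum_(i <- s) l i.
Proof.
move=> fl; elim: s => [|i s IH].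
  by under eq_fun do rewrite big_nil; rewrite big_nil; exact: cvg_cst.
under eq_fun do rewrite big_cons; rewrite big_cons.
by apply: cvgD.
Qed.

Section TraceExponential.
Variables (R : realType) (d : nat).
Local Notation C := R[i].
Implicit Types (A B M U : 'M[C]_d).

Definition trexp_approx n M : R :=
  complex.Re (\tr ((1%:M - (n.+4%:R^-1)%:C%C *: M) ^+ n.+4)).

(** [tr (exp (- M))] for self-adjoint [M], as the limit of [tr ((1 - M / n) ^ n)]. *)
Definition trexp M : R := lim (trexp_approx n M @[n --> \oo]).

Lemma trexp_approxE M U lam n : spectral_of M U lam ->
  trexp_approx n M = \sum_i (1 - lam i / n.+4%:R) ^+ n.+4.
Proof.
move=> [uU dU]; pose k : R := n.+4%:R^-1.
have sN : spectral_of (1%:M - k%:C%C *: M) U (fun i => 1 - k * lam i).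
  split=> //; rewrite mulmxBr mulmxBl mulmx1 (unitarymxP uU) -scalemxAr -scalemxAl dU.
  apply/matrixP => i j; rewrite !mxE; case: (i == j); rewrite ?mulr1n ?mulr0n ?mulr0 ?subrr//.
  by rewrite rmorphB rmorphM rmorph1.
rewrite /trexp_approx (trace_pow_eigen sN) raddf_sum /=.
by apply: eq_bigr => i _; rewrite [k * _]mulrC.
Qed.

Lemma cvg_trexp_spectral M U lam : spectral_of M U lam ->
  trexp_approx n M @[n --> \oo] --> \sum_i expR (- lam i).
Proof.
move=> sM; under eq_fun do rewrite (trexp_approxE _ sM).
by apply: cvg_finite_sum => i; exact: cvg_expR_pow.
Qed.

Lemma trexpE M U lam : spectral_of M U lam -> trexp M = \sum_i expR (- lam i).
Proof. by move=> /cvg_trexp_spectral; exact: cvg_lim. Qed.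

Lemma cvg_trexp M : M ^t* = M -> trexp_approx n M @[n --> \oo] --> trexp M.
Proof. by move=> /spectral_ofP[U [lam sM]]; rewrite (trexpE sM); exact: cvg_trexp_spectral sM. Qed.

Lemma trexp_ge0 M : M ^t* = M -> 0 <= trexp M.
Proof.
by move=> /spectral_ofP[U [lam /trexpE ->]]; apply: sumr_ge0 => i _; exact: expR_ge0.
Qed.

Variables (A B : 'M[C]_d).
Hypotheses (hB : B ^t* = B) (pA : psdC A).

Lemma cvg_respow x : (respow A B n).[x] @[n --> \oo] --> trexp (pencil A B x).
Proof.
have hM := adj_pencil hB pA x.
have [U [lam sM]] := spectral_ofP hM.
under eq_fun do rewrite (horner_respow _ sM) -(trexp_approxE _ sM).
exact: cvg_trexp.
Qed.

Let respow_sign (r : R) : exists N, forall n, (N <= n)%N -> forall x, `|x| <= r ->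
  [/\ 0 <= ((respow A B n)^`(2)).[x], ((respow A B n)^`(3)).[x] <= 0 &
      - (2 * d%:R ^+ 3 * frob A ^+ 3 * expR (frob B + Num.max (- x) 0 * frob A))
        <= ((respow A B n)^`(3)).[x]].
Proof.
pose b := frob B + r * frob A.
(* From this rank on, the exponent exceeds every eigenvalue of the pencil for all [x] of absolute
   value at most [r]. *)
exists (Num.trunc b).+1 => n Nn x xr.
have [U [lam sM]] := spectral_ofP (adj_pencil hB pA x).
have lamK i : lam i <= n.+4%:R.
  have [h _] := pencil_spectrum pA i sM.
  apply: le_trans (ler_norm _) (le_trans h _).
  apply: (@le_trans _ _ b); first by rewrite lerD2l ler_wpM2r ?frob_ge0.
  apply: ltW; apply: lt_le_trans (truncnS_gt b) _.
  by rewrite ler_nat (leq_trans Nn)// -(addn4 n) leq_addr.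
split.
- exact: deriv2_respow_ge0 sM lamK.
- exact: deriv3_respow_le0 sM lamK.
- exact: deriv3_respow_ge sM lamK.
Qed.

Lemma trexp_pencil_supermodular : supermodular_on_pos (fun x => trexp (pencil A B x)).
Proof. exact: limit_supermodular cvg_respow respow_sign. Qed.

Lemma trexp_pencil_jet x :
  second_order_jet (2 * d%:R ^+ 3 * frob A ^+ 3) (frob B) (frob A)
    (fun x => trexp (pencil A B x)) x.
Proof.
apply: limit_second_order_jet cvg_respow respow_sign x; last exact: frob_ge0.
by rewrite !mulr_ge0 ?exprn_ge0 ?frob_ge0.
Qed.

End TraceExponential.

(** * Gaussian integrals *)

Section GaussianMeasure.
Variable R : realType.
Local Notation mu := (@lebesgue_measure R).
Import HBNNSimple.

Section Affine.
Variables (a b : R).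
Hypothesis b0 : 0 < b.

Definition affine_map (y : measurableTypeR R) : measurableTypeR R := a + b * y.

Lemma measurable_affine_map : measurable_fun [set: measurableTypeR R] affine_map.
Proof. by apply: measurable_funD => //; exact: measurable_funM. Qed.

Let pf : {measure set (measurableTypeR R) -> \bar R} :=
  measure_function_pushforward__canonical__measure_function_Measure mu measurable_affine_map.

Let nu := mscale (NngNum (ltW b0)) pf.

Let lebesgue_affine (A : set R) : measurable A -> mu A = nu A.
Proof.
move=> mA; apply: lebesgue_measure_unique => // _ [[l r] _ <-].
rewrite /nu/= /mscale/= /pushforward.
rewrite (_ : _ @^-1` _ = `]((l - a) / b), ((r - a) / b)]%classic); last first.
  apply/seteqP; split=> y /=; rewrite /affine_map !in_itv/= ltr_pdivrMr// ler_pdivlMr//.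
    by move=> /andP[? ?]; apply/andP; split; lra.
  by move=> /andP[? ?]; apply/andP; split; lra.
rewrite !lebesgue_measure_itv/= !lte_fin ltr_pM2r ?invr_gt0// ltrD2r.
case: ifP => lr; last by rewrite mule0.
by rewrite -!EFinD -EFinM; congr (_%:E); field; rewrite gt_eqF.
Qed.

Lemma integral_affine (f : R -> \bar R) : measurable_fun [set: R] f -> (forall x, 0 <= f x)%E ->
  (\int[mu]_z f z = b%:E * \int[mu]_y f (a + b * y)%R)%E.
Proof.
move=> mf f0.
transitivity (\int[nu]_z f z)%E.
  by apply: eq_measure_integral => A mA _; exact: lebesgue_affine.
rewrite ge0_integral_mscale//; congr (_ * _)%E.
by rewrite ge0_integral_pushforward//; exact: measurable_affine_map.
Qed.

End Affine.

Lemma integral_normal_prob (m s : R) (f : measurableTypeR R -> \bar R) :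
  measurable_fun [set: measurableTypeR R] f -> (forall x, 0 <= f x)%E ->
  (\int[normal_prob m s]_x f x = \int[mu]_x (f x * (normal_pdf m s x)%:E))%E.
Proof.
move=> mf f0; pose f_ := nnsfun_approx measurableT mf.
have mpdf : measurable_fun [set: R] (fun x => (normal_pdf m s x)%:E).
  by apply/measurable_EFinP; exact: measurable_normal_pdf.
have pdf0 x : (0 <= (normal_pdf m s x)%:E)%E by rewrite lee_fin normal_pdf_ge0.
transitivity (limn (fun n => \int[normal_prob m s]_x (f_ n x)%:E))%E.
  rewrite -monotone_convergence//.
  - by apply: eq_integral => x _; apply/esym/cvg_lim => //; apply: cvg_nnsfun_approx.
  - by move=> n; exact/measurable_EFinP/measurable_funTS.
  - by move=> n x _; rewrite lee_fin.
  - by move=> x _ k n kn; rewrite lee_fin; exact/lefP/nd_nnsfun_approx.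
transitivity (limn (fun n => \int[mu]_x ((f_ n x)%:E * (normal_pdf m s x)%:E)))%E; last first.
  rewrite -monotone_convergence//.
  - apply: eq_integral => x _; apply/cvg_lim => //.
    by apply: cvgeZr => //; apply: cvg_nnsfun_approx.
  - by move=> n; apply: emeasurable_funM => //; exact/measurable_EFinP/measurable_funTS.
  - by move=> n x _; rewrite mule_ge0// lee_fin.
  - by move=> x _ k n kn; rewrite lee_wpmul2r// lee_fin; exact/lefP/nd_nnsfun_approx.
congr (limn _); apply/funext => n.
under eq_integral do rewrite fimfunE -fsumEFin//.
rewrite ge0_integral_fsum//; last 2 first.
  - by move=> r; exact/measurable_EFinP/measurable_funM.
  - by move=> r x _; rewrite nnfun_muleindic_ge0.
under [RHS]eq_integral.
  move=> x _; rewrite fimfunE -fsumEFin// ge0_mule_fsuml; last first.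
    by move=> r; rewrite nnfun_muleindic_ge0.
  over.
rewrite ge0_integral_fsum//; last 2 first.
  - by move=> r; apply: emeasurable_funM => //; exact/measurable_EFinP/measurable_funM.
  - by move=> r x _; rewrite mule_ge0// nnfun_muleindic_ge0.
apply: eq_fsbigr => r _.
rewrite integralZl_indic_nnsfun// integral_indic// setIT.
have [r0|r0] := ltP r 0.
  rewrite preimage_nnfun0// measure0 mule0; apply/esym.
  by apply: integral0_eq => x _; rewrite indic0 mulr0 mul0e.
under [RHS]eq_integral do rewrite EFinM -muleA.
rewrite ge0_integralZl//; last 2 first.
  - apply: emeasurable_funM => //; exact/measurable_EFinP.
  - by move=> x _; rewrite mule_ge0// lee_fin.
congr (_ * _)%E.
transitivity (\int[mu]_(x in f_ n @^-1` [set r]) (normal_pdf m s x)%:E)%E => //.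
rewrite [LHS]integral_mkcond [in LHS]epatch_indic.
by apply: eq_integral => x _; rewrite /= muleC.
Qed.

End GaussianMeasure.

Section ExponentialTaylor.
Variable R : realType.

Lemma expR_taylor (t : R) j :
  `|expR t - \sum_(0 <= k < j) t ^+ k / k`!%:R| <= `|t| ^+ j * expR `|t|.
Proof.
have lhs : `|series (exp_coeff t) n - \sum_(0 <= k < j) t ^+ k / k`!%:R| @[n --> \oo] -->
    `|expR t - \sum_(0 <= k < j) t ^+ k / k`!%:R|.
  apply: cvg_norm; apply: cvgB; last exact: cvg_cst.
  exact: is_cvg_series_exp_coeff.
have rhs : `|t| ^+ j * series (exp_coeff `|t|) n @[n --> \oo] --> `|t| ^+ j * expR `|t|.
  by apply: cvgM; [exact: cvg_cst|exact: is_cvg_series_exp_coeff].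
apply: (ler_cvg_to lhs rhs); exists j => // n /= jn.
rewrite /series/= (big_cat_nat (leq0n j) jn)//= addrAC subrr add0r.
apply: le_trans (ler_norm_sum _ _ _) _.
rewrite -{1}[j]add0n big_addn.
apply: (@le_trans _ _ (\sum_(0 <= k < n - j) `|t| ^+ j * (`|t| ^+ k / k`!%:R))).
  apply: ler_sum => k _; rewrite /exp_coeff /= normrM normrX normfV normr_nat addnC exprD -mulrA.
  rewrite !ler_wpM2l ?exprn_ge0// lef_pV2 ?posrE ?ltr0n ?fact_gt0// ler_nat.
  by rewrite addnC leq_fact// leq_addr.
rewrite -mulr_sumr ler_wpM2l ?exprn_ge0//.
rewrite [leRHS](big_cat_nat (leq0n _) (leq_subr j n))//= lerDl sumr_ge0// => k _.
by rewrite /exp_coeff/= mulr_ge0 ?exprn_ge0.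
Qed.

Lemma expRB1_le (t : R) : `|expR t - 1| <= `|t| * expR `|t|.
Proof. by have := expR_taylor t 1; rewrite big_nat1 expr0 expr1 fact0 divr1. Qed.

Lemma expR_le_taylor2 (t : R) : expR t <= 1 + t + t ^+ 2 / 2 + `|t| ^+ 3 * expR `|t|.
Proof.
have := expR_taylor t 3; rewrite ler_norml => /andP[_].
have f2 : 2`!%:R = 2 :> R by [].
by rewrite !big_nat_recr//= big_nil expr0 expr1 fact0 !divr1 f2 add0r; lra.
Qed.

Lemma exprn_le_expR (t : R) n : 0 <= t -> t ^+ n <= n`!%:R * expR t.
Proof.
case: n => [|n] t0; first by rewrite expr0 mul1r -(expR0 R) ler_expR.
have := expR_ge1Dxn n t0; rewrite -ler_pdivrMl ?ltr0n ?fact_gt0// mulrC.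
by apply: le_trans; rewrite lerDr.
Qed.

Lemma expR_norm_le (t : R) : expR `|t| <= expR t + expR (- t).
Proof.
have [t0|t0] := leP 0 t; first by rewrite ger0_norm// lerDl expR_ge0.
by rewrite ltr0_norm// lerDr expR_ge0.
Qed.

End ExponentialTaylor.

Lemma le0_of_small (R : realType) (m K : R) : 0 < K ->
  (forall a : R, 0 < a <= 1 -> m <= a * K) -> m <= 0.
Proof.
move=> K0 h; rewrite leNgt; apply/negP => m0.
have d0 : 0 < m + 2 * K by lra.
(* This [a] lies in (0, 1] and [a * K] is below [m / 2]. *)
have := h (m / (m + 2 * K)); rewrite divr_gt0// ler_pdivrMr// mul1r => H.
have {H} : m <= m / (m + 2 * K) * K by apply: H; lra.
rewrite mulrAC ler_pdivlMr//; nra.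
Qed.

Section GaussianMoments.
Variable R : realType.
Local Notation mu := (@lebesgue_measure R).
Local Notation gauss := (normal_prob (0 : R) 1).

Lemma normal_pdfE1 (m s x : R) : 0 < s -> normal_pdf m s x =
  normal_peak s * expR (- (x - m) ^+ 2 / (s ^+ 2 *+ 2)).
Proof. by move=> s0; rewrite normal_pdfE ?gt_eqF. Qed.

Lemma gauss_mgf (a : R) : (\int[gauss]_x (expR (a * x))%:E = (expR (a ^+ 2 / 2))%:E)%E.
Proof.
rewrite integral_normal_prob; last 2 first.
  - by apply/measurable_EFinP; apply: measurableT_comp => //; exact: measurable_funM.
  - by move=> x; rewrite lee_fin expR_ge0.
transitivity (\int[mu]_x ((expR (a ^+ 2 / 2))%:E * (normal_pdf a 1 x)%:E))%E.
  apply: eq_integral => x _; rewrite -!EFinM !normal_pdfE1//; congr (_%:E).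
  rewrite mulrCA [RHS]mulrCA -!expRD; congr (_ * expR _).
  by rewrite expr1n; field.
rewrite ge0_integralZl//; last 2 first.
  - by apply/measurable_EFinP; exact: measurable_normal_pdf.
  - by move=> x _; rewrite lee_fin normal_pdf_ge0.
by rewrite integral_normal_pdf mule1.
Qed.

Lemma integrable_gauss_expR (a : R) : gauss.-integrable setT (fun x => (expR (a * x))%:E).
Proof.
apply/integrableP; split.
  by apply/measurable_EFinP; apply: measurableT_comp => //; exact: measurable_funM.
under eq_integral do rewrite gee0_abs ?lee_fin ?expR_ge0//.
by rewrite gauss_mgf ltry.
Qed.

Lemma integrable_gauss_bounded (f : measurableTypeR R -> R) (c a : R) : measurable_fun setT f ->
  (forall x, `|f x| <= c * (expR (a * x) + expR (- a * x))) ->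
  gauss.-integrable setT (EFin \o f).
Proof.
move=> mf fb.
have ig : gauss.-integrable setT (EFin \o (fun x : measurableTypeR R => c * (expR (a * x) + expR (- a * x)))).
  have := integrableZl measurableT c
    (integrableD measurableT (integrable_gauss_expR a) (integrable_gauss_expR (- a))).
  by apply: eq_integrable.
apply: (le_integrable measurableT _ _ ig); first exact/measurable_EFinP.
by move=> x _; rewrite /= lee_fin; exact: le_trans (fb x) (ler_norm _).
Qed.

Let cosh_bound n (x : R) : `|x| ^+ n <= n`!%:R * (expR (1 * x) + expR (- 1 * x)).
Proof.
rewrite mul1r mulN1r; apply: le_trans (exprn_le_expR n (normr_ge0 x)) _.
by rewrite ler_wpM2l// expR_norm_le.
Qed.

Lemma integrable_gauss_exprn n : gauss.-integrable setT (fun x => (x ^+ n)%:E).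
Proof.
apply: (@integrable_gauss_bounded (fun x => x ^+ n) n`!%:R 1) => [|x].
  exact: measurable_funX.
by rewrite normrX; exact: cosh_bound.
Qed.

Let moment n := \int[gauss]_x (x ^+ n).

Let Rint_mgf a : \int[gauss]_x expR (a * x) = expR (a ^+ 2 / 2).
Proof. by rewrite /Rintegral gauss_mgf. Qed.

Let Rint_affine a b c : \int[gauss]_x (a + b * x + c * x ^+ 2) = a + b * moment 1 + c * moment 2.
Proof.
have i1 : gauss.-integrable setT (EFin \o (fun x : measurableTypeR R => x ^+ 1)).
  exact: integrable_gauss_exprn 1.
have i2 : gauss.-integrable setT (EFin \o (fun x : measurableTypeR R => x ^+ 2)).
  exact: integrable_gauss_exprn 2.
have ia : gauss.-integrable setT (EFin \o (fun=> a)).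
  exact: finite_measure_integrable_cst.
have ib : gauss.-integrable setT (EFin \o (fun x : measurableTypeR R => b * x ^+ 1)).
  by apply: eq_integrable (integrableZl measurableT b i1) => // x _; rewrite /= EFinM.
have ic : gauss.-integrable setT (EFin \o (fun x : measurableTypeR R => c * x ^+ 2)).
  by apply: eq_integrable (integrableZl measurableT c i2) => // x _; rewrite /= EFinM.
have iab : gauss.-integrable setT (EFin \o (fun x : measurableTypeR R => a + b * x ^+ 1)).
  by apply: eq_integrable (integrableD measurableT ia ib) => // x _; rewrite /= EFinD.
transitivity (\int[gauss]_x ((a + b * x ^+ 1) + c * x ^+ 2)); first by [].
rewrite (RintegralD _ iab ic)// (RintegralD _ ia ib)// !RintegralZl//; congr (_ + _ + _).
by rewrite Rintegral_cst// [X in fine X]probability_setT mulr1.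
Qed.

Let integrable_affine a b c : gauss.-integrable setT (EFin \o (fun x => a + b * x + c * x ^+ 2)).
Proof.
apply: (@integrable_gauss_bounded _ (`|a| + `|b| + 2 * `|c|) 1).
  apply: measurable_funD; last by apply: measurable_funM => //; exact: measurable_funX.
  by apply: measurable_funD => //; exact: measurable_funM.
move=> x; set E := _ + expR _.
have h0 : 1 <= 1 * E := cosh_bound 0 x.
have h1 : `|x| <= 1 * E := cosh_bound 1 x.
have h2 : `|x| ^+ 2 <= 2 * E := cosh_bound 2 x.
rewrite !mul1r in h0 h1.
apply: le_trans (ler_normD _ _) _; rewrite normrM normrX.
apply: (@le_trans _ _ (`|a| + `|b| * `|x| + `|c| * `|x| ^+ 2)).
  by rewrite lerD2r -normrM ler_normD.
have := normr_ge0 a; have := normr_ge0 b; have := normr_ge0 c.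
move: h2 h1 h0; move: `|a| `|b| `|c| `|x| (`|x| ^+ 2) => u v w y z *; nra.
Qed.

Let integrable_exp a : gauss.-integrable setT (EFin \o (fun x => expR (a * x))).
Proof. exact: integrable_gauss_expR. Qed.

(** Read off the moment generating function: [1 + a * x <= expR (a * x)] integrates to
    [a * moment 1 <= expR (a ^+ 2 / 2) - 1], of order [a ^+ 2]. Divide by [a] of either sign and let
    it tend to 0. *)
Let moment1 : moment 1 = 0.
Proof.
have key a : `|a| <= 1 -> a * moment 1 <= a ^+ 2 * expR 1.
  move=> a1; have : \int[gauss]_x (1 + a * x + 0 * x ^+ 2) <= \int[gauss]_x expR (a * x).
    apply: le_Rintegral => // x _; rewrite mul0r addr0; exact: expR_ge1Dx.
  rewrite Rint_affine mul0r addr0 Rint_mgf => h.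
  have a2 : a ^+ 2 / 2 <= 1.
    have : a ^+ 2 <= 1 by rewrite -real_normK ?num_real// expr_le1.
    by lra.
  have := expRB1_le (a ^+ 2 / 2).
  have -> : `|a ^+ 2 / 2| = a ^+ 2 / 2 by rewrite ger0_norm// divr_ge0 ?sqr_ge0.
  have : expR (a ^+ 2 / 2) <= expR 1 by rewrite ler_expR.
  have := sqr_ge0 a; have := expR_ge0 (1 : R); have := ler_norm (expR (a ^+ 2 / 2) - 1).
  move: h; set u := expR (a ^+ 2 / 2); set e := expR 1; set z := a ^+ 2; nra.
have e0 := expR_gt0 (1 : R).
apply/eqP; rewrite eq_le; apply/andP; split.
  apply: (le0_of_small e0) => a /andP[a0 a1]; have := key a; rewrite gtr0_norm// => /(_ a1).
  by rewrite expr2 -mulrA ler_pM2l.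
rewrite -oppr_le0; apply: (le0_of_small e0) => a /andP[a0 a1].
have := key (- a); rewrite normrN gtr0_norm// => /(_ a1).
by rewrite sqrrN expr2 -mulrA mulNr -mulrN ler_pM2l.
Qed.

(** Same method at second order. In [K], the outer 2 undoes [a ^+ 2 / 2], the 6 is 3!, and
    [2 * expR 2] is the integral of [expR (2 * x) + expR (- 2 * x)]. This half of the equality
    suffices because [gauss_lower_bound] multiplies it by a nonnegative [C]. *)
Let moment2 : 1 <= moment 2.
Proof.
pose K : R := 2 * (6 * (2 * expR 2)).
have K0 : 0 < K by rewrite !mulr_gt0 ?expR_gt0.
rewrite -subr_le0; apply: (le0_of_small K0) => a /andP[a0 a1].
have iE : gauss.-integrable setT (EFin \o (fun x => expR (2 * x) + expR (- 2 * x))).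
  by apply: eq_integrable (integrableD measurableT (integrable_exp 2) (integrable_exp (- 2))).
have : \int[gauss]_x expR (a * x) <=
    \int[gauss]_x ((1 + a * x + a ^+ 2 / 2 * x ^+ 2) + a ^+ 3 * 6 * (expR (2 * x) + expR (- 2 * x))).
  apply: le_Rintegral => //.
    have := integrableD measurableT (integrable_affine 1 a (a ^+ 2 / 2)) (integrableZl measurableT (a ^+ 3 * 6) iE).
    by apply: eq_integrable.
  move=> x _; apply: le_trans (expR_le_taylor2 _) _.
  have -> : (a * x) ^+ 2 / 2 = a ^+ 2 / 2 * x ^+ 2 by ring.
  have k1 : `|a * x| ^+ 3 * expR `|a * x| <= a ^+ 3 * (`|x| ^+ 3 * expR `|x|).
    rewrite normrM (gtr0_norm a0) exprMn -mulrA; apply: ler_wpM2l; first by rewrite exprn_ge0// ltW.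
    by apply: ler_wpM2l; rewrite ?exprn_ge0// ler_expR ler_piMl.
  have k2 : `|x| ^+ 3 * expR `|x| <= 6 * (expR (2 * x) + expR (- 2 * x)).
    apply: (@le_trans _ _ (6 * expR `|x| * expR `|x|)).
      apply: ler_wpM2r; first exact: expR_ge0.
      exact: (exprn_le_expR 3 (normr_ge0 x)).
    rewrite -mulrA -expRD mulNr; apply: ler_wpM2l => //; have := expR_norm_le (2 * x).
    by rewrite normrM ger0_norm// (_ : 2 * `|x| = `|x| + `|x|)//; ring.
  rewrite lerD2l; apply: le_trans k1 _; rewrite -mulrA; apply: ler_wpM2l => //.
  by rewrite exprn_ge0// ltW.
have i1 := integrable_affine 1 a (a ^+ 2 / 2).
have i2 : gauss.-integrable setT (EFin \o (fun x => a ^+ 3 * 6 * (expR (2 * x) + expR (- 2 * x)))).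
  by apply: eq_integrable (integrableZl measurableT (a ^+ 3 * 6) iE).
rewrite (RintegralD measurableT i1 i2) (RintegralZl _ measurableT iE).
rewrite (RintegralD measurableT (integrable_exp 2) (integrable_exp (- 2))).
rewrite Rint_affine moment1 !Rint_mgf sqrrN.
have -> : 2 ^+ 2 / 2 = 2 :> R by lra.
have := expR_ge1Dx (a ^+ 2 / 2); rewrite /K.
have a2 : 0 < a ^+ 2 by rewrite exprn_gt0.
have -> : a ^+ 3 = a ^+ 2 * a by rewrite exprSr.
move: (expR 2) (expR (a ^+ 2 / 2)) (moment 2) (a ^+ 2) a2 => e u m z z0 h1 h2.
rewrite -(ler_pM2l z0); nra.
Qed.

Lemma gauss_lower_bound (F : measurableTypeR R -> R) (A B C D s : R) :
  measurable_fun setT F -> (forall x, 0 <= F x) -> 0 <= C ->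
  (forall x, A + B * x + C * x ^+ 2 - D * (expR (s * x) + expR (- s * x)) <= F x) ->
  ((A + C - 2 * D * expR (s ^+ 2 / 2))%:E <= \int[gauss]_x (F x)%:E)%E.
Proof.
move=> mF F0 C0 lb.
have iE : gauss.-integrable setT (EFin \o (fun x => expR (s * x) + expR (- s * x))).
  by apply: eq_integrable (integrableD measurableT (integrable_exp s) (integrable_exp (- s))).
have iQ : gauss.-integrable setT (EFin \o (fun x => A + B * x + C * x ^+ 2 - D * (expR (s * x) + expR (- s * x)))).
  have := integrableB measurableT (integrable_affine A B C) (integrableZl measurableT D iE).
  by apply: eq_integrable.
have [|Fy] := leP (+oo)%E (\int[gauss]_x (F x)%:E)%E.
  by rewrite leye_eq => /eqP ->; rewrite leey.
have iF : gauss.-integrable setT (EFin \o F).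
  apply/integrableP; split; first exact/measurable_EFinP.
  by under eq_integral do rewrite /= ger0_norm//.
have := le_Rintegral measurableT iQ iF (fun x _ => lb x).
have i1 := integrable_affine A B C.
have i2 : gauss.-integrable setT (EFin \o (fun x => D * (expR (s * x) + expR (- s * x)))).
  by apply: eq_integrable (integrableZl measurableT D iE).
rewrite (RintegralB measurableT i1 i2) (RintegralZl _ measurableT iE).
rewrite (RintegralD measurableT (integrable_exp s) (integrable_exp (- s))).
rewrite Rint_affine moment1 !Rint_mgf sqrrN.
have Ffin : (\int[gauss]_x (F x)%:E)%E \is a fin_num.
  by rewrite ge0_fin_numE// integral_ge0// => x _; rewrite lee_fin.
rewrite -[X in (_ <= X)%E](fineK Ffin) lee_fin => h.
apply: le_trans h; rewrite -/(moment 2).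
have h : C * 1 <= C * moment 2 by rewrite ler_wpM2l.
by lra.
Qed.


End GaussianMoments.

Section GaussianRotation.
Variable R : realType.
Local Notation mu := (@lebesgue_measure R).
Local Notation gauss := (@normal_prob R 0 1).

Let gauss_exponent (c b y : R) : b != 0 ->
  - (y - 0) ^+ 2 / (1 ^+ 2 *+ 2) = - (c + b * y - c) ^+ 2 / (b ^+ 2 *+ 2).
Proof. by move=> b0; rewrite -(mulr_natr (1 ^+ 2)) -(mulr_natr (b ^+ 2)); field. Qed.

(** Completing the square: the density of [a * x + b * y] given [x], times the density of [x],
    equals the standard density at [z] times a Gaussian density in [x] centred at [a * z] with
    deviation [b], which integrates to 1. The case [b = 0] is apart because that conditional law has
    no density. *)
Lemma gauss_rotation (h : measurableTypeR R -> \bar R) (a b : R) :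
  measurable_fun setT h -> (forall x, 0 <= h x)%E -> 0 <= a -> 0 <= b -> a ^+ 2 + b ^+ 2 = 1 ->
  (\int[gauss]_x \int[gauss]_y h (a * x + b * y)%R = \int[gauss]_z h z)%E.
Proof.
move=> mh h0 a0 b0 ab.
move: b0; rewrite le_eqVlt => /predU1P[b0|b0].
  have a1 : a = 1.
    by apply/eqP; rewrite -(@eqrXn2 _ 2)// expr1n -ab -b0 expr0n addr0.
  apply: eq_integral => x _; transitivity (\int[gauss]_y h x)%E.
    by apply: eq_integral => y _; congr h; rewrite -b0 a1 mul1r mul0r addr0.
  by rewrite integral_cst// [X in (_ * X)%E]probability_setT mule1.
have mpdf m s : measurable_fun setT (fun z : measurableTypeR R => (normal_pdf m s z)%:E).
  by apply/measurable_EFinP; exact: measurable_normal_pdf.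
have inner x : (\int[gauss]_y h (a * x + b * y)%R =
    \int[mu]_z (h z * (normal_pdf (a * x) b z)%:E))%E.
  have mha : measurable_fun setT (fun y : measurableTypeR R => h (a * x + b * y)).
    by apply: (measurableT_comp mh); exact: measurable_affine_map.
  have mhp : measurable_fun setT (fun z : measurableTypeR R => h z * (normal_pdf (a * x) b z)%:E)%E.
    exact: (emeasurable_funM mh (mpdf _ _)).
  have hp0 z : (0 <= h z * (normal_pdf (a * x) b z)%:E)%E by rewrite mule_ge0// lee_fin normal_pdf_ge0.
  rewrite (integral_normal_prob 0 1 mha (fun y => h0 _)) (integral_affine (a * x) b0 mhp hp0).
  rewrite -(ge0_integralZl _ measurableT (measurableT_comp mhp (measurable_affine_map _ _)) (fun y _ => hp0 _)); last first.
    by rewrite lee_fin ltW.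
  apply: eq_integral => y _; rewrite muleCA -EFinM; congr (_ * _%:E)%E.
  rewrite !normal_pdfE1// mulrA; congr (_ * expR _).
    rewrite /normal_peak expr1n mul1r -mulrnAr sqrtrM ?sqr_ge0// sqrtr_sqr gtr0_norm//.
    by rewrite invfM mulrA divff ?mul1r// gt_eqF.
  rewrite /= /affine_map; have bn0 : b != 0 by rewrite gt_eqF.
  have := gauss_exponent (a * x) y bn0; exact.
pose H (xz : measurableTypeR R * measurableTypeR R) := (h xz.2 * (normal_pdf (a * xz.1) b xz.2)%:E)%E.
transitivity (\int[gauss]_x \int[mu]_z H (x, z))%E.
  by apply: eq_integral => x _; exact: inner.
have mpdf2 : measurable_fun setT (fun xz : measurableTypeR R * measurableTypeR R =>
    (normal_pdf (a * xz.1) b xz.2)%:E).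
  apply/measurable_EFinP; under eq_fun do rewrite normal_pdfE1//.
  apply: measurable_funM => //; apply: measurableT_comp => //.
  apply: measurable_funM => //; apply: measurableT_comp => //; apply: measurable_funX.
  by apply: measurable_funB => //; exact: measurable_funM.
have pdf0 m s z : (0 <= (normal_pdf m s z)%:E :> \bar R)%E by rewrite lee_fin normal_pdf_ge0.
have mhz : measurable_fun setT (fun xz : measurableTypeR R * measurableTypeR R => h xz.2).
  exact: measurableT_comp.
have mH : measurable_fun setT H by exact: (emeasurable_funM mhz mpdf2).
have H0 xz : (0 <= H xz)%E by rewrite /H mule_ge0.
rewrite (@fubini_tonelli _ _ (measurableTypeR R) (measurableTypeR R) R gauss mu H mH H0) /H /=.
rewrite (integral_normal_prob 0 1 mh h0); apply: eq_integral => z _.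
have mz : measurable_fun setT (fun x : measurableTypeR R => (normal_pdf (a * x) b z)%:E).
  apply/measurable_EFinP; under eq_fun do rewrite normal_pdfE1//.
  apply: measurable_funM => //; apply: measurableT_comp => //.
  apply: measurable_funM => //; apply: measurableT_comp => //; apply: measurable_funX.
  by apply: measurable_funB => //; exact: measurable_funM.
transitivity (h z * \int[gauss]_x (normal_pdf (a * (x : R)) b z)%:E)%E.
  exact: (@ge0_integralZl _ (measurableTypeR R) R gauss setT measurableT _ mz (h z) (fun x _ => pdf0 (a * (x : R)) b z) (h0 z)).
congr (_ * _)%E; transitivity (\int[mu]_x ((normal_pdf (a * (x : R)) b z)%:E * (normal_pdf 0 1 x)%:E))%E.
  exact: (integral_normal_prob 0 1 mz (fun x => pdf0 (a * (x : R)) b z)).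
transitivity (\int[mu]_x ((normal_pdf 0 1 z)%:E * (normal_pdf (a * z) b x)%:E))%E.
  apply: eq_integral => x _; rewrite -!EFinM !normal_pdfE1//; congr (_%:E).
  rewrite mulrACA [RHS]mulrACA [X in X * _ = _]mulrC -!expRD; congr (_ * expR _).
  have -> : b ^+ 2 = 1 - a ^+ 2 by rewrite -ab addrAC subrr add0r.
  have b2 : 1 - a ^+ 2 != 0 by rewrite -ab addrAC subrr add0r expf_neq0// gt_eqF.
  by rewrite expr1n; field.
transitivity ((normal_pdf 0 1 z)%:E * \int[mu]_x (normal_pdf (a * z) b x)%:E)%E.
  exact: (@ge0_integralZl _ (measurableTypeR R) R mu setT measurableT _ (mpdf (a * z) b) _ (fun x _ => pdf0 (a * z) b x) (pdf0 0 1 z)).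
by rewrite integral_normal_pdf mule1.
Qed.

End GaussianRotation.

(** * Comparison with a Gaussian *)

Section ScalarComparison.
Variables (R : realType) (dT : measure_display) (T : measurableType dT) (P : probability T R).
Local Notation Rm := (measurableTypeR R).
Local Notation gauss := (@normal_prob R 0 1).
Variables (W : T -> R) (m v : R).
Hypotheses (mW : measurable_fun setT W) (W0 : forall t, 0 <= W t).
Hypotheses (iW : P.-integrable setT (EFin \o W)) (iW2 : P.-integrable setT (EFin \o (fun t => W t ^+ 2))).
Hypotheses (EW : \int[P]_t W t = m) (EW2 : \int[P]_t (W t ^+ 2) = v).
Variables (f : Rm -> R) (c b a : R).
Hypotheses (mf : measurable_fun setT f) (f0 : forall x, 0 <= f x).
Hypotheses (fsm : supermodular_on_pos f) (fjet : forall x, second_order_jet c b a f x).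
Hypotheses (c0 : 0 <= c) (a0 : 0 <= a).

Let m0 : 0 <= m.
Proof. by rewrite -EW; apply: Rintegral_ge0. Qed.

Let v0 : 0 <= v.
Proof. by rewrite -EW2; apply: Rintegral_ge0 => t _; rewrite sqr_ge0. Qed.

Let mfW x : measurable_fun setT (fun t => f (x + W t)).
Proof. by apply: (measurableT_comp mf); exact: measurable_funD. Qed.

Let upper x f1 f2 : 0 <= f2 -> (forall w, 0 <= w -> f (x + w) <= f x + w * f1 + w ^+ 2 / 2 * f2) ->
  (\int[P]_t (f (x + W t))%:E <= (f x + m * f1 + v / 2 * f2)%:E)%E.
Proof.
move=> f20 fw.
have i1 : P.-integrable setT (EFin \o (fun t => f1 * W t)).
  exact: (integrableZl measurableT f1 iW).
have i2 : P.-integrable setT (EFin \o (fun t => f2 / 2 * W t ^+ 2)).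
  exact: (integrableZl measurableT (f2 / 2) iW2).
have ic : P.-integrable setT (EFin \o (fun _ : T => f x)).
  by apply: finite_measure_integrable_cst.
have i3 : P.-integrable setT (EFin \o (fun t => f x + f1 * W t)) by exact: (integrableD _ ic i1).
have i4 : P.-integrable setT (EFin \o (fun t => (f x + f1 * W t) + f2 / 2 * W t ^+ 2)).
  exact: (integrableD _ i3 i2).
apply: (@le_trans _ _ (\int[P]_t ((f x + f1 * W t) + f2 / 2 * W t ^+ 2)%:E)%E).
  apply: ge0_le_integral => //.
  - by move=> t _; rewrite lee_fin.
  - exact/measurable_EFinP.
  - by case/integrableP : i4.
  - by move=> t _; rewrite lee_fin; apply: (le_trans (fw _ (W0 t))); lra.
rewrite -(fineK (integrable_fin_num measurableT i4)) lee_fin.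
rewrite -[fine _]/(\int[P]_t ((f x + f1 * W t) + f2 / 2 * W t ^+ 2)).
rewrite (RintegralD measurableT i3 i2) (RintegralD measurableT ic i1).
rewrite (RintegralZl _ measurableT iW) (RintegralZl _ measurableT iW2) EW EW2 Rintegral_cst//.
have -> : fine (P setT) = 1 by rewrite probability_setT.
by lra.
Qed.

Let K := 2 * c * expR (b + m + v / 2).

Let K0 : 0 <= K. Proof. by rewrite /K mulr_ge0 ?expR_ge0// mulr_ge0. Qed.

(** Exchanges the truncated weight for one whose Gaussian average is explicit. *)
Let weight_le x : expR (Num.max (- x) 0 * a) <= 1 + expR (- (a * x)).
Proof.
case: (leP (- x) 0) => _; first by rewrite mul0r expR0 lerDl expR_ge0.
by rewrite mulNr mulrC lerDr.
Qed.

(** A Bernoulli piece of mean [h ^+ 2] is traded for Gaussian variance [h ^+ 2 * v]. The upper half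
    of the jet bounds the left side by [f x + h ^+ 2 * (m * f1 + v / 2 * f2)]; its lower half, at a
    Gaussian increment with drift [h ^+ 2 * m], gives the same quantity from below, minus an error
    of order [h ^+ 3]. *)
Let one_step x h : 0 < h -> h <= 1 ->
  ((1 - h ^+ 2)%:E * (f x)%:E + (h ^+ 2)%:E * \int[P]_t (f (x + W t))%:E <=
   \int[gauss]_y (f (x + h ^+ 2 * m + h * Num.sqrt v * y))%:E +
   (K * h ^+ 3 * (1 + expR (- (a * x))))%:E)%E.
Proof.
move=> h0 h1; have [f1 [f2 [f20 fw fy]]] := fjet x.
have h21 : h ^+ 2 <= 1 by rewrite exprn_ile1// ltW.
have h2h : h ^+ 2 <= h by rewrite expr2 ler_piMr// ltW.
have h20 := exprn_gt0 2 h0; have h30 := exprn_gt0 3 h0.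
apply: (@le_trans _ _ (f x + h ^+ 2 * m * f1 + h ^+ 2 * v / 2 * f2)%:E).
  apply: (@le_trans _ _ ((1 - h ^+ 2)%:E * (f x)%:E + (h ^+ 2)%:E * (f x + m * f1 + v / 2 * f2)%:E)%E).
    by rewrite leeD2l// lee_wpmul2l// ?upper// lee_fin ltW.
  by rewrite -!EFinM -EFinD lee_fin; lra.
set D := c * expR (b + Num.max (- x) 0 * a) * h ^+ 3 * expR m.
have D0 : 0 <= D by rewrite /D !mulr_ge0 ?expR_ge0// ltW.
have := @gauss_lower_bound R (fun y => f (x + h ^+ 2 * m + h * Num.sqrt v * y))
  (f x + h ^+ 2 * m * f1) (h * Num.sqrt v * f1 + h ^+ 2 * m * (h * Num.sqrt v) * f2)
  (h ^+ 2 * v / 2 * f2) D (Num.sqrt v).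
have sv0 := sqrtr_ge0 v; have sv := sqr_sqrtr v0.
move=> H; have {H} := H _ _ _ _; rewrite sv => H.
apply: (@le_trans _ _ ((f x + h ^+ 2 * m * f1 + h ^+ 2 * v / 2 * f2 - 2 * D * expR (v / 2))%:E +
     (K * h ^+ 3 * (1 + expR (- (a * x))))%:E)%E); last first.
  rewrite leeD2r//; apply: H => //.
  - by apply: (measurableT_comp mf); apply: measurable_funD => //; exact: measurable_funM.
  - by rewrite !mulr_ge0// ltW.
  - move=> y; set Y := h ^+ 2 * m + h * Num.sqrt v * y.
    have := fy Y; rewrite addrA; apply: le_trans.
    (* The squared drift, of order [h ^+ 4], is nonnegative and is dropped. *)
    have Y2 : h ^+ 2 * v * y ^+ 2 + 2 * (h ^+ 2 * m * (h * Num.sqrt v)) * y <= Y ^+ 2.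
      rewrite -[X in _ * X * _ ^+ 2]sv /Y -subr_ge0.
      by rewrite (_ : _ - _ = (h ^+ 2 * m) ^+ 2) ?sqr_ge0//; ring.
    have Y3 : `|Y| ^+ 3 <= h ^+ 3 * (6 * (expR m * (expR (Num.sqrt v * y) + expR (- (Num.sqrt v * y))))).
      apply: (@le_trans _ _ ((h * (m + Num.sqrt v * `|y|)) ^+ 3)).
        rewrite lerXn2r ?nnegrE// ?mulr_ge0 ?addr_ge0 ?mulr_ge0 ?(ltW h0)//.
        apply: (le_trans (ler_normD _ _)); rewrite mulrDr lerD//.
          have hm : 0 <= h ^+ 2 * m by rewrite mulr_ge0// ltW.
          by rewrite (ger0_norm hm); exact: ler_wpM2r.
        by rewrite !normrM (ger0_norm (ltW h0)) (ger0_norm sv0) mulrA.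
      rewrite exprMn ler_wpM2l ?(ltW h30)//.
      apply: (le_trans (exprn_le_expR 3 _)); first by rewrite addr_ge0// mulr_ge0.
      rewrite ler_wpM2l// expRD ler_wpM2l ?expR_ge0//.
      have -> : Num.sqrt v * `|y| = `|Num.sqrt v * y| by rewrite normrM ger0_norm.
      exact: expR_norm_le.
    have Y2f := ler_wpM2r f20 Y2.
    have cE0 : 0 <= c * expR (b + Num.max (- x) 0 * a) by rewrite mulr_ge0 ?expR_ge0.
    have Y3f := ler_wpM2l cE0 Y3.
    have -> : c / 6 * expR (b + Num.max (- x) 0 * a) = c * expR (b + Num.max (- x) 0 * a) / 6 by rewrite mulrAC.
    rewrite /D mulNr; move: Y2f Y3f; rewrite -/Y.
    move: (c * expR _) => q1; move: (expR m) => q2; move: (expR _) => q3; move: (expR _) => q4.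
    move: (`|Y| ^+ 3) => Z Y2f Y3f.
    have Y2g : h ^+ 2 * v / 2 * f2 * y ^+ 2 + h ^+ 2 * m * (h * Num.sqrt v) * f2 * y <= Y ^+ 2 / 2 * f2 by lra.
    have Y3g : q1 / 6 * Z <= q1 * h ^+ 3 * q2 * (q3 + q4) by lra.
    have YE : Y * f1 = h ^+ 2 * m * f1 + h * Num.sqrt v * f1 * y by rewrite /Y; ring.
    lra.
rewrite -EFinD lee_fin.
have -> : 2 * D * expR (v / 2) = K * h ^+ 3 * expR (Num.max (- x) 0 * a).
  by rewrite /D /K !expRD; ring.
have : K * h ^+ 3 * expR (Num.max (- x) 0 * a) <= K * h ^+ 3 * (1 + expR (- (a * x))).
  by rewrite ler_wpM2l// mulr_ge0// ltW.
by move: (expR (Num.max _ _ * _)) (expR (- _)) => ? ?; lra.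
Qed.

(** The sides differ by [s * e] times [x + z - (y + y)]. A Bernoulli variable of mean [s + e] is
    compared with the sum of two independent ones of means [s] and [e]; [x], [y], [z] are the
    averages after zero, one and two independent jumps. *)
Let mix (s e : R) (x y z : \bar R) : 0 <= s -> 0 <= e -> s + e <= 1 ->
  (0 <= x)%E -> (0 <= y)%E -> (0 <= z)%E -> (y + y <= x + z)%E ->
  ((1 - (s + e))%:E * x + (s + e)%:E * y <=
   (1 - s)%:E * ((1 - e)%:E * x + e%:E * y) + s%:E * ((1 - e)%:E * y + e%:E * z))%E.
Proof.
move=> s0 e0 se x0 y0 z0 yy.
have s1 : 0 <= 1 - s by lra. have e1 : 0 <= 1 - e by lra.
have p0 : 0 <= 1 - (s + e) by lra. have r0 : 0 <= s * e by rewrite mulr_ge0.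
have q1 : 0 <= (1 - s) * e by rewrite mulr_ge0. have q2 : 0 <= s * (1 - e) by rewrite mulr_ge0.
have H : ((s * e)%:E * (y + y) <= (s * e)%:E * (x + z))%E by rewrite lee_wpmul2l// lee_fin.
have -> : ((s + e)%:E * y = ((1 - s) * e)%:E * y + (s * (1 - e))%:E * y + (s * e)%:E * (y + y))%E.
  rewrite (ge0_muleDr _ y0 y0) -!ge0_muleDl ?lee_fin ?addr_ge0//.
  by rewrite -!EFinD; congr (_%:E * _)%E; ring.
have -> : ((1 - s)%:E * ((1 - e)%:E * x + e%:E * y) + s%:E * ((1 - e)%:E * y + e%:E * z) =
   (1 - (s + e))%:E * x + (((1 - s) * e)%:E * y + (s * (1 - e))%:E * y + (s * e)%:E * (x + z)))%E.
  rewrite (ge0_muleDr _ x0 z0) !ge0_muleDr ?mule_ge0 ?lee_fin// !muleA -!EFinM.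
  have -> : (1 - s) * (1 - e) = (1 - (s + e)) + s * e by ring.
  rewrite EFinD ge0_muleDl ?lee_fin// -!addeA; congr (_ + _)%E.
  by rewrite addeCA; congr (_ + _)%E; rewrite addeCA.
by rewrite leeD2l// leeD2l.
Qed.

Section Mesh.
Variables (h : R) (N : nat).
Hypotheses (h0 : 0 < h) (hN : h ^+ 2 * N%:R = 1).

(** Deviation of [j] accumulated Gaussian increments of variance [h ^+ 2 * v]; [G j] is [f] smoothed
    by that much noise. *)
Let sc j := h * Num.sqrt v * Num.sqrt j%:R.
Let G j (x : Rm) : \bar R := (\int[gauss]_z (f (x + sc j * z))%:E)%E.

Let mfE : measurable_fun setT (fun x : Rm => (f x)%:E).
Proof. exact/measurable_EFinP. Qed.

Let G0 j x : (0 <= G j x)%E.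
Proof. by apply: integral_ge0 => z _; rewrite lee_fin. Qed.

Let mG j : measurable_fun setT (G j).
Proof.
apply: (@measurable_fun_fubini_tonelli_F _ _ Rm Rm R gauss (fun p : Rm * Rm => (f (p.1 + sc j * p.2))%:E)); last first.
  by move=> p; rewrite lee_fin.
apply: (measurableT_comp mfE); apply: measurable_funD => //; exact: measurable_funM.
Qed.

Let mGW j (x : R) : measurable_fun setT (fun t => G j (x + W t)%R).
Proof. by apply: (measurableT_comp (mG j)); exact: measurable_funD. Qed.

Let mGWW j (x : R) : measurable_fun setT (fun t => \int[P]_u G j (x + W t + W u)%R)%E.
Proof.
apply: (@measurable_fun_fubini_tonelli_F _ _ T T R P (fun p : T * T => G j (x + W p.1 + W p.2)%R)) => //.
apply: (measurableT_comp (mG j)); apply: measurable_funD; last exact: (measurableT_comp mW).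
by apply: measurable_funD => //; exact: (measurableT_comp mW).
Qed.

Let msc j x : measurable_fun setT (fun z : Rm => (f (x + sc j * z))%:E).
Proof. by apply: (measurableT_comp mfE); apply: measurable_funD => //; exact: measurable_funM. Qed.

Let smG j (x y z : R) : 0 <= y -> 0 <= z -> (G j (x + y)%R + G j (x + z)%R <= G j x + G j (x + y + z)%R)%E.
Proof.
move=> y0 z0; rewrite /G -!(@ge0_integralD _ Rm R gauss setT measurableT)//; try by move=> t _; rewrite lee_fin.
apply: (@ge0_le_integral _ Rm R gauss setT measurableT) => //.
- by move=> t _; rewrite adde_ge0 ?lee_fin.
- exact: emeasurable_funD.
- exact: emeasurable_funD.
- move=> t _; rewrite -!EFinD lee_fin; have := fsm (x + sc j * t) y0 z0.
  by rewrite -!(addrAC _ _ (sc j * t)).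
Qed.

Let smGW j (x : R) : (\int[P]_t G j (x + W t)%R + \int[P]_t G j (x + W t)%R <=
  G j x + \int[P]_t \int[P]_u G j (x + W t + W u)%R)%E.
Proof.
have cst (q : \bar R) : (\int[P]_t q = q)%E by rewrite integral_cst// [X in (_ * X)%E]probability_setT mule1.
have -> : (\int[P]_t G j (x + W t)%R + \int[P]_t G j (x + W t)%R =
    \int[P]_t \int[P]_u (G j (x + W t)%R + G j (x + W u)%R))%E.
  rewrite -[X in (_ + X)%E]cst -(@ge0_integralD _ T R P setT measurableT)//; last by move=> t _; exact: integral_ge0.
  by apply: eq_integral => t _; rewrite [RHS](@ge0_integralD _ T R P setT measurableT)// cst.
have -> : (G j x + \int[P]_t \int[P]_u G j (x + W t + W u)%R =
    \int[P]_t \int[P]_u (G j x + G j (x + W t + W u)%R))%E.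
  rewrite -[in LHS](cst (G j x)) -(@ge0_integralD _ T R P setT measurableT)//; last by move=> t _; exact: integral_ge0.
  by apply: eq_integral => t _; rewrite [RHS](@ge0_integralD _ T R P setT measurableT)// cst.
have mGD t : measurable_fun setT (fun u => G j (x + W t)%R + G j (x + W u)%R)%E.
  by apply: emeasurable_funD.
have mGD' t : measurable_fun setT (fun u => G j x + G j (x + W t + W u)%R)%E.
  by apply: emeasurable_funD.
apply: (@ge0_le_integral _ T R P setT measurableT).
- by move=> t _; apply: integral_ge0 => u _; rewrite adde_ge0.
- rewrite (_ : (fun _ => _) = (fun t => G j (x + W t)%R + \int[P]_u G j (x + W u)%R)%E); first exact: emeasurable_funD.
  by apply/funext => t; rewrite [LHS](@ge0_integralD _ T R P setT measurableT)// cst.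
- rewrite (_ : (fun _ => _) = (fun t => G j x + \int[P]_u G j (x + W t + W u)%R)%E); first exact: emeasurable_funD.
  by apply/funext => t; rewrite [LHS](@ge0_integralD _ T R P setT measurableT)// cst.
- move=> t _; apply: (@ge0_le_integral _ T R P setT measurableT).
  - by move=> u _; rewrite adde_ge0.
  - exact: mGD.
  - exact: mGD'.
  - by move=> u _; exact: smG.
Qed.

Let err (x : R) := K * h ^+ 3 * (1 + expR (- (a * x)) * expR (a ^+ 2 * v / 2)).

(** As [j < N], the deviation [sc j] is at most [Num.sqrt v], which bounds the Gaussian average of
    the exponential weight. *)
Let gauss_mix j (x : R) : (j < N)%N ->
  (\int[gauss]_z (K * h ^+ 3 * (1 + expR (- (a * (x + sc j * z)%R))))%:E <= (err x)%:E)%E.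
Proof.
move=> jN.
have Kh0 : 0 <= K * h ^+ 3 by rewrite mulr_ge0// exprn_ge0// ltW.
have mexp : measurable_fun setT (fun z : Rm => (expR (- (a * sc j) * z))%:E).
  by apply/measurable_EFinP; apply: measurableT_comp => //; exact: measurable_funM.
have -> : (\int[gauss]_z (K * h ^+ 3 * (1 + expR (- (a * (x + sc j * z)%R))))%:E =
   (K * h ^+ 3)%:E * \int[gauss]_z (1%:E + (expR (- (a * x)))%:E * (expR (- (a * sc j) * z))%:E))%E.
  rewrite -(@ge0_integralZl _ Rm R gauss setT measurableT).
  - apply: eq_integral => z _; rewrite [RHS](_ : _ =
      (K * h ^+ 3 * (1 + expR (- (a * x)) * expR (- (a * sc j) * z)))%:E)// -expRD.
    by congr (_ * (1 + expR _))%:E; ring.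
  - by apply: emeasurable_funD => //; exact: emeasurable_funM.
  - by move=> z _; rewrite adde_ge0// mule_ge0// lee_fin expR_ge0.
  - by rewrite lee_fin.
rewrite /err (EFinM (K * h ^+ 3)); apply: lee_wpmul2l; first by rewrite lee_fin.
have mexp2 : measurable_fun setT (fun z : Rm => (expR (- (a * x)))%:E * (expR (- (a * sc j) * z))%:E)%E.
  exact: emeasurable_funM.
have exp20 (z : R) : (0 <= (expR (- (a * x)))%:E * (expR (- (a * sc j) * z))%:E)%E.
  by rewrite mule_ge0// lee_fin expR_ge0.
rewrite (@ge0_integralD _ Rm R gauss setT measurableT)//.
rewrite integral_cst// [X in (_ * X)%E]probability_setT mule1 EFinD leeD2l//.
have exp0 (z : R) : (0 <= (expR (- (a * sc j) * z))%:E)%E by rewrite lee_fin expR_ge0.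
have exp1 : (0 <= (expR (- (a * x)))%:E)%E by rewrite lee_fin expR_ge0.
rewrite (@ge0_integralZl _ Rm R gauss setT measurableT _ mexp _ (fun z _ => exp0 z) exp1).
rewrite (EFinM (expR _)); apply: lee_wpmul2l; first by rewrite lee_fin expR_ge0.
rewrite gauss_mgf lee_fin ler_expR.
rewrite ler_pM2r ?invr_gt0// sqrrN exprMn ler_wpM2l ?sqr_ge0// /sc !exprMn !sqr_sqrtr//.
by rewrite mulrAC ler_piMl// -[X in _ <= X]hN ler_pM2l ?exprn_gt0// ler_nat ltnW.
Qed.

(** [one_step] at [x + sc j * z], averaged over [z]; by [gauss_rotation] the noises of deviation
    [sc j] and [h * Num.sqrt v] merge into one of deviation [sc j.+1]. *)
Let step j (x : R) : (j < N)%N -> ((1 - h ^+ 2)%:E * G j x + (h ^+ 2)%:E * \int[P]_t G j (x + W t)%R <=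
  G j.+1 (x + h ^+ 2 * m)%R + (err x)%:E)%E.
Proof.
move=> jN.
have h21 : h ^+ 2 <= 1.
  by rewrite -[X in _ <= X]hN ler_peMr ?exprn_ge0 ?(ltW h0)// ler1n (leq_trans _ jN).
have h1 : h <= 1 by rewrite -(@expr_le1 _ 2)// ltW.
have mF : measurable_fun setT (fun p : Rm * T => (f (x + sc j * p.1 + W p.2))%:E).
  apply: (measurableT_comp mfE); apply: measurable_funD; last exact: (measurableT_comp mW).
  by apply: measurable_funD => //; exact: measurable_funM.
have mI : measurable_fun setT (fun z : Rm => \int[P]_t (f (x + sc j * z + W t))%:E)%E.
  apply: (@measurable_fun_fubini_tonelli_F _ _ Rm T R P _ mF).
  by move=> p; rewrite lee_fin.
have mFF : measurable_fun setT (fun p : T * Rm => (f (x + W p.1 + sc j * p.2))%:E).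
  apply: (measurableT_comp mfE); apply: measurable_funD; last exact: measurable_funM.
  by apply: measurable_funD => //; exact: (measurableT_comp mW).
have -> : (\int[P]_t G j (x + W t)%R = \int[gauss]_z \int[P]_t (f (x + sc j * z + W t))%:E)%E.
  rewrite (@fubini_tonelli _ _ T Rm R P gauss _ mFF); last by move=> p; rewrite lee_fin.
  by apply: eq_integral => z _; apply: eq_integral => t _; rewrite addrAC.
have I0 z : (0 <= \int[P]_t (f (x + sc j * z + W t))%:E)%E.
  by apply: integral_ge0 => t _; rewrite lee_fin.
have hE0 : (0 <= (h ^+ 2)%:E)%E by rewrite lee_fin sqr_ge0.
have h1E0 : (0 <= (1 - h ^+ 2)%:E)%E by rewrite lee_fin subr_ge0.
rewrite /G -!(@ge0_integralZl _ Rm R gauss setT measurableT)//; last by move=> z _; rewrite lee_fin.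
rewrite -(@ge0_integralD _ Rm R gauss setT measurableT)//; last 4 first.
  - by move=> z _; rewrite mule_ge0// lee_fin.
  - exact: emeasurable_funM.
  - by move=> z _; rewrite mule_ge0.
  - exact: emeasurable_funM.
have mS : measurable_fun setT (fun p : Rm * Rm => (f (x + sc j * p.1 + h ^+ 2 * m + h * Num.sqrt v * p.2))%:E).
  apply: (measurableT_comp mfE); apply: measurable_funD; last exact: measurable_funM.
  by apply: measurable_funD => //; apply: measurable_funD => //; exact: measurable_funM.
have mSI : measurable_fun setT (fun z : Rm => \int[gauss]_y (f (x + sc j * z + h ^+ 2 * m + h * Num.sqrt v * y))%:E)%E.
  apply: (@measurable_fun_fubini_tonelli_F _ _ Rm Rm R gauss _ mS).
  by move=> p; rewrite lee_fin.
have SI0 z : (0 <= \int[gauss]_y (f (x + sc j * z + h ^+ 2 * m + h * Num.sqrt v * y))%:E)%E.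
  by apply: integral_ge0 => y _; rewrite lee_fin.
have mE : measurable_fun setT (fun z : Rm => (K * h ^+ 3 * (1 + expR (- (a * (x + sc j * z)))))%:E).
  apply/measurable_EFinP; apply: measurable_funM => //; apply: measurable_funD => //.
  apply: measurableT_comp => //; apply: measurableT_comp => //; apply: measurable_funM => //.
  by apply: measurable_funD => //; exact: measurable_funM.
have E0 z : 0 <= K * h ^+ 3 * (1 + expR (- (a * (x + sc j * z)))).
  by rewrite mulr_ge0 ?mulr_ge0 ?exprn_ge0 ?(ltW h0)// addr_ge0// expR_ge0.
apply: (@le_trans _ _ (\int[gauss]_z (\int[gauss]_y (f (x + sc j * z + h ^+ 2 * m + h * Num.sqrt v * y)%R)%:E +
   (K * h ^+ 3 * (1 + expR (- (a * (x + sc j * z)%R))))%:E))%E).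
  apply: (@ge0_le_integral _ Rm R gauss setT measurableT).
  - by move=> z _; rewrite adde_ge0// mule_ge0// lee_fin.
  - by apply: emeasurable_funD; exact: emeasurable_funM.
  - exact: emeasurable_funD.
  - by move=> z _; exact: one_step.
rewrite (@ge0_integralD _ Rm R gauss setT measurableT)//; last by move=> z _; rewrite lee_fin.
rewrite leeD ?gauss_mix// le_eqVlt; apply/orP; left; apply/eqP.
have q0 : 0 < Num.sqrt j.+1%:R :> R by rewrite sqrtr_gt0 ltr0n.
have mh : measurable_fun setT (fun u : Rm => (f (x + h ^+ 2 * m + sc j.+1 * u))%:E).
  by apply: (measurableT_comp mfE); apply: measurable_funD => //; exact: measurable_funM.
have h0' u : (0 <= (f (x + h ^+ 2 * m + sc j.+1 * u))%:E)%E by rewrite lee_fin.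
rewrite -(gauss_rotation (a := Num.sqrt j%:R / Num.sqrt j.+1%:R) (b := (Num.sqrt j.+1%:R)^-1) mh h0').
- apply: eq_integral => z _; apply: eq_integral => y _; congr (f _)%:E.
  by rewrite /sc; field; rewrite gt_eqF.
- by rewrite divr_ge0 ?sqrtr_ge0.
- by rewrite invr_ge0 sqrtr_ge0.
- rewrite exprVn expr_div_n !sqr_sqrtr ?ler0n// -[X in _ + X]mul1r -mulrDl natr1 divff// pnatr_eq0//.
Qed.

Let EWs x : (\int[P]_t G 0 (x + W t)%R = \int[P]_t (f (x + W t))%:E)%E.
Proof.
apply: eq_integral => t _; rewrite /G /sc sqrtr0 mulr0.
transitivity (\int[gauss]_z (f (x + W t))%:E)%E.
  by apply: eq_integral => z _; rewrite mul0r addr0.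
by rewrite integral_cst// [X in (_ * X)%E]probability_setT mule1.
Qed.

Let E0 := K * h ^+ 3 * (1 + expR (a * m) * expR (a ^+ 2 * v / 2)).

(** Since [W] is nonnegative, base points on the path never fall below [- m]; this makes the error
    uniform. *)
Let err_le (s t : R) : 0 <= s <= 1 -> 0 <= t -> err (- (s * m) + t) <= E0.
Proof.
move=> /andP[s0 s1] t0; rewrite /err /E0 ler_wpM2l ?mulr_ge0 ?exprn_ge0 ?(ltW h0)//.
rewrite lerD2l ler_wpM2r ?expR_ge0// ler_expR -mulrN ler_wpM2l//.
by rewrite opprD opprK lerBlDr (le_trans (ler_piMl m0 s1))// lerDl.
Qed.

(** Mean of [f] at b W - s m plus Gaussian noise of variance [(1 - s) * v], with b Bernoulli of mean
    [s]. The end [k = N] is [W - m], and [k = 0] is the pure Gaussian. *)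
Let Psi k := let s := k%:R * h ^+ 2 in
  ((1 - s)%:E * G (N - k) (- (s * m))%R + s%:E * \int[P]_t G (N - k) (- (s * m) + W t)%R)%E.

(** Split the Bernoulli variable with [mix], then apply [step] on both branches, at [x0] and at
    [x0 + W t]. The drift [h ^+ 2 * m] in [step] accounts exactly for the change of centring. *)
Let Psi_step k : (k < N)%N -> (Psi k.+1 <= Psi k + E0%:E)%E.
Proof.
move=> kN; rewrite /Psi; have -> : (N - k)%N = (N - k.+1).+1 by rewrite subnSK.
set j := (N - k.+1)%N; have jN : (j < N)%N by rewrite /j ltn_subrL (leq_ltn_trans _ kN).
set s := k%:R * h ^+ 2; have sE : k.+1%:R * h ^+ 2 = s + h ^+ 2 by rewrite /s -natr1 mulrDl mul1r.
have h2 := exprn_gt0 2 h0.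
have s0 : 0 <= s by rewrite mulr_ge0// ltW.
have s1 : s + h ^+ 2 <= 1 by rewrite -sE -[X in _ <= X]hN mulrC ler_pM2l// ler_nat.
rewrite sE; set x0 := - ((s + h ^+ 2) * m).
have xE : x0 + h ^+ 2 * m = - (s * m) by rewrite /x0; ring.
have ss : 0 <= s + h ^+ 2 <= 1 by rewrite s1 andbT addr_ge0// ltW.
have s1' : 0 <= 1 - s by rewrite subr_ge0 (le_trans _ s1)// lerDl ltW.
apply: le_trans (mix s0 (ltW h2) s1 (G0 j x0) _ _ (smGW j x0)) _.
- by apply: integral_ge0.
- by apply: integral_ge0 => t _; exact: integral_ge0.
have E00 : 0 <= E0.
  by rewrite /E0 !mulr_ge0 ?addr_ge0 ?mulr_ge0 ?exprn_ge0 ?expR_ge0 ?(ltW h0)//.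
have err0 x : 0 <= err x.
  by rewrite /err !mulr_ge0 ?addr_ge0 ?mulr_ge0 ?exprn_ge0 ?expR_ge0 ?(ltW h0)//.
have I1 : ((1 - h ^+ 2)%:E * G j x0 + (h ^+ 2)%:E * \int[P]_t G j (x0 + W t)%R <=
    G j.+1 (- (s * m))%R + E0%:E)%E.
  rewrite -xE; apply: (le_trans (step _ jN)); rewrite leeD2l// lee_fin.
  by rewrite -[x0]addr0; apply: err_le.
have mGx t : measurable_fun setT (fun u => G j (x0 + W t + W u)%R) by [].
have h1E : (0 <= (1 - h ^+ 2)%:E)%E.
  by rewrite lee_fin subr_ge0 (le_trans _ s1)// lerDr.
have hE : (0 <= (h ^+ 2)%:E)%E by rewrite lee_fin ltW.
have GW0 t : (0 <= \int[P]_u G j (x0 + W t + W u)%R)%E by exact: integral_ge0.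
have I2 : ((1 - h ^+ 2)%:E * \int[P]_t G j (x0 + W t)%R +
      (h ^+ 2)%:E * \int[P]_t \int[P]_u G j (x0 + W t + W u)%R <=
    \int[P]_t G j.+1 (- (s * m) + W t)%R + E0%:E)%E.
  rewrite -!(@ge0_integralZl _ T R P setT measurableT)//.
  rewrite -(@ge0_integralD _ T R P setT measurableT)//; last 4 first.
  - by move=> t _; rewrite mule_ge0.
  - exact: emeasurable_funM.
  - by move=> t _; rewrite mule_ge0.
  - exact: emeasurable_funM.
  have -> : (\int[P]_t G j.+1 (- (s * m) + W t)%R + E0%:E = \int[P]_t (G j.+1 (- (s * m) + W t)%R + E0%:E))%E.
    rewrite [RHS](@ge0_integralD _ T R P setT measurableT)//; congr (_ + _)%E.
    by rewrite integral_cst// [X in (_ * X)%E]probability_setT mule1.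
  apply: (@ge0_le_integral _ T R P setT measurableT).
  - by move=> t _; rewrite adde_ge0// mule_ge0.
  - by apply: emeasurable_funD; exact: emeasurable_funM.
  - exact: emeasurable_funD.
  - move=> t _; have := step (x0 + W t) jN; rewrite (addrAC x0 (W t)) xE => /le_trans; apply.
    by rewrite leeD2l// lee_fin; exact: err_le.
apply: (@le_trans _ _ ((1 - s)%:E * (G j.+1 (- (s * m))%R + E0%:E) +
    s%:E * (\int[P]_t G j.+1 (- (s * m) + W t)%R + E0%:E))%E).
  by rewrite leeD// lee_wpmul2l ?lee_fin.
have IW0 : (0 <= \int[P]_t G j.+1 (- (s * m) + W t)%R)%E by exact: integral_ge0.
have E00E : (0 <= E0%:E)%E by rewrite lee_fin.
rewrite (ge0_muleDr _ (G0 _ _) E00E) (ge0_muleDr _ IW0 E00E) addeACA leeD2l// -!EFinM -EFinD lee_fin.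
by rewrite -mulrDl subrK mul1r.
Qed.

(** There are [N] steps with an error of order [h ^+ 3] each; as [h ^+ 2 * N%:R = 1], the total is
    of order [h]. *)
Lemma comparison_mesh : (\int[P]_t (f (W t - m))%:E <= \int[gauss]_z (f (Num.sqrt v * z))%:E +
  (h * (K * (1 + expR (a * m) * expR (a ^+ 2 * v / 2))))%:E)%E.
Proof.
have ind k : (k <= N)%N -> (Psi k <= Psi 0 + (k%:R * E0)%:E)%E.
  elim: k => [|k IH] kN; first by rewrite mul0r adde0.
  apply: (le_trans (Psi_step kN)); apply: (@le_trans _ _ (Psi 0 + (k%:R * E0)%:E + E0%:E)%E).
    by rewrite leeD2r// IH// ltnW.
  by rewrite -addeA -EFinD -natr1 mulrDl mul1r.
have := ind N (leqnn N).
have -> : Psi N = (\int[P]_t (f (W t - m))%:E)%E.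
  rewrite /Psi subnn mulrC hN subrr mul0e add0e mul1e EWs.
  by apply: eq_integral => t _; rewrite mul1r addrC.
have -> : Psi 0 = (\int[gauss]_z (f (Num.sqrt v * z))%:E)%E.
  rewrite /Psi !mul0r subr0 mul1e mul0e adde0 oppr0 subn0.
  apply: eq_integral => z _; rewrite add0r /sc.
  have hs : h * Num.sqrt N%:R = 1.
    by rewrite -[h]ger0_norm ?(ltW h0)// -sqrtr_sqr -sqrtrM ?sqr_ge0// hN sqrtr1.
  by rewrite (mulrAC h) hs mul1r.
move=> H; apply: (le_trans H); rewrite leeD2l// lee_fin /E0.
rewrite le_eqVlt; apply/orP; left; apply/eqP.
transitivity ((h ^+ 2 * N%:R) * (h * (K * (1 + expR (a * m) * expR (a ^+ 2 * v / 2))))); first by ring.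
by rewrite hN mul1r.
Qed.

End Mesh.

Lemma scalar_comparison :
  (\int[P]_t (f (W t - m))%:E <= \int[gauss]_z (f (Num.sqrt v * z))%:E)%E.
Proof.
apply/lee_addgt0Pr => e e0; set C := K * (1 + expR (a * m) * expR (a ^+ 2 * v / 2)).
have C0 : 0 <= C by rewrite /C mulr_ge0 ?addr_ge0 ?mulr_ge0 ?expR_ge0.
set N := (Num.truncn ((C / e) ^+ 2)).+1; have N0 : 0 < N%:R :> R by rewrite ltr0n.
have hN : (Num.sqrt N%:R)^-1 ^+ 2 * N%:R = 1 :> R.
  by rewrite exprVn sqr_sqrtr ?(ltW N0)// mulVf// gt_eqF.
have h0 : 0 < (Num.sqrt N%:R)^-1 :> R by rewrite invr_gt0 sqrtr_gt0.
apply: (le_trans (comparison_mesh h0 hN)); rewrite leeD2l// lee_fin -/C.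
rewrite mulrC ler_pdivrMr ?sqrtr_gt0// mulrC -ler_pdivrMr//.
rewrite -(@ler_pXn2r _ 2) ?nnegrE ?sqrtr_ge0 ?divr_ge0 ?(ltW e0)// sqr_sqrtr ?(ltW N0)//.
by rewrite ltW// truncnS_gt.
Qed.

End ScalarComparison.

(** * Finite products of real lines and joint laws *)

Section ProductSpace.
Variable R : realType.
Local Notation Rm := (measurableTypeR R).

(** Nested pairs ending in [unit], packed with their displays, so that Fubini applies by recursion
    on [n]. *)
Fixpoint rspace_sig (n : nat) : {d : measure_display & measurableType d} :=
  if n is m.+1
  then existT _ _ ((Rm * projT2 (rspace_sig m))%type : measurableType _)
  else existT _ _ (unit : measurableType _).

Definition rspace n := projT2 (rspace_sig n).

Fixpoint prodP n : ('I_n -> probability Rm R) -> probability (rspace n) R :=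
  match n with
  | 0 => fun _ => (\d_ tt : probability unit R)
  | m.+1 => fun nu => ((nu ord0 \x prodP (fun i => nu (lift ord0 i)))%E : probability (Rm * rspace m)%type R)
  end.

Fixpoint coord n : rspace n -> 'I_n -> R :=
  match n with
  | 0 => fun _ _ => 0
  | m.+1 => fun x i => if unlift ord0 i is Some j then coord x.2 j else x.1
  end.

Fixpoint rvec n : ('I_n -> R) -> rspace n :=
  match n with
  | 0 => fun _ => tt
  | m.+1 => fun X => (X ord0, rvec (fun i => X (lift ord0 i)))
  end.

Lemma coord0 n (x : rspace n.+1) : coord x ord0 = x.1.
Proof. by rewrite /= unlift_none. Qed.

Lemma coordS n (x : rspace n.+1) i : coord x (lift ord0 i) = coord (x.2 : rspace n) i.
Proof. by rewrite /= liftK. Qed.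

Lemma coord_rvec n (X : 'I_n -> R) i : coord (rvec X) i = X i.
Proof.
elim: n X i => [|n IH] X i; first by case: i.
by case: (unliftP ord0 i) => [j|] ->; [rewrite coordS IH|rewrite coord0].
Qed.

Lemma measurable_coord n (i : 'I_n) : measurable_fun setT (fun x : rspace n => coord x i : Rm).
Proof.
elim: n i => [|n IH] i; first by case: i.
case: (unliftP ord0 i) => [j|] ->.
  rewrite (_ : (fun _ => _) = (fun y : rspace n => coord y j) \o snd); last first.
    by apply/funext => x; exact: coordS.
  exact: (measurableT_comp (IH j) measurable_snd).
rewrite (_ : (fun _ => _) = fst); first exact: measurable_fst.
by apply/funext => x; exact: coord0.
Qed.

Lemma measurable_rvec n d (T : measurableType d) (X : 'I_n -> T -> Rm) :
  (forall i, measurable_fun setT (X i)) -> measurable_fun setT (fun t => rvec (fun i => X i t)).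
Proof.
elim: n X => [|n IH] X mX; first exact: measurable_cst.
apply: (@measurable_fun_pair _ _ _ T Rm (rspace n)); first exact: mX.
by apply: (IH (fun i => X (lift ord0 i))) => i; exact: mX.
Qed.

Section JointLaw.
Variables (d : measure_display) (T : measurableType d) (P : probability T R).

(** The event [E] makes the induction go through: it stores the constraints on the coordinates
    already peeled off. Both sides are finite measures in [C] that agree on rectangles. *)
Lemma joint_law n (X : 'I_n -> {mfun T >-> Rm}) (E : set T) : measurable E ->
  (forall B : 'I_n -> set Rm, (forall i, measurable (B i)) ->
     P (E `&` [set t | forall i, B i (X i t)]) = (P E * \prod_i P (X i @^-1` B i))%E) ->
  forall C : set (rspace n), measurable C ->
  P (E `&` [set t | C (rvec (fun i => X i t))]) =
    (P E * prodP (fun i => distribution P (X i)) C)%E.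
Proof.
elim: n X E => [|n IH] X E mE indep C mC.
  rewrite /= diracE; have [Ctt|Ctt] := pselect (C tt).
    rewrite mem_set// mule1; congr (P _); apply/seteqP; split=> [t []//|t Et]; split=> //.
  rewrite memNset// mule0 -[RHS](measure0 P); congr (P _).
  by apply/seteqP; split=> [t []//|t].
pose p := NngNum (fine_ge0 (measure_ge0 P E)).
have pE : (p%:num%:E = P E)%E by rewrite /= fineK// fin_num_measure.
pose phi (t : T) : Rm * rspace n := (X ord0 t, rvec (fun i => X (lift ord0 i) t)).
have mphi : measurable_fun setT phi.
  apply: (@measurable_fun_pair _ _ _ T Rm (rspace n)); first exact: measurable_funPT.
  exact: (measurable_rvec (fun i => measurable_funPT (X (lift ord0 i)))).
pose m' := measure_function_pushforward__canonical__measure_function_Measure (mrestr P mE) mphi.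
pose nu0 := mscale p (distribution P (X ord0)).
pose nun := prodP (fun i => distribution P (X (lift ord0 i))).
have rect A1 A2 : measurable A1 -> measurable A2 -> m' (A1 `*` A2) = (nu0 A1 * nun A2)%E.
  move=> mA1 mA2; rewrite /m' /= /pushforward /mrestr/=.
  pose E1 := E `&` (X ord0 @^-1` A1).
  have mE1 : measurable E1 by apply: measurableI => //; rewrite -[X in measurable X]setTI; exact: measurable_funPT.
  have PE1 : P E1 = (P E * P (X ord0 @^-1` A1))%E.
    have := indep (fun i => if i == ord0 then A1 else setT).
    rewrite big_ord_recl/= big1 ?mule1; last by move=> i _; rewrite preimage_setT probability_setT.
    move=> <-; last by move=> i; case: ifP.
    congr (P (_ `&` _)); apply/seteqP; split=> [t /= At i|t /(_ ord0)//].
    by case: eqP => // ->.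
  transitivity (P (E1 `&` [set t | A2 (rvec (fun i => X (lift ord0 i) t))])).
    congr (P _); rewrite setIC /E1 -setIA; congr (_ `&` _).
  rewrite (IH (fun i => X (lift ord0 i)) E1 mE1 _ A2 mA2); last first.
    move=> B mB; pose B' i := if unlift ord0 i is Some j then B j else A1.
    have := indep B' _; rewrite big_ord_recl/= /B' unlift_none muleA -PE1.
    under eq_bigr do rewrite liftK.
    move=> <-; last by move=> i; case: unliftP.
    rewrite -setIA; congr (P (_ `&` _)); apply/seteqP; split=> t /=.
      by move=> [A1t Bt] i; case: unliftP => [j ->|->].
    by move=> H; split; [have := H ord0; rewrite unlift_none|move=> i; have := H (lift ord0 i); rewrite liftK].
  by rewrite PE1 /nu0 /mscale/= -pE.
transitivity (m' C); first by rewrite /m'/= /pushforward /mrestr setIC.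
rewrite -(product_measure_unique (m1 := nu0) (m2 := nun) rect)//.
rewrite /nu0 /= /product_measure1 ge0_integral_mscale// ?pE//.
exact: measurable_fun_xsection.
Qed.

Lemma ge0_integral_joint n (X : 'I_n -> {mfun T >-> Rm}) (h : rspace n -> \bar R) :
  (forall B : 'I_n -> set Rm, (forall i, measurable (B i)) ->
     P [set t | forall i, B i (X i t)] = (\prod_i P (X i @^-1` B i))%E) ->
  measurable_fun setT h -> (forall x, 0 <= h x)%E ->
  (\int[P]_t h (rvec (fun i => X i t)) = \int[prodP (fun i => distribution P (X i))]_x h x)%E.
Proof.
move=> indep mh h0.
have mX := measurable_rvec (fun i => measurable_funPT (X i)).
pose pf := measure_function_pushforward__canonical__measure_function_Measure P mX.
transitivity (\int[pf]_x h x)%E.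
  by rewrite (ge0_integral_pushforward mX).
apply: eq_measure_integral => C mC _; rewrite /pf/= /pushforward.
have := joint_law (X := X) measurableT _ mC; rewrite setTI probability_setT mul1e; apply.
by move=> B mB; rewrite setTI mul1e indep.
Qed.

End JointLaw.

End ProductSpace.

Section MeasurableTraceExp.
Variables (R : realType) (dS : measure_display) (S : measurableType dS).
Local Notation Rm := (measurableTypeR R).
Local Notation C := R[i].

Definition measurable_cplx (z : S -> C) : Prop :=
  measurable_fun setT (fun s => complex.Re (z s) : Rm) /\ measurable_fun setT (fun s => complex.Im (z s) : Rm).

Definition measurable_mx m n (M : S -> 'M[C]_(m, n)) : Prop :=
  forall i j, measurable_cplx (fun s => M s i j).

Lemma measurable_cplxD (y z : S -> C) : measurable_cplx y -> measurable_cplx z ->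
  measurable_cplx (fun s => y s + z s).
Proof.
move=> [y1 y2] [z1 z2]; split.
  by under eq_fun do rewrite raddfD/=; exact: measurable_funD.
by under eq_fun do rewrite raddfD/=; exact: measurable_funD.
Qed.

Lemma measurable_cplxM (y z : S -> C) : measurable_cplx y -> measurable_cplx z ->
  measurable_cplx (fun s => y s * z s).
Proof.
move=> [y1 y2] [z1 z2]; split.
  rewrite (_ : (fun _ => _) = (fun s => complex.Re (y s) * complex.Re (z s) - complex.Im (y s) * complex.Im (z s))).
    by apply: measurable_funB; exact: measurable_funM.
  by apply/funext => s; case: (y s) (z s) => [? ?] [? ?].
rewrite (_ : (fun _ => _) = (fun s => complex.Re (y s) * complex.Im (z s) + complex.Im (y s) * complex.Re (z s))).
  by apply: measurable_funD; exact: measurable_funM.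
by apply/funext => s; case: (y s) (z s) => [? ?] [? ?].
Qed.

Lemma measurable_cplx_cst (z : C) : measurable_cplx (fun=> z).
Proof. by split; exact: measurable_cst. Qed.

Lemma measurable_cplx_real (r : S -> Rm) : measurable_fun setT r -> measurable_cplx (fun s => (r s)%:C%C).
Proof. by move=> mr; split => //; exact: measurable_cst. Qed.

Lemma measurable_cplx_sum (I : Type) (r : seq I) (z : I -> S -> C) :
  (forall i, measurable_cplx (z i)) -> measurable_cplx (fun s => \sum_(i <- r) z i s).
Proof.
move=> mz; elim: r => [|i r IH].
  by rewrite (_ : (fun _ => _) = fun=> 0); [exact: measurable_cplx_cst|apply/funext => s; rewrite big_nil].
rewrite (_ : (fun _ => _) = fun s => z i s + \sum_(i <- r) z i s); first exact: measurable_cplxD.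
by apply/funext => s; rewrite big_cons.
Qed.

Lemma measurable_mxD m n (M N : S -> 'M[C]_(m, n)) : measurable_mx M -> measurable_mx N ->
  measurable_mx (fun s => M s + N s).
Proof.
move=> mM mN i j; rewrite (_ : (fun _ => _) = fun s => M s i j + N s i j); last first.
  by apply/funext => s; rewrite mxE.
exact: measurable_cplxD.
Qed.

Lemma measurable_mx_cst m n (M : 'M[C]_(m, n)) : measurable_mx (fun=> M).
Proof. by move=> i j; exact: measurable_cplx_cst. Qed.

Lemma measurable_mxZ m n (z : S -> C) (M : S -> 'M[C]_(m, n)) : measurable_cplx z -> measurable_mx M ->
  measurable_mx (fun s => z s *: M s).
Proof.
move=> mz mM i j; rewrite (_ : (fun _ => _) = fun s => z s * M s i j); last first.
  by apply/funext => s; rewrite mxE.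
exact: measurable_cplxM.
Qed.

Lemma measurable_mxM m n p (M : S -> 'M[C]_(m, n)) (N : S -> 'M[C]_(n, p)) : measurable_mx M ->
  measurable_mx N -> measurable_mx (fun s => M s *m N s).
Proof.
move=> mM mN i j; rewrite (_ : (fun _ => _) = fun s => \sum_k M s i k * N s k j); last first.
  by apply/funext => s; rewrite mxE.
by apply: measurable_cplx_sum => k; exact: measurable_cplxM.
Qed.

Lemma measurable_mx_sum m n k (M : 'I_k -> S -> 'M[C]_(m, n)) :
  (forall i, measurable_mx (M i)) -> measurable_mx (fun s => \sum_i M i s).
Proof.
move=> mM i j; rewrite (_ : (fun _ => _) = fun s => \sum_l M l s i j).
  by apply: measurable_cplx_sum => l; exact: mM.
by apply/funext => s; rewrite summxE.
Qed.

Lemma measurable_mxX d (M : S -> 'M[C]_d) k : measurable_mx M -> measurable_mx (fun s => M s ^+ k).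
Proof.
move=> mM; elim: k => [|k IH]; first exact: measurable_mx_cst.
rewrite (_ : (fun _ => _) = fun s => M s *m M s ^+ k); first exact: measurable_mxM.
by apply/funext => s; rewrite exprS.
Qed.

Lemma measurable_trexp d (M : S -> 'M[C]_d) : measurable_mx M -> (forall s, (M s)^t* = M s) ->
  measurable_fun setT (fun s => trexp (M s) : Rm).
Proof.
move=> mM hM; apply: (measurable_fun_cvg (h := fun n s => trexp_approx n (M s))); last first.
  by move=> s _; exact: cvg_trexp.
move=> n; suff [] : measurable_cplx (fun s => \tr ((1%:M - (n.+4%:R^-1)%:C%C *: M s) ^+ n.+4)) by [].
apply: measurable_cplx_sum => i; apply: measurable_mxX; apply: measurable_mxD; first exact: measurable_mx_cst.
rewrite (_ : (fun _ => _) = fun s => (- (n.+4%:R^-1)%:C%C) *: M s); last first.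
  by apply/funext => s; rewrite scaleNr.
by apply: measurable_mxZ => //; exact: measurable_cplx_cst.
Qed.

End MeasurableTraceExp.

Section VectorComparison.
Variables (R : realType) (d : nat) (dT : measure_display) (T : measurableType dT) (P : probability T R).
Local Notation Rm := (measurableTypeR R).
Local Notation C := R[i].
Local Notation gauss := (@normal_prob R 0 1).

Lemma adj_comb n (A : 'I_n -> 'M[C]_d) (B : 'M[C]_d) (c : 'I_n -> R) : B^t* = B ->
  (forall i, (A i)^t* = A i) ->
  (B + \sum_i (c i)%:C%C *: A i)^t* = B + \sum_i (c i)%:C%C *: A i.
Proof.
move=> hB hA; rewrite adj_mxD hB; congr (_ + _); elim/big_ind: _ => [|M N hM hN|i _].
- by rewrite trmx0 map_mx0.
- by rewrite adj_mxD hM hN.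
- apply/matrixP => j k; rewrite -[in RHS]hA !mxE rmorphM; congr (_ * _).
  exact: conjc_real.
Qed.

Lemma measurable_comb dS (S : measurableType dS) n (A : 'I_n -> 'M[C]_d) (B : S -> 'M[C]_d) (c : 'I_n -> S -> Rm) :
  measurable_mx B -> (forall i, measurable_fun setT (c i)) ->
  measurable_mx (fun s => B s + \sum_i (c i s)%:C%C *: A i).
Proof.
move=> mB mc; apply: measurable_mxD => //; apply: measurable_mx_sum => i.
by apply: measurable_mxZ; [exact: measurable_cplx_real|exact: measurable_mx_cst].
Qed.

(** The tail is exchanged first, with the head coordinate frozen into [B]; then the head is
    exchanged by [scalar_comparison], with the Gaussian tail frozen. Fubini reverses the order of
    integration in between. *)
Lemma vector_comparison n (W : 'I_n -> {mfun T >-> Rm}) (m v : 'I_n -> R)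
    (A : 'I_n -> 'M[C]_d) (B : 'M[C]_d) :
  (forall i t, 0 <= W i t) -> (forall i, P.-integrable setT (EFin \o W i)) ->
  (forall i, P.-integrable setT (EFin \o (fun t => W i t ^+ 2))) ->
  (forall i, \int[P]_t W i t = m i) -> (forall i, \int[P]_t (W i t ^+ 2) = v i) ->
  (forall i, psdC (A i)) -> B^t* = B ->
  (\int[prodP (fun i => distribution P (W i))]_x
     (trexp (B + \sum_i (coord x i - m i)%:C%C *: A i))%:E <=
   \int[prodP (fun _ : 'I_n => gauss)]_x
     (trexp (B + \sum_i (Num.sqrt (v i) * coord x i)%:C%C *: A i))%:E)%E.
Proof.
elim: n W m v A B => [|n IH] W m v A B W0 iW iW2 EW EW2 pA hB.
  rewrite le_eqVlt; apply/orP; left; apply/eqP.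
  by apply: eq_integral => x _; rewrite !big_ord0.
have hA i : (A i)^t* = A i by case: (pA i).
pose law i := distribution P (W (lift ord0 i)).
pose L (p : Rm * rspace R n) := (B + (p.1 - m ord0)%:C%C *: A ord0 +
  \sum_i (coord p.2 i - m (lift ord0 i))%:C%C *: A (lift ord0 i)).
pose H (p : Rm * rspace R n) := (B + (p.1 - m ord0)%:C%C *: A ord0 +
  \sum_i (Num.sqrt (v (lift ord0 i)) * coord p.2 i)%:C%C *: A (lift ord0 i)).
pose G (p : Rm * rspace R n) := (B + (Num.sqrt (v ord0) * p.1)%:C%C *: A ord0 +
  \sum_i (Num.sqrt (v (lift ord0 i)) * coord p.2 i)%:C%C *: A (lift ord0 i)).
have hB1 c : (B + c%:C%C *: A ord0)^t* = B + c%:C%C *: A ord0.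
  by have := adj_comb (fun _ : 'I_1 => c) hB (fun _ : 'I_1 => hA ord0); rewrite big_ord1.
have hL p : (L p)^t* = L p by exact: adj_comb.
have hH p : (H p)^t* = H p by exact: adj_comb.
have hG p : (G p)^t* = G p by exact: adj_comb.
have mcoord (i : 'I_n) : measurable_fun setT (fun p : Rm * rspace R n => coord p.2 i : Rm).
  rewrite (_ : (fun _ => _) = (fun y : rspace R n => coord y i) \o snd)//.
  exact: (measurableT_comp (measurable_coord i) measurable_snd).
have mfst : measurable_fun setT (fun p : Rm * rspace R n => p.1) by exact: measurable_fst.
have mB (c : Rm * rspace R n -> Rm) : measurable_fun setT c ->
    measurable_mx (fun p : Rm * rspace R n => B + (c p)%:C%C *: A ord0).
  move=> mc; apply: measurable_mxD; first exact: measurable_mx_cst.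
  by apply: measurable_mxZ; [exact: measurable_cplx_real|exact: measurable_mx_cst].
have mL : measurable_fun setT (fun p => (trexp (L p))%:E).
  apply/measurable_EFinP; apply: (measurable_trexp _ hL); apply: measurable_comb.
    by apply: mB; exact: measurable_funB.
  by move=> i; apply: measurable_funB => //; exact: mcoord.
have mH : measurable_fun setT (fun p => (trexp (H p))%:E).
  apply/measurable_EFinP; apply: (measurable_trexp _ hH); apply: measurable_comb.
    by apply: mB; exact: measurable_funB.
  by move=> i; apply: measurable_funM => //; exact: mcoord.
have mG : measurable_fun setT (fun p => (trexp (G p))%:E).
  apply/measurable_EFinP; apply: (measurable_trexp _ hG); apply: measurable_comb.
    by apply: mB; exact: measurable_funM.
  by move=> i; apply: measurable_funM => //; exact: mcoord.
have L0 p : (0 <= (trexp (L p))%:E)%E by rewrite lee_fin; exact: (trexp_ge0 (hL p)).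
have H0 p : (0 <= (trexp (H p))%:E)%E by rewrite lee_fin; exact: (trexp_ge0 (hH p)).
have G0 p : (0 <= (trexp (G p))%:E)%E by rewrite lee_fin; exact: (trexp_ge0 (hG p)).
pose gn := prodP (fun _ : 'I_n => gauss).
pose nu0 : probability Rm R := distribution P (W ord0).
have -> : (\int[prodP (fun i => distribution P (W i))]_x
     (trexp (B + \sum_i (coord x i - m i)%:C%C *: A i))%:E =
     \int[nu0]_x \int[prodP law]_y (trexp (L (x, y)))%:E)%E.
  rewrite -[RHS](fubini_tonelli1 (m1 := nu0) (m2 := prodP law) _ mL L0).
  apply: eq_integral => x _; rewrite big_ord_recl coord0 addrA; congr (trexp (_ + _))%:E.
  by apply: eq_bigr => i _; rewrite coordS.
have -> : (\int[prodP (fun _ : 'I_n.+1 => gauss)]_x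
     (trexp (B + \sum_i (Num.sqrt (v i) * coord x i)%:C%C *: A i))%:E =
     \int[gn]_y \int[gauss]_x (trexp (G (x, y)))%:E)%E.
  rewrite -(@fubini_tonelli _ _ Rm (rspace R n) R gauss gn _ mG G0).
  rewrite -[RHS](fubini_tonelli1 (m1 := gauss) (m2 := gn) _ mG G0).
  apply: eq_integral => x _; rewrite big_ord_recl coord0 addrA; congr (trexp (_ + _))%:E.
  by apply: eq_bigr => i _; rewrite coordS.
apply: (@le_trans _ _ (\int[nu0]_x \int[gn]_y (trexp (H (x, y)))%:E)%E).
  apply: (@ge0_le_integral _ Rm R nu0 setT measurableT).
  - by move=> x _; exact: integral_ge0.
  - exact: (@measurable_fun_fubini_tonelli_F _ _ Rm (rspace R n) R (prodP law) _ mL L0).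
  - exact: (@measurable_fun_fubini_tonelli_F _ _ Rm (rspace R n) R gn _ mH H0).
  - move=> x _; apply: (IH (fun i => W (lift ord0 i)) (fun i => m (lift ord0 i))
      (fun i => v (lift ord0 i)) (fun i => A (lift ord0 i)) (B + (x - m ord0)%:C%C *: A ord0)) => //.
rewrite (@fubini_tonelli _ _ Rm (rspace R n) R nu0 gn _ mH H0).
apply: (@ge0_le_integral _ (rspace R n) R gn setT measurableT).
- by move=> y _; exact: integral_ge0.
- exact: (@measurable_fun_fubini_tonelli_G _ _ Rm (rspace R n) R nu0 _ mH H0).
- exact: (@measurable_fun_fubini_tonelli_G _ _ Rm (rspace R n) R gauss _ mG G0).
move=> y _.
pose B' := B + \sum_i (Num.sqrt (v (lift ord0 i)) * coord y i)%:C%C *: A (lift ord0 i).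
have hB' : B'^t* = B' by exact: adj_comb.
pose f (x : Rm) := trexp (pencil (A ord0) B' x).
have mf : measurable_fun setT f.
  apply: measurable_trexp; last by move=> x; apply: adj_pencil.
  rewrite /pencil; apply: measurable_mxD; first exact: measurable_mx_cst.
  by apply: measurable_mxZ; [exact: measurable_cplx_real|exact: measurable_mx_cst].
have f0 x : 0 <= f x by rewrite /f trexp_ge0// adj_pencil.
have mW : measurable_fun setT (W ord0 : T -> R).
  apply: (@measurableT_comp _ _ _ T Rm R (fun z => z) _ (W ord0)); first exact: measurable_id.
  exact: measurable_funPT.
have := scalar_comparison mW (W0 ord0) (iW _) (iW2 _) (EW _) (EW2 _) mf f0
  (trexp_pencil_supermodular hB' (pA ord0)) (trexp_pencil_jet hB' (pA ord0)) _ (frob_ge0 _).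
have HE x : H (x, y) = pencil (A ord0) B' (x - m ord0) by rewrite /H /pencil /B' addrAC.
have GE x : G (x, y) = pencil (A ord0) B' (Num.sqrt (v ord0) * x) by rewrite /G /pencil /B' addrAC.
have -> : (\int[nu0]_x (trexp (H (x, y)))%:E = \int[P]_t (f (W ord0 t - m ord0))%:E)%E.
  have mHy : measurable_fun setT (fun x : Rm => (f (x - m ord0))%:E).
    by apply/measurable_EFinP; apply: (measurableT_comp mf); exact: measurable_funB.
  transitivity (\int[nu0]_x (f (x - m ord0))%:E)%E.
    by apply: eq_integral => x _; rewrite HE.
  by apply: (ge0_integral_distribution (W ord0) mHy) => x; rewrite lee_fin.
move=> /(_ _)/le_trans; apply; first by rewrite !mulr_ge0 ?exprn_ge0 ?frob_ge0.
rewrite le_eqVlt; apply/orP; left; apply/eqP.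
by apply: eq_integral => x _; rewrite GE.
Qed.

End VectorComparison.

(** * Gaussian concentration *)

Section PrekopaLeindler.
Variable R : realType.
Local Notation Rm := (measurableTypeR R).
Local Notation mu := (@lebesgue_measure R).

Let measurable_translate (c : R) (A : set Rm) : measurable A -> measurable [set z : Rm | A (c + z)].
Proof.
move=> mA; have mc : measurable_fun setT (fun z : Rm => (c + z : R) : Rm) by exact: measurable_funD.
by rewrite -[X in measurable X]setTI; exact: (mc measurableT _ mA).
Qed.

Let translate (A : set Rm) (c : R) : measurable A -> mu [set z : Rm | A (c + z)] = mu A.
Proof.
move=> mA; have m1 : measurable_fun setT (fun z : Rm => (\1_A z : R)%:E).
  exact/measurable_EFinP/measurable_indic.
have mB := measurable_translate c mA.
have m0 (z : R) : (0 <= (\1_A z : R)%:E)%E by rewrite lee_fin indicE ler0n.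
have := integral_affine c ltr01 m1 m0; rewrite mul1e => E.
transitivity (\int[mu]_y (\1_A (c + 1 * y) : R)%:E)%E; last by rewrite -E integral_indic// setIT.
rewrite -[LHS](congr1 mu (setIT _)) -integral_indic//; apply: eq_integral => y _; congr (_%:E).
by rewrite !indicE mul1r; congr (_%:R); apply/idP/idP; rewrite !inE.
Qed.

Let I (n : nat) : set Rm := `[- n%:R, n%:R]%classic.

Let below (a : R) : set Rm := `]-oo, a[%classic.

Let above (a : R) : set Rm := `[a, +oo[%classic.

Let mI n : measurable (I n). Proof. exact: measurable_itv. Qed.

Let mbelow a : measurable (below a). Proof. exact: measurable_itv. Qed.

Let mabove a : measurable (above a). Proof. exact: measurable_itv. Qed.

Let belowE a z : below a z -> z < a. Proof. by rewrite /below/= in_itv. Qed.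

Let aboveE a z : above a z -> a <= z. Proof. by rewrite /above/= in_itv/= andbT. Qed.

(** Take a point of [A] within [e] of the supremum of the bounded piece: what is not strictly below
    it fits in an interval of length [e]. *)
Let lower (A : set Rm) n (e : R) : measurable A -> A !=set0 -> 0 < e ->
  exists2 a, A a & (mu (A `&` I n) <= mu (A `&` below a) + e%:E)%E.
Proof.
move=> mA [a1 Aa1] e0.
have [[a2 Aa2]|A0] := pselect (exists x, (A `&` I n) x); last first.
  exists a1 => //; rewrite (_ : _ `&` I n = set0) ?measure0 ?adde_ge0// ?lee_fin ?ltW//.
  by apply/seteqP; split=> // x Ax; apply: A0; exists x.
have hs : has_sup (A `&` I n).
  split; first by exists a2.
  by exists n%:R => x [_]; rewrite /I/= in_itv/= => /andP[].
have [a [Aa Ia] sa] := sup_adherent e0 hs.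
exists a => //; have le : (A `&` I n) `<=` (A `&` below a) `|` `[a, a + e]%classic.
  move=> x [Ax Ix]; have [xa|ax] := ltP x a; first by left; split => //=; rewrite /below/= in_itv.
  right; rewrite /= in_itv/= ax/=; have := ub_le_sup (proj2 hs) (conj Ax Ix); lra.
apply: (le_trans (le_measure mu _ _ le)); rewrite ?inE.
- by apply: measurableI.
- by apply: measurableU => //; by apply: measurableI.
apply: (le_trans (measureU2 _ _ _)) => //; first by apply: measurableI.
have le_e : (mu (`[a, (a + e)%R]%classic : set Rm) <= e%:E)%E.
  rewrite lebesgue_measure_itv/=; case: ifP => _; last by rewrite lee_fin ltW.
  by rewrite -EFinB lee_fin addrAC subrr add0r.
exact: leeD2l.
Qed.

Let upper (A : set Rm) n (e : R) : measurable A -> A !=set0 -> 0 < e ->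
  exists2 a, A a & (mu (A `&` I n) <= mu (A `&` above a) + e%:E)%E.
Proof.
move=> mA [a1 Aa1] e0.
have [[a2 Aa2]|A0] := pselect (exists x, (A `&` I n) x); last first.
  exists a1 => //; rewrite (_ : _ `&` I n = set0) ?measure0 ?adde_ge0// ?lee_fin ?ltW//.
  by apply/seteqP; split=> // x Ax; apply: A0; exists x.
have hs : has_inf (A `&` I n).
  split; first by exists a2.
  by exists (- n%:R) => x [_]; rewrite /I/= in_itv/= => /andP[].
have [a [Aa Ia] sa] := inf_adherent e0 hs.
exists a => //; have le : (A `&` I n) `<=` (A `&` above a) `|` `[a - e, a]%classic.
  move=> x [Ax Ix]; have [xa|ax] := leP a x; first by left; split => //=; rewrite /above/= in_itv/= xa.
  right; rewrite /= in_itv/= (ltW ax) andbT; have := ge_inf (proj2 hs) (conj Ax Ix); lra.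
apply: (le_trans (le_measure mu _ _ le)); rewrite ?inE.
- by apply: measurableI.
- by apply: measurableU => //; by apply: measurableI.
apply: (le_trans (measureU2 _ _ _)) => //; first by apply: measurableI.
have le_e : (mu (`[(a - e)%R, a]%classic : set Rm) <= e%:E)%E.
  rewrite lebesgue_measure_itv/=; case: ifP => _; last by rewrite lee_fin ltW.
  by rewrite -EFinB lee_fin opprB addrCA subrr addr0.
exact: leeD2l.
Qed.

(** The part of [A] below [a], shifted by [b], and the part of [B] above [b], shifted by [a], are
    subsets of [D] on the two sides of [a + b], hence disjoint. Truncation to bounded pieces
    provides [a] and [b] that lose almost no mass. *)
Lemma brunn_minkowski1 (A B D : set Rm) : measurable A -> measurable B -> measurable D ->
  A !=set0 -> B !=set0 -> (forall a b, A a -> B b -> D (a + b)) -> (mu A + mu B <= mu D)%E.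
Proof.
move=> mA mB mD A0 B0 AB.
have bnd n : (mu (A `&` I n) + mu (B `&` I n) <= mu D)%E.
  apply/lee_addgt0Pr => e e0; have e20 : 0 < e / 2 by rewrite divr_gt0.
  have [a Aa la] := lower n mA A0 e20; have [b Bb lb] := upper n mB B0 e20.
  apply: (le_trans (leeD la lb)); rewrite addeACA -EFinD -splitr leeD2r//.
  rewrite -(translate (- b)) -?[mu (B `&` _)](translate (- a)); [|by apply: measurableI..].
  have mA' : measurable [set z : Rm | (A `&` below a) (- b + z)].
    by apply: measurable_translate; apply: measurableI.
  have mB' : measurable [set z : Rm | (B `&` above b) (- a + z)].
    by apply: measurable_translate; apply: measurableI.
  rewrite -measureU//; last first.
    apply/seteqP; split=> // z [[_ /belowE za] [_ /aboveE zb]].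
    by exfalso; lra.
  apply: le_measure; rewrite ?inE//; first exact: measurableU.
  move=> z /= [[Az _]|[Bz _]].
    by rewrite -(subrK b z) addrC (addrC z) addrC; apply: AB => //; rewrite addrC.
  by rewrite -(subrK a z) addrC; apply: AB => //; rewrite addrC.
have cvg S : measurable S -> mu (S `&` I n) @[n --> \oo] --> mu S.
  move=> mS; rewrite [X in _ --> mu X](_ : S = \bigcup_n (S `&` I n)); last first.
    apply/seteqP; split=> [x Sx|x [n _ []]//]; exists (Num.truncn `|x|).+1 => //; split=> //.
    by rewrite /I/= in_itv/= -ler_norml ltW// truncnS_gt.
  apply: nondecreasing_cvg_mu.
  - by move=> n; by apply: measurableI.
  - by apply: bigcup_measurable => n _; by apply: measurableI.
  - move=> n p np; apply/subsetPset => x [Sx]; rewrite /I/= !in_itv/= => /andP[x1 x2]; split=> //.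
    have : n%:R <= p%:R :> R by rewrite ler_nat.
    by move=> ?; apply/andP; split; lra.
have AB0 : (mu A +? mu B)%E by rewrite ge0_adde_def// inE.
have cv : (mu (A `&` I n) + mu (B `&` I n))%E @[n --> \oo] --> (mu A + mu B)%E.
  exact: (cvgeD AB0 (cvg _ mA) (cvg _ mB)).
rewrite -(cvg_lim _ cv)//; apply: lime_le; first by apply/cvg_ex; exists (mu A + mu B)%E.
exact: nearW.
Qed.

Let layer (U : Rm -> R) := (fun p : Rm * Rm => (\1_([set q : Rm * Rm | 0 < q.2 < U q.1]) p : R)%:E).

Let layer_ge0 U p : (0 <= layer U p)%E.
Proof. by rewrite /layer lee_fin indicE ler0n. Qed.

Let measurable_layer_set (U : Rm -> R) : measurable_fun setT U -> measurable [set q : Rm * Rm | 0 < q.2 < U q.1].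
Proof.
move=> mU; rewrite (_ : mkset _ = [set q | 0 < q.2 :> R] `&` [set q | q.2 < U q.1 :> R]); last first.
  by apply/seteqP; split=> q /=; [move=> /andP[]|move=> [-> ->]].
have m2 : measurable_fun setT (fun q : Rm * Rm => q.2) by exact: measurable_snd.
have mU1 : measurable_fun setT (fun q : Rm * Rm => U q.1).
  by apply: (measurableT_comp mU); exact: measurable_fst.
have mlt (f g : Rm * Rm -> Rm) : measurable_fun setT f -> measurable_fun setT g ->
    measurable [set q | (f q : R) < g q].
  move=> mf mg; have mgf : measurable_fun setT (fun q => (g q : R) - f q : Rm) by exact: measurable_funB.
  rewrite (_ : mkset _ = (fun q => (g q : R) - f q : Rm) @^-1` (`]0, +oo[%classic : set R)).
    by rewrite -[X in measurable X]setTI; apply: mgf => //; exact: measurable_itv.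
  by apply/seteqP; split=> q; rewrite /= in_itv/= andbT subr_gt0.
by apply: measurableI; apply: mlt.
Qed.

Let measurable_layer (U : Rm -> R) : measurable_fun setT U -> measurable_fun setT (layer U).
Proof. by move=> mU; apply/measurable_EFinP/measurable_indic; exact: measurable_layer_set. Qed.

Let lev (U : Rm -> R) (t : R) : set Rm := [set y | 0 < t < U y].

Let layer_cake (U : Rm -> R) : measurable_fun setT U -> (forall y, 0 <= U y) ->
  (\int[mu]_y (U y)%:E = \int[mu]_t mu (lev U t))%E.
Proof.
move=> mU U0.
transitivity (\int[mu]_y \int[mu]_t layer U (y, t))%E.
  apply: eq_integral => y _; rewrite /layer.
  transitivity (\int[mu]_t (\1_(`]0%R, (U y)[%classic : set Rm) t : R)%:E)%E.
    have E : (mu (`]0%R, (U y)[%classic : set Rm) = (U y)%:E)%E.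
      rewrite lebesgue_measure_itv/= lte_fin sube0; case: ltP => // U0'.
      by apply/eqP; rewrite eqe eq_le U0' U0.
    by rewrite integral_indic// setIT; exact: esym E.
  by apply: eq_integral => t _; congr (_%:E); rewrite !indicE; congr (_%:R); apply/idP/idP; rewrite !inE/= in_itv.
rewrite (@fubini_tonelli _ _ Rm Rm R mu mu _ (measurable_layer mU) (layer_ge0 U)).
apply: eq_integral => t _; rewrite /layer.
have mS : measurable (lev U t).
  have := measurable_ysection t (measurable_layer_set mU).
  by congr measurable; apply/seteqP; split=> y; rewrite /ysection/= inE.
rewrite -[RHS](congr1 mu (setIT _)) -integral_indic//; apply: eq_integral => y _; congr (_%:E).
Qed.

(** With suprema equal to 1, the level sets of [U] and [V] are nonempty at the same levels, those
    below 1, so [brunn_minkowski1] applies level by level and the layer-cake formula integrates the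
    result. This is what makes the sum, rather than a geometric mean, appear on the left. *)
Lemma prekopa_leindler1 (U V H : Rm -> R) :
  measurable_fun setT U -> measurable_fun setT V -> measurable_fun setT H ->
  (forall y, 0 <= U y <= 1) -> (forall y, 0 <= V y <= 1) -> (forall y, 0 <= H y) ->
  (forall t, t < 1 -> exists y, t < U y) -> (forall t, t < 1 -> exists y, t < V y) ->
  (forall x y, Num.min (U x) (V y) <= H (x + y)) ->
  (\int[mu]_y (U y)%:E + \int[mu]_y (V y)%:E <= \int[mu]_y (H y)%:E)%E.
Proof.
move=> mU mV mH U01 V01 H0 U1 V1 UVH.
have ge0 F : (forall y : Rm, 0 <= F y <= 1) -> forall y, 0 <= F y by move=> h y; case/andP: (h y).
have msec F (t : R) : measurable_fun setT F -> measurable (lev F t).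
  move=> mF; have := measurable_ysection t (measurable_layer_set mF).
  by congr measurable; apply/seteqP; split=> y; rewrite /ysection/= inE.
have mlev F : measurable_fun setT F -> measurable_fun setT (fun t : Rm => mu (lev F t)).
  move=> mF; rewrite (_ : (fun _ => _) = mu \o ysection [set q : Rm * Rm | 0 < q.2 < F q.1]).
    by apply: measurable_fun_ysection; exact: measurable_layer_set.
  by apply/funext => t; congr (mu _); apply/seteqP; split=> y; rewrite /ysection/= inE.
rewrite !layer_cake// ?ge0//; try exact: ge0.
rewrite -(@ge0_integralD _ Rm R mu setT measurableT)//; try exact: mlev.
apply: (@ge0_le_integral _ Rm R mu setT measurableT).
- by move=> t _; rewrite adde_ge0.
- by apply: emeasurable_funD; exact: mlev.
- exact: mlev.
move=> t _; have [t0|t0] := leP t 0.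
  have E F : lev F t = set0 by apply/seteqP; split=> // y /= /andP[]; rewrite ltNge t0.
  by rewrite !E !measure0 adde0.
have [t1|t1] := ltP t 1.
  apply: brunn_minkowski1; try exact: msec.
  - by have [y yt] := U1 _ t1; exists y; rewrite /lev/= t0.
  - by have [y yt] := V1 _ t1; exists y; rewrite /lev/= t0.
  - move=> a b /andP[_ aU] /andP[_ bV]; rewrite /lev/= t0/=.
    by apply: lt_le_trans (UVH a b); rewrite lt_min aU.
have E F : (forall y, 0 <= F y <= 1) -> lev F t = set0.
  move=> F01; apply/seteqP; split=> // y /= /andP[_]; rewrite ltNge => /negP; apply.
  by apply: le_trans t1; case/andP: (F01 y).
by rewrite (E U)// (E V)// measure0 adde0.
Qed.

End PrekopaLeindler.

Lemma jensen_expR (R : realType) (dT : measure_display) (T : measurableType dT) (P : probability T R)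
    (k : R) (Y : T -> R) : measurable_fun setT Y -> P.-integrable setT (EFin \o Y) ->
  ((expR (- (k * \int[P]_t Y t)))%:E <= \int[P]_t (expR (- (k * Y t)))%:E)%E.
Proof.
move=> mY iY; set G := \int[P]_t Y t.
have i1 : P.-integrable setT (EFin \o (fun _ : T => expR (- (k * G)) * (1 + k * G))).
  exact: finite_measure_integrable_cst.
have i2 : P.-integrable setT (EFin \o (fun t => - (expR (- (k * G)) * k) * Y t)).
  exact: (integrableZl measurableT _ iY).
have i3 : P.-integrable setT (EFin \o (fun t => expR (- (k * G)) * (1 + k * G) + - (expR (- (k * G)) * k) * Y t)).
  exact: (integrableD _ i1 i2).
apply: (@le_trans _ _ (\int[P]_t (expR (- (k * G)) * (1 + k * G) + - (expR (- (k * G)) * k) * Y t)%:E)%E).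
  rewrite -(fineK (integrable_fin_num measurableT i3)) lee_fin.
  rewrite -[fine _]/(\int[P]_t (expR (- (k * G)) * (1 + k * G) + - (expR (- (k * G)) * k) * Y t)).
  rewrite (RintegralD measurableT i1 i2) (RintegralZl _ measurableT iY) Rintegral_cst// -/G.
  have -> : fine (P setT) = 1 by rewrite probability_setT.
  by lra.
have mE : measurable_fun setT (fun t => (expR (- (k * Y t)))%:E).
  apply/measurable_EFinP; apply: measurableT_comp => //; apply: measurableT_comp => //.
  exact: measurable_funM.
have le t : expR (- (k * G)) * (1 + k * G) + - (expR (- (k * G)) * k) * Y t <= expR (- (k * Y t)).
  have := @expR_ge1Dx R (k * G - k * Y t) => /(ler_wpM2l (expR_ge0 (- (k * G)))).
  rewrite -expRD (_ : - (k * G) + (k * G - k * Y t) = - (k * Y t)); last by ring.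
  by apply: le_trans; rewrite le_eqVlt; apply/orP; left; apply/eqP; ring.
have [J0|J0] := ltP (\int[P]_t (expR (- (k * Y t)))%:E)%E +oo%E; last by rewrite (le_trans (leey _) J0).
have iE : P.-integrable setT (fun t => (expR (- (k * Y t)))%:E).
  apply/integrableP; split => //; rewrite (_ : (\int[P]_t `|_| = \int[P]_t (expR (- (k * Y t)))%:E)%E)//.
  by apply: eq_integral => t _; rewrite gee0_abs// lee_fin expR_ge0.
by apply: (le_integral measurableT i3 iE) => t _; rewrite lee_fin.
Qed.

Section GaussianInfConvolution.
Variable R : realType.
Local Notation Rm := (measurableTypeR R).
Local Notation mu := (@lebesgue_measure R).
Local Notation gauss := (@normal_prob R 0 1).

Let amgm (s A B : R) : 0 <= s <= 1 -> expR ((1 - s) * A + s * B) <= (1 - s) * expR A + s * expR B.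
Proof.
move=> /andP[s0 s1]; set c := _ + _.
have h x : expR c * (1 + (x - c)) <= expR x.
  have := ler_wpM2l (expR_ge0 c) (expR_ge1Dx (x - c)).
  by rewrite -expRD [c + (x - c)]addrC subrK.
have hA : (1 - s) * (expR c * (1 + (A - c))) <= (1 - s) * expR A by apply: ler_wpM2l (h A); rewrite subr_ge0.
have hB : s * (expR c * (1 + (B - c))) <= s * expR B by exact: ler_wpM2l (h B).
apply: (@le_trans _ _ ((1 - s) * (expR c * (1 + (A - c))) + s * (expR c * (1 + (B - c))))).
  by rewrite le_eqVlt; apply/orP; left; apply/eqP; rewrite /c; ring.
exact: lerD.
Qed.

Variables (s : R) (phi g : Rm -> R).
Hypotheses (s01 : 0 < s < 1) (mphi : measurable_fun setT phi) (mg : measurable_fun setT g).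
Hypotheses (phi0 : forall x, 0 <= phi x) (ig : gauss.-integrable setT (EFin \o g)).
Hypothesis phig : forall x y, phi x <= expR (g y + (1 - s) / 2 * (x - y) ^+ 2).

Let s0 : 0 < s. Proof. by case/andP: s01. Qed.
Let s1 : 0 < 1 - s. Proof. by rewrite subr_gt0; case/andP: s01. Qed.

Let k := s / (1 - s).
Let pk : R := normal_peak 1.
Let pk0 : 0 < pk. Proof. exact: normal_peak_gt0. Qed.
Let u (y : Rm) : R := expR (- (k * g y)) * (pk * expR (- (y ^+ 2 / 2))).
Let v (x : Rm) : R := phi x * (pk * expR (- (x ^+ 2 / 2))).

Let pdfE (x : Rm) : normal_pdf 0 1 x = pk * expR (- (x ^+ 2 / 2)).
Proof. by rewrite normal_pdfE1// subr0 expr1n mulNr. Qed.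

Let mpdf : measurable_fun setT (fun x : Rm => pk * expR (- (x ^+ 2 / 2)) : R).
Proof.
have := @measurable_normal_pdf R 0 1; congr (measurable_fun setT _).
by apply/funext => x; exact: pdfE.
Qed.

Let mu_u : measurable_fun setT u.
Proof.
apply: measurable_funM => //; apply: measurableT_comp => //; apply: measurableT_comp => //.
exact: measurable_funM.
Qed.

Let mu_v : measurable_fun setT v.
Proof. exact: measurable_funM. Qed.

Let int_u : (\int[mu]_y (u y)%:E = \int[gauss]_y (expR (- (k * g y)))%:E)%E.
Proof.
have m1 : measurable_fun setT (fun y : Rm => (expR (- (k * g y)))%:E).
  apply/measurable_EFinP; apply: measurableT_comp => //; apply: measurableT_comp => //.
  exact: measurable_funM.
rewrite (integral_normal_prob 0 1 m1); last by move=> y; rewrite lee_fin expR_ge0.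
by apply: eq_integral => y _; rewrite /u -pdfE EFinM.
Qed.

Let int_v : (\int[mu]_y (v y)%:E = \int[gauss]_y (phi y)%:E)%E.
Proof.
have m1 : measurable_fun setT (fun y : Rm => (phi y)%:E) by exact/measurable_EFinP.
rewrite (integral_normal_prob 0 1 m1)//.
by apply: eq_integral => y _; rewrite /v -pdfE EFinM.
Qed.

Let jensen := jensen_expR k mg ig.

(** With [u] and [v] the functions [expR (- (k * g y))] and [phi] times the Gaussian density, the
    identity (1 - s) y^2 + s x^2 - ((1 - s) y + s x)^2 = s (1 - s) (x - y)^2 turns [phig] into the
    statement that u(y)^(1 - s) v(x)^s is at most the density at (1 - s) y + s x. Prekopa-Leindler
    bounds the product of the corresponding powers of the integrals by 1, and Jensen bounds the
    integral of [u] from below. *)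
Lemma gauss_infconv : (\int[gauss]_x (phi x)%:E <= (expR (\int[gauss]_y g y))%:E)%E.
Proof.
set G := \int[gauss]_y g y.
have [[x0 px0]|phi00] := pselect (exists x, 0 < phi x); last first.
  rewrite [X in (X <= _)%E](_ : _ = 0%E) ?lee_fin ?expR_ge0//; apply: integral0_eq => x _; congr (_%:E).
  apply/eqP; rewrite eq_le phi0 andbT leNgt; apply/negP => px; by apply: phi00; exists x.
have u_gt0 y : 0 < u y by rewrite /u !mulr_gt0 ?expR_gt0.
have v0 x : 0 <= v x by rewrite /v mulr_ge0// ltW// mulr_gt0 ?expR_gt0.
have vx0 : 0 < v x0 by rewrite /v mulr_gt0// mulr_gt0 ?expR_gt0.
have vb : has_ubound (range v).
  exists (expR (g 0) * pk) => _ [x _ <-]; rewrite /v mulrCA mulrC ler_pM2r//.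
  have e1 := expR_ge0 (- (x ^+ 2 / 2)); apply: (le_trans (ler_wpM2r e1 (phig x 0))).
  rewrite -expRD ler_expR subr0; have := mulr_ge0 (ltW s0) (sqr_ge0 x); lra.
(* A point [x0] with [phi x0 > 0] gives a quadratic lower bound on [g]; completing the square shows
   that the Gaussian factor outweighs it. *)
have ub : has_ubound (range u).
  exists (expR (- (k * ln (phi x0)) + s / (2 * (1 - s)) * x0 ^+ 2) * pk) => _ [y _ <-].
  rewrite /u mulrCA mulrC ler_pM2r// -expRD ler_expR.
  have lg : ln (phi x0) <= g y + (1 - s) / 2 * (x0 - y) ^+ 2.
    by rewrite -ler_expR lnK ?posrE.
  have kg := ler_wpM2l (divr_ge0 (ltW s0) (ltW s1)) lg; rewrite -/k in kg.
  apply: (@le_trans _ _ (- (k * ln (phi x0)) + k * ((1 - s) / 2 * (x0 - y) ^+ 2) - y ^+ 2 / 2)); first lra.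
  rewrite -addrA lerD2l -subr_ge0.
  have -> : s / (2 * (1 - s)) * x0 ^+ 2 - (k * ((1 - s) / 2 * (x0 - y) ^+ 2) - y ^+ 2 / 2) =
     ((1 - s) * y + s * x0) ^+ 2 / (2 * (1 - s)).
    by rewrite /k; field; rewrite gt_eqF.
  by rewrite divr_ge0 ?sqr_ge0// mulr_ge0// ltW.
have us : has_sup (range u) by split => //; exists (u 0), 0.
have vs : has_sup (range v) by split => //; exists (v 0), 0.
have a0 : 0 < sup (range u) by apply: lt_le_trans (u_gt0 0) (ub_le_sup ub _); exists 0.
have b0 : 0 < sup (range v) by apply: lt_le_trans vx0 (ub_le_sup vb _); exists x0.
set a := ln (sup (range u)); set b := ln (sup (range v)).
have aE : expR a = sup (range u) by rewrite lnK.
have bE : expR b = sup (range v) by rewrite lnK.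
(* [U] and [V] have supremum 1, and their arguments are dilated so that a plain sum replaces the
   convex combination; [e] is the matching normalization of the density. *)
pose e := expR (- ((1 - s) * a + s * b)).
pose U (y : Rm) : R := u ((1 - s)^-1 * y) / expR a.
pose V (x : Rm) : R := v (s^-1 * x) / expR b.
pose H (z : Rm) : R := normal_pdf 0 1 z * e.
have U01 y : 0 <= U y <= 1.
  rewrite /U divr_ge0 ?expR_ge0 ?(ltW (u_gt0 _))//= ler_pdivrMr ?expR_gt0// mul1r aE.
  by apply: ub_le_sup => //; exists ((1 - s)^-1 * y).
have V01 y : 0 <= V y <= 1.
  rewrite /V divr_ge0 ?expR_ge0//= ler_pdivrMr ?expR_gt0// mul1r bE.
  by apply: ub_le_sup => //; exists (s^-1 * y).
have U1 t : t < 1 -> exists y, t < U y.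
  move=> t1; have d0 : 0 < expR a * (1 - t) by rewrite mulr_gt0 ?expR_gt0// subr_gt0.
  have [_ [y _ <-]] := sup_adherent d0 us; rewrite -aE => ty; exists ((1 - s) * y).
  rewrite /U mulrA mulVf ?gt_eqF// mul1r ltr_pdivlMr ?expR_gt0//; lra.
have V1 t : t < 1 -> exists y, t < V y.
  move=> t1; have d0 : 0 < expR b * (1 - t) by rewrite mulr_gt0 ?expR_gt0// subr_gt0.
  have [_ [y _ <-]] := sup_adherent d0 vs; rewrite -bE => ty; exists (s * y).
  rewrite /V mulrA mulVf ?gt_eqF// mul1r ltr_pdivlMr ?expR_gt0//; lra.
have H0 z : 0 <= H z by rewrite /H mulr_ge0 ?normal_pdf_ge0 ?expR_ge0.
have UVH y x : Num.min (U y) (V x) <= H (y + x).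
  have [px|px] := ltP 0 (phi (s^-1 * x)); last first.
    by rewrite ge_min /V /v (_ : phi _ = 0) ?mul0r ?H0 ?orbT//; apply/eqP; rewrite eq_le px phi0.
  set y' := (1 - s)^-1 * y; set x' := s^-1 * x.
  have yE : y = (1 - s) * y' by rewrite /y' mulrA mulfV ?mul1r// gt_eqF.
  have xE : x = s * x' by rewrite /x' mulrA mulfV ?mul1r// gt_eqF.
  set lu := - (k * g y') + ln pk - y' ^+ 2 / 2 - a.
  set lv := ln (phi x') + ln pk - x' ^+ 2 / 2 - b.
  have UE : U y = expR lu by rewrite /U /u -/y' /lu !expRD lnK ?posrE// [expR (- a)]expRN !mulrA.
  have VE : V x = expR lv by rewrite /V /v -/x' /lv !expRD (@lnK _ pk) ?posrE// (@lnK _ (phi x')) ?posrE// [expR (- b)]expRN !mulrA.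
  have lg : ln (phi x') <= g y' + (1 - s) / 2 * (x' - y') ^+ 2 by rewrite -ler_expR lnK ?posrE.
  apply: (@le_trans _ _ (expR ((1 - s) * lu + s * lv))); last first.
    rewrite /H pdfE /e -[X in X * _ * _](@lnK _ pk) ?posrE// -!expRD ler_expR.
    have slg := ler_wpM2l (ltW s0) lg.
    have kE : (1 - s) * (k * g y') = s * g y' by rewrite /k mulrA mulrCA mulfV ?mulr1// gt_eqF.
    rewrite -subr_ge0 in slg; rewrite -subr_ge0; apply: (le_trans slg).
    rewrite le_eqVlt; apply/orP; left; apply/eqP.
    rewrite /lu /lv {1}yE {1}xE.
    transitivity (s * g y' + s * ((1 - s) / 2 * (x' - y') ^+ 2) - s * ln (phi x')); first by ring.
    by rewrite -kE; field.
  (* A minimum is at most the weighted geometric mean. *)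
  rewrite UE VE; case: (leP lu lv) => luv.
    by rewrite ge_min ler_expR; apply/orP; left; have := ler_wpM2l (ltW s0) luv; lra.
  by rewrite ge_min !ler_expR; apply/orP; right; have := ler_wpM2l (ltW s1) (ltW luv); lra.
have mU : measurable_fun setT U.
  by apply: measurable_funM => //; apply: (measurableT_comp mu_u); exact: measurable_funM.
have mV : measurable_fun setT V.
  by apply: measurable_funM => //; apply: (measurableT_comp mu_v); exact: measurable_funM.
have mH : measurable_fun setT H by apply: measurable_funM => //; exact: measurable_normal_pdf.
have PL := prekopa_leindler1 mU mV mH U01 V01 H0 U1 V1 UVH.
have mUE : measurable_fun setT (fun y : Rm => (U y)%:E) by apply/measurable_EFinP; exact: mU.
have mVE : measurable_fun setT (fun y : Rm => (V y)%:E) by apply/measurable_EFinP; exact: mV.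
have U0 y : (0 <= (U y)%:E)%E by rewrite lee_fin; case/andP: (U01 y).
have V0 y : (0 <= (V y)%:E)%E by rewrite lee_fin; case/andP: (V01 y).
have IU : (\int[mu]_y (U y)%:E = ((1 - s) / expR a)%:E * \int[gauss]_y (expR (- (k * g y)))%:E)%E.
  rewrite (integral_affine 0 s1 mUE U0) EFinM -muleA -int_u; congr (_ * _)%E.
  rewrite -(@ge0_integralZl _ Rm R mu setT measurableT).
  - by apply: eq_integral => y _; rewrite /U add0r mulrA mulVf ?gt_eqF// mul1r mulrC EFinM.
  - exact/measurable_EFinP.
  - by move=> y _; rewrite lee_fin ltW.
  - by rewrite lee_fin invr_ge0 expR_ge0.
have IV : (\int[mu]_y (V y)%:E = (s / expR b)%:E * \int[gauss]_y (phi y)%:E)%E.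
  rewrite (integral_affine 0 s0 mVE V0) EFinM -muleA -int_v; congr (_ * _)%E.
  rewrite -(@ge0_integralZl _ Rm R mu setT measurableT).
  - by apply: eq_integral => y _; rewrite /V add0r mulrA mulVf ?gt_eqF// mul1r mulrC EFinM.
  - exact/measurable_EFinP.
  - by move=> y _; rewrite lee_fin.
  - by rewrite lee_fin invr_ge0 expR_ge0.
have IH : (\int[mu]_y (H y)%:E = e%:E)%E.
  transitivity (e%:E * \int[mu]_y (normal_pdf 0 1 y)%:E)%E; last by rewrite integral_normal_pdf mule1.
  rewrite -(@ge0_integralZl _ Rm R mu setT measurableT).
  - by apply: eq_integral => y _; rewrite /H mulrC EFinM.
  - by apply/measurable_EFinP; exact: measurable_normal_pdf.
  - by move=> y _; rewrite lee_fin normal_pdf_ge0.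
  - by rewrite lee_fin expR_ge0.
rewrite IU IV IH in PL.
have c0 : (0 <= ((1 - s) / expR a)%:E)%E by rewrite lee_fin divr_ge0 ?expR_ge0// ltW.
have {}PL := le_trans (leeD (lee_wpmul2l c0 jensen) (lexx _)) PL.
have I0 : (0 <= \int[gauss]_x (phi x)%:E)%E by apply: integral_ge0 => x _; rewrite lee_fin.
move: PL I0; case: (\int[gauss]_x (phi x)%:E)%E => [i|PL _|//].
  rewrite -!EFinM -EFinD !lee_fin -/G => PL i0.
  have [i1|i1] := ltP 0 i; last by apply: (le_trans i1); exact: expR_ge0.
  have s01' : 0 <= s <= 1 by case/andP: s01 => ? ?; apply/andP; split; exact: ltW.
  (* The weighted arithmetic-geometric mean inequality returns from the sum to the product, in which
     the constants [a] and [b] cancel against [e]. *)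
  have := amgm (- (k * G) - a) (ln i - b) s01'.
  rewrite [expR (- (k * G) - a)]expRD [expR (ln i - b)]expRD lnK ?posrE// [expR (- a)]expRN [expR (- b)]expRN => H2.
  have H3 : expR ((1 - s) * (- (k * G) - a) + s * (ln i - b)) <= e.
    by apply: (le_trans H2); move: PL; rewrite -!mulrA (mulrC (expR a)^-1) (mulrC (expR b)^-1).
  rewrite ler_expR in H3; rewrite -(@lnK _ i) ?posrE// ler_expR -(ler_pM2l s0).
  have kE : (1 - s) * (k * G) = s * G by rewrite /k mulrA mulrCA mulfV ?mulr1// gt_eqF.
  by rewrite -kE; lra.
by move: PL; rewrite gt0_muley ?lte_fin ?divr_gt0 ?expR_gt0// -EFinM addey.
Qed.

End GaussianInfConvolution.

(** * Tensorization over product Gaussian measures *)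

Section ProductGauss.
Variable R : realType.
Local Notation Rm := (measurableTypeR R).
Local Notation gauss := (@normal_prob R 0 1).

Definition gaussn n : probability (rspace R n) R := prodP (fun _ : 'I_n => gauss).

Let wt n (x : rspace R n) : R := 1 + \sum_i `|coord x i|.

Let wt_ge1 n (x : rspace R n) : 1 <= wt x.
Proof. by rewrite /wt lerDl sumr_ge0. Qed.

Let mwt n : measurable_fun setT (fun x : rspace R n => (wt x)%:E).
Proof.
apply/measurable_EFinP; apply: measurable_funD => //; apply: measurable_sum => i.
by apply: measurableT_comp => //; exact: measurable_coord.
Qed.

Let wtS n x (y : rspace R n) : @wt n.+1 (x, y) = `|x| + wt y.
Proof.
rewrite /wt big_ord_recl coord0/= addrCA; congr (_ + (_ + _)).
by apply: eq_bigr => i _; rewrite liftK.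
Qed.

Lemma ge0_integral_gaussnS n (h : Rm * rspace R n -> \bar R) : measurable_fun setT h ->
  (forall p, 0 <= h p)%E ->
  (\int[gaussn n.+1]_p h p = \int[gauss]_x \int[gaussn n]_y h (x, y))%E.
Proof. by move=> mh h0; exact: (fubini_tonelli1 (m1 := gauss) (m2 := gaussn n) _ mh h0). Qed.

Let wt_fin n : (\int[gaussn n]_x (wt x)%:E < +oo)%E.
Proof.
elim: n => [|n IH].
  rewrite (eq_integral (fun=> 1%:E)); last by move=> x _; rewrite /wt big_ord0 addr0.
  by rewrite integral_cst// [X in (_ * X)%E]probability_setT mule1 ltry.
rewrite (ge0_integral_gaussnS (@mwt n.+1)); last by move=> p; rewrite lee_fin (le_trans ler01 (wt_ge1 _)).
have mabs : measurable_fun setT (fun x : Rm => `|x|%:E).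
  by case/integrableP: (@integrable_gauss_exprn R 1) => mx _; exact: (measurableT_comp (@abse_measurable R setT) mx).
have J0 : (0 <= \int[gaussn n]_y (wt y)%:E)%E.
  by apply: integral_ge0 => y _; rewrite lee_fin (le_trans ler01 (wt_ge1 _)).
rewrite (eq_integral (fun x : Rm => `|x|%:E + \int[gaussn n]_y (wt y)%:E)%E); last first.
  move=> x _; transitivity (\int[gaussn n]_y (`|x|%:E + (wt y)%:E))%E.
    by apply: eq_integral => y _; rewrite wtS.
  rewrite (@ge0_integralD _ (rspace R n) R (gaussn n) setT measurableT)//.
  - by rewrite integral_cst// [X in (_ * X)%E]probability_setT mule1.
  - by move=> y _; rewrite lee_fin (le_trans ler01 (wt_ge1 _)).
rewrite (@ge0_integralD _ Rm R gauss setT measurableT)//.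
rewrite integral_cst// [X in (_ * X)%E]probability_setT mule1 lte_add_pinfty//.
by have /integrableP[_] := @integrable_gauss_exprn R 1.
Qed.

Lemma integrable_linear_growth n (g : rspace R n -> R) (K : R) : measurable_fun setT g -> 0 <= K ->
  (forall x, `|g x| <= K * (1 + \sum_i `|coord x i|)) -> (gaussn n).-integrable setT (EFin \o g).
Proof.
move=> mg K0 gK; apply/integrableP; split; first exact/measurable_EFinP.
have mab : measurable_fun setT (fun x : rspace R n => `|(EFin \o g) x|%E).
  by apply: measurableT_comp => //; exact/measurable_EFinP.
have wt0 (x : rspace R n) : (0 <= (wt x)%:E)%E by rewrite lee_fin (le_trans ler01 (wt_ge1 _)).
have K0E : (0 <= K%:E)%E by rewrite lee_fin.
have E := @ge0_integralZl _ (rspace R n) R (gaussn n) setT measurableT _ (@mwt n) K%:E (fun x _ => wt0 x) K0E.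
apply: (@le_lt_trans _ _ (K%:E * \int[gaussn n]_x (wt x)%:E)%E).
  rewrite -E; apply: (@ge0_le_integral _ (rspace R n) R (gaussn n) setT measurableT) => //.
    by apply: emeasurable_funM => //; exact: mwt.
  by move=> x _; rewrite lee_fin; exact: gK.
by rewrite lte_mul_pinfty ?lee_fin// wt_fin.
Qed.

(** For fixed head coordinates, the induction hypothesis on slices, with their quadratic cost added
    to [g] as a constant, yields the one-dimensional hypothesis for the partial integrals [phi1] and
    [g1]. Linear growth of [g] keeps every slice integrable. *)
Lemma gaussn_infconv (s : R) n (phi g : rspace R n -> R) (K : R) : 0 < s < 1 ->
  measurable_fun setT phi -> measurable_fun setT g -> (forall x, 0 <= phi x) -> 0 <= K ->
  (forall x, `|g x| <= K * (1 + \sum_i `|coord x i|)) ->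
  (forall x y, phi x <= expR (g y + (1 - s) / 2 * \sum_i (coord x i - coord y i) ^+ 2)) ->
  (\int[gaussn n]_x (phi x)%:E <= (expR (\int[gaussn n]_y g y))%:E)%E.
Proof.
move=> s01; elim: n phi g K => [|n IH] phi g K mphi mg phi0 K0 gK phig.
  rewrite (eq_integral (fun=> (phi tt)%:E)); last by move=> [] _.
  rewrite integral_cst// [X in (_ * X)%E]probability_setT mule1 lee_fin.
  have -> : \int[gaussn 0]_y g y = g tt.
    rewrite /Rintegral (eq_integral (fun=> (g tt)%:E)); last by move=> [] _.
    by rewrite integral_cst// [X in (_ * X)%E]probability_setT mule1.
  by apply: (le_trans (phig tt tt)); rewrite big_ord0 mulr0 addr0.
have mslice x : measurable_fun setT (fun y : rspace R n => (x, y) : Rm * rspace R n).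
  by apply: (@measurable_fun_pair _ _ _ (rspace R n) Rm (rspace R n) (cst x) id).
have mphis x : measurable_fun setT (fun y : rspace R n => phi (x, y)) by exact: (measurableT_comp mphi (mslice x)).
have mgs x : measurable_fun setT (fun y : rspace R n => g (x, y)) by exact: (measurableT_comp mg (mslice x)).
have gKs x y : `|g (x, y)| <= K * (1 + `|x|) * (1 + \sum_i `|coord (y : rspace R n) i|).
  apply: (le_trans (gK _)); rewrite -mulrA ler_wpM2l// -/(wt (_ : rspace R n.+1)) wtS -/(wt y).
  by have := wt_ge1 y; have := normr_ge0 x; nra.
have igs x : (gaussn n).-integrable setT (EFin \o (fun y => g (x, y))).
  by apply: integrable_linear_growth (gKs x) => //; rewrite mulr_ge0// addr_ge0.
pose phi1 (x : Rm) : R := fine (\int[gaussn n]_y (phi (x, y))%:E).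
pose g1 (x : Rm) : R := \int[gaussn n]_y g (x, y).
have slice x y : (\int[gaussn n]_z (phi (x, z))%:E <= (expR (g1 y + (1 - s) / 2 * (x - y) ^+ 2))%:E)%E.
  have ic : (gaussn n).-integrable setT (EFin \o (fun _ : rspace R n => (1 - s) / 2 * (x - y) ^+ 2)).
    exact: finite_measure_integrable_cst.
  have -> : g1 y + (1 - s) / 2 * (x - y) ^+ 2 = \int[gaussn n]_z (g (y, z) + (1 - s) / 2 * (x - y) ^+ 2).
    rewrite (RintegralD measurableT (igs y) ic) Rintegral_cst//.
    by rewrite [X in fine X]probability_setT mulr1.
  have c0 : 0 <= (1 - s) / 2 * (x - y) ^+ 2.
    by rewrite mulr_ge0 ?sqr_ge0// divr_ge0// subr_ge0 ltW//; case/andP: s01.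
  apply: (IH _ _ (K * (1 + `|y|) + (1 - s) / 2 * (x - y) ^+ 2)) => //.
  - exact: measurable_funD.
  - by rewrite addr_ge0// mulr_ge0// addr_ge0.
  - move=> z; apply: (le_trans (ler_normD _ _)); rewrite (mulrDl (K * (1 + `|y|))) lerD//.
    by rewrite ger0_norm// ler_peMr// -/(wt z).
  - move=> z z'; apply: (le_trans (phig _ (y, z'))); rewrite ler_expR.
    rewrite le_eqVlt; apply/orP; left; apply/eqP; rewrite big_ord_recl !coord0 (mulrDr ((1 - s) / 2)) addrA.
    by congr (_ + _ * _); apply: eq_bigr => i _; rewrite !coordS.
have phi1E x : (phi1 x)%:E = (\int[gaussn n]_y (phi (x, y))%:E)%E.
  rewrite /phi1 fineK// ge0_fin_numE; last by apply: integral_ge0 => y _; rewrite lee_fin.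
  by apply: le_lt_trans (slice x x) _; rewrite ltry.
have g1E x : (g1 x)%:E = (\int[gaussn n]_y (g (x, y))%:E)%E.
  by rewrite /g1 /Rintegral fineK//; exact: (integrable_fin_num measurableT (igs x)).
have mphiE : measurable_fun setT (fun p : Rm * rspace R n => (phi p)%:E) by apply/measurable_EFinP; exact: mphi.
have mphi1 : measurable_fun setT phi1.
  apply/measurable_EFinP; rewrite (_ : EFin \o phi1 = fubini_F (gaussn n) (fun p : Rm * rspace R n => (phi p)%:E)).
    by apply: (@measurable_fun_fubini_tonelli_F _ _ Rm (rspace R n) R (gaussn n) _ mphiE) => p; rewrite lee_fin.
  by apply/funext => x; exact: phi1E.
have ig : (gaussn n.+1).-integrable setT (EFin \o g) by exact: integrable_linear_growth gK.
have ig1F := @integrable_fubini_F _ _ Rm (rspace R n) R gauss (gaussn n) _ ig.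
have gE : EFin \o g1 = fubini_F (gaussn n) (EFin \o g : Rm * rspace R n -> \bar R).
  by apply/funext => x; exact: g1E.
have ig1 : gauss.-integrable setT (EFin \o g1) by rewrite gE.
have mg1 : measurable_fun setT g1 by apply/measurable_EFinP; case/integrableP: ig1.
rewrite (ge0_integral_gaussnS mphiE); last by move=> p; rewrite lee_fin.
rewrite (eq_integral (fun x : Rm => (phi1 x)%:E)); last by move=> x _; rewrite phi1E.
have -> : \int[gaussn n.+1]_y g y = \int[gauss]_x g1 x.
  rewrite /Rintegral; congr fine; rewrite -(@fubini1 _ _ Rm (rspace R n) R gauss (gaussn n) _ ig).
  by apply: eq_integral => x _; rewrite -gE.
apply: (gauss_infconv s01 mphi1 mg1 _ ig1) => [x|x y].
  by rewrite -lee_fin phi1E; apply: integral_ge0 => y _; rewrite lee_fin.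
by rewrite -lee_fin phi1E; exact: slice.
Qed.

End ProductGauss.

(** * Minimum eigenvalue *)

Section HermitianSpectrum.
Variables (R : realType) (d : nat).
Local Notation C := R[i].

Lemma spectral_eigenvalue (N U : 'M[C]_d) (lam : 'I_d -> R) (a : R) : spectral_of N U lam ->
  eigenvalue N a%:C%C <-> exists i, lam i = a.
Proof.
move=> [uU dN]; have UU := unitary_adjM uU.
have UN : U *m N = diag_mx (\row_i (lam i)%:C%C) *m U.
  by rewrite -dN -mulmxA UU mulmx1.
split=> [/eigenvalueP[v vN v0]|[i <-]].
  pose w := v *m U^t*.
  have wD : w *m diag_mx (\row_i (lam i)%:C%C) = a%:C%C *: w.
    by rewrite /w -dN scalemxAl -vN !mulmxA -(mulmxA v (U^t*) U) UU mulmx1.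
  have w0 : w != 0.
    apply: contra v0 => /eqP w0; apply/eqP.
    by rewrite -[v]mulmx1 -UU mulmxA -/w w0 mul0mx.
  have [j wj] : exists j, w 0 j != 0.
    apply/existsP; move: w0; apply: contraR; rewrite negb_exists => /forallP w0.
    by apply/eqP/rowP => j; rewrite [RHS]mxE; apply/eqP; have := w0 j; rewrite negbK.
  clearbody w; exists j; move/rowP/(_ j): wD; rewrite mul_mx_diag !mxE mulrC => H.
  by case: (mulIf wj H).
apply/eigenvalueP; exists (row i U).
  by rewrite -row_mul UN; apply/rowP => j; rewrite mul_diag_mx !mxE.
apply/eqP => r0; have := unitarymxP uU => /(congr1 (row i)); rewrite row_mul r0 mul0mx.
by move=> /rowP/(_ i)/eqP; rewrite !mxE eqxx eq_sym oner_eq0.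
Qed.

Lemma spectral_psd (N U : 'M[C]_d) (lam : 'I_d -> R) (m : R) : spectral_of N U lam ->
  (forall i, m <= lam i) -> psdC (N - (m%:C%C)%:M).
Proof.
move=> [uU dN] mlam; have UU := unitary_adjM uU.
have -> : N - (m%:C%C)%:M = U^t* *m diag_mx (\row_i (lam i - m)%:C%C) *m U.
  have -> : diag_mx (\row_i (lam i - m)%:C%C) = U *m (N - (m%:C%C)%:M) *m U^t*.
    rewrite mulmxBr mulmxBl dN -scalemx1 -scalemxAr mulmx1 -scalemxAl (unitarymxP uU).
    by apply/matrixP => i j; rewrite !mxE; case: eqP => _; rewrite ?mulr1n ?mulr0n ?mulr1 ?mulr0 ?subr0// rmorphB.
  by rewrite !mulmxA UU mul1mx -mulmxA UU mulmx1.
by apply: psdC_congr; apply: psdC_diag_mx => i; rewrite mxE lecR subr_ge0.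
Qed.

Lemma row_norm_gt0 (w : 'rV[C]_d) : w != 0 -> exists2 r : R, 0 < r & (w *m w^t*) 0 0 = r%:C%C.
Proof.
move=> w0; have [j wj] : exists j, w 0 j != 0.
  apply/existsP; move: w0; apply: contraR; rewrite negb_exists => /forallP w0.
  by apply/eqP/rowP => j; rewrite [RHS]mxE; apply/eqP; have := w0 j; rewrite negbK.
have : 0 < (w *m w^t*) 0 0.
  rewrite mxE (bigD1 j)//= !mxE -normCK ltr_pwDl ?exprn_gt0 ?normr_gt0// sumr_ge0// => i _.
  by rewrite !mxE -normCK exprn_ge0.
case: ((w *m w^t*) 0 0) => x y; rewrite ltcE/= => /andP[/eqP y0 x0].
by exists x => //; rewrite y0.
Qed.

End HermitianSpectrum.

Section LambdaMin.
Variables (R : realType) (k : scalars).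
Local Notation C := R[i].
Local Notation F := (Fld R k).

(** Both scalar fields are handled inside [R[i]], where the spectral theorem and [trexp] live. *)
Definition emb : {rmorphism F -> C} :=
  match k as k0 return {rmorphism Fld R k0 -> C} with
  | RealF => (@real_complex R : {rmorphism R -> C})
  | ComplexF => (idfun : {rmorphism C -> C})
  end.

Lemma emb_ofR x : emb (ofR k x) = x%:C%C.
Proof. by rewrite /emb /ofR; case: k. Qed.

Lemma ofRM (x y : R) : ofR k x * ofR k y = ofR k (x * y) :> F.
Proof. by case: (k) => //=; rewrite -rmorphM. Qed.

Lemma ofR1 : ofR k 1 = 1 :> F.
Proof. by case: (k). Qed.

Lemma emb_conj (x : F) : emb (conjF x) = (emb x)^*.
Proof. by rewrite /emb /conjF; move: x; case: k => x //=; rewrite [RHS]conjc_real. Qed.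

Lemma Re_emb (x : F) : complex.Re (emb x) = reF x.
Proof. by rewrite /emb /reF; move: x; case: k. Qed.

Lemma emb_ge0 (x : F) : 0 <= x -> 0 <= emb x.
Proof. by rewrite /emb; move: x; case: k => x //= x0; rewrite lecR. Qed.

Lemma conjFK (x : F) : conjF (conjF x) = x.
Proof. by apply: (fmorph_inj emb); rewrite !emb_conj conjCK. Qed.

Lemma emb_adj m n (M : 'M[F]_(m, n)) : map_mx emb (adj M) = (map_mx emb M)^t*.
Proof. by apply/matrixP => i j; rewrite !mxE emb_conj. Qed.

Lemma adjK m n (M : 'M[F]_(m, n)) : adj (adj M) = M.
Proof. by apply/matrixP => i j; rewrite !mxE conjFK. Qed.

Lemma emb_mx_inj m n : injective (@map_mx _ _ emb m n).
Proof.
move=> A B /matrixP AB; apply/matrixP => i j; apply: (fmorph_inj emb).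
by have := AB i j; rewrite !mxE.
Qed.

Lemma adjZ m n c (M : 'M[F]_(m, n)) : adj (ofR k c *: M) = ofR k c *: adj M.
Proof.
apply/matrixP => i j; rewrite !mxE; apply: (fmorph_inj emb).
by rewrite emb_conj !rmorphM emb_ofR emb_conj; congr (_ * _); rewrite [LHS]conjc_real.
Qed.

Variable d : nat.
Implicit Types (M A : 'M[F]_d).

Lemma emb_self_adjoint M : self_adjoint M -> (map_mx emb M)^t* = map_mx emb M.
Proof. by rewrite -emb_adj => ->. Qed.

Lemma emb_eigenvalue M a : eigenvalue M (ofR k a) = eigenvalue (map_mx emb M) a%:C%C.
Proof. by rewrite !eigenvalue_root_char -map_char_poly -emb_ofR fmorph_root. Qed.

Lemma eigenrow_norm (v : 'rV[F]_d) : v != 0 -> exists2 r : R, 0 < r & v *m adj v = (ofR k r)%:M.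
Proof.
move=> v0; have v0' : map_mx emb v != 0.
  by apply: contra v0 => /eqP v0; apply/eqP/emb_mx_inj; rewrite v0 map_mx0.
have [r r0 rE] := row_norm_gt0 v0'; exists r => //; apply: emb_mx_inj.
by rewrite map_mxM emb_adj [LHS]mx11_scalar rE map_scalar_mx emb_ofR.
Qed.

(** Over the reals, [psd] tests only real vectors. The spectrum bridges the gap: a real eigenvalue
    has an eigenvector over [F] itself, and testing [psd] there shows that the eigenvalue is
    nonnegative. *)
Lemma emb_psd A : psd A -> psdC (map_mx emb A).
Proof.
move=> [hA pA]; have hE := emb_self_adjoint hA; have [U [lam sA]] := spectral_ofP hE.
have lam0 i : 0 <= lam i.
  have : eigenvalue (map_mx emb A) (lam i)%:C%C by apply/(spectral_eigenvalue _ sA); exists i.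
  rewrite -emb_eigenvalue => /eigenvalueP[v vA v0]; have [r r0 rE] := eigenrow_norm v0.
  have := pA (adj v); rewrite adjK vA -scalemxAl rE => /emb_ge0.
  by rewrite !mxE mulr1n rmorphM !emb_ofR -rmorphM lecR pmulr_lge0.
have := spectral_psd sA lam0; congr psdC; apply/matrixP => i j.
by rewrite !mxE (_ : 0%:C%C = 0 :> C)// mul0rn subr0.
Qed.

Hypothesis d0 : (0 < d)%N.

Lemma lambda_minP M : self_adjoint M -> exists U lam i0,
  [/\ spectral_of (map_mx emb M) U lam, lambda_min M = lam i0 & forall i, lambda_min M <= lam i].
Proof.
move=> hM; have [U [lam sM]] := spectral_ofP (emb_self_adjoint hM).
pose i0 := [arg min_(i < Ordinal d0) lam i]%O.
have i0P i : lam i0 <= lam i by rewrite /i0; case: arg_minP => // j _ /(_ i isT).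
have ev a : eigenvalue M (ofR k a) <-> exists i, lam i = a.
  by rewrite emb_eigenvalue; exact: (spectral_eigenvalue _ sM).
have E : lambda_min M = lam i0.
  apply/eqP; rewrite eq_le; apply/andP; split.
    apply: ge_inf; last by apply/ev; exists i0.
    by exists (lam i0) => a /ev[i <-].
  apply: lb_le_inf; first by exists (lam i0); apply/ev; exists i0.
  by move=> a /ev[i <-].
by exists U, lam, i0; split => // i; rewrite E.
Qed.

Lemma lambda_min_le M (u : 'cV[F]_d) : self_adjoint M -> unit_vec u ->
  lambda_min M <= reF ((adj u *m M *m u) 0 0).
Proof.
move=> hM uu; have [U [lam [i0 [sM _ lamP]]]] := lambda_minP hM.
have [_ /(_ (map_mx emb u))] := spectral_psd sM lamP.
rewrite mulmxBr mulmxBl -emb_adj -!map_mxM -scalemx1 -scalemxAr mulmx1 -scalemxAl -map_mxM uu.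
rewrite map_mx1 !mxE/= mulr1 -Re_emb; case: (emb _) => x y.
by rewrite subr_ge0 lecE/= => /andP[].
Qed.

Lemma lambda_min_attained M : self_adjoint M ->
  exists2 u : 'cV[F]_d, unit_vec u & reF ((adj u *m M *m u) 0 0) = lambda_min M.
Proof.
move=> hM; have [U [lam [i0 [sM lE _]]]] := lambda_minP hM.
have : eigenvalue M (ofR k (lam i0)) by rewrite emb_eigenvalue; apply/(spectral_eigenvalue _ sM); exists i0.
move=> /eigenvalueP[v vM v0]; have [r r0 rE] := eigenrow_norm v0.
pose c := (Num.sqrt r)^-1; have c2 : c * c * r = 1.
  by rewrite -expr2 exprVn sqr_sqrtr ?ltW// mulVf// gt_eqF.
exists (ofR k c *: adj v).
  rewrite /unit_vec adjZ adjK -scalemxAl -scalemxAr rE scalerA ofRM scale_scalar_mx ofRM c2.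
  by rewrite ofR1.
rewrite adjZ adjK -!scalemxAl vM -scalemxAr -scalemxAl rE !scalerA !scale_scalar_mx !ofRM mxE mulr1n.
rewrite -Re_emb emb_ofR/= lE mulrAC mulrA; rewrite -[RHS]mul1r -c2; ring.
Qed.

End LambdaMin.

(** * Affine families of self-adjoint matrices *)

Section AffineMatrixFamily.
Variables (R : realType) (k : scalars) (d : nat).
Local Notation C := R[i].
Local Notation F := (Fld R k).
Local Notation Rm := (measurableTypeR R).
Local Notation emb := (@emb R k).

Definition quad (u : 'cV[F]_d) (M : 'M[F]_d) : R := reF ((adj u *m M *m u) 0 0).

Let Re_ofRM (x : R) (z : C) : complex.Re (x%:C%C * z) = x * complex.Re z.
Proof. by case: z => a b /=; rewrite mul0r subr0. Qed.

Lemma quadD u (M N : 'M[F]_d) : quad u (M + N) = quad u M + quad u N.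
Proof. by rewrite /quad mulmxDr mulmxDl mxE -!Re_emb rmorphD raddfD. Qed.

Lemma quadZ u c (M : 'M[F]_d) : quad u (ofR k c *: M) = c * quad u M.
Proof. by rewrite /quad -scalemxAr -scalemxAl mxE -!Re_emb rmorphM emb_ofR Re_ofRM. Qed.

Lemma quad_sum u n (c : 'I_n -> R) (H : 'I_n -> 'M[F]_d) :
  quad u (\sum_i ofR k (c i) *: H i) = \sum_i c i * quad u (H i).
Proof.
transitivity (\sum_i quad u (ofR k (c i) *: H i)); last by apply: eq_bigr => i _; exact: quadZ.
elim/big_rec2: _ => [|i y M _ IH]; last by rewrite quadD IH.
by rewrite /quad mulmx0 mul0mx mxE -Re_emb rmorph0.
Qed.

Lemma emb_comb n (c : 'I_n -> R) (H : 'I_n -> 'M[F]_d) (B : 'M[F]_d) :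
  map_mx emb (B + \sum_i ofR k (c i) *: H i) =
  map_mx emb B + \sum_i (c i)%:C%C *: map_mx emb (H i).
Proof.
apply/matrixP => a b; rewrite !mxE !summxE rmorphD rmorph_sum; congr (_ + _).
by apply: eq_bigr => i _; rewrite !mxE rmorphM emb_ofR.
Qed.

Lemma emb_ofRZ (c : R) (M : 'M[F]_d) : map_mx emb (ofR k c *: M) = c%:C%C *: map_mx emb M.
Proof. by rewrite map_mxZ emb_ofR. Qed.

Lemma self_adjoint_comb n (c : 'I_n -> R) (H : 'I_n -> 'M[F]_d) (B : 'M[F]_d) :
  self_adjoint B -> (forall i, self_adjoint (H i)) -> self_adjoint (B + \sum_i ofR k (c i) *: H i).
Proof.
move=> hB hH; apply: emb_mx_inj; rewrite emb_adj emb_comb; apply: adj_comb.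
  exact: emb_self_adjoint.
by move=> i; exact: emb_self_adjoint.
Qed.

Lemma self_adjointZ (c : R) (M : 'M[F]_d) : self_adjoint M -> self_adjoint (ofR k c *: M).
Proof. by rewrite /self_adjoint adjZ => ->. Qed.

Lemma self_adjointN (M : 'M[F]_d) : self_adjoint M -> self_adjoint (- M).
Proof.
move=> /(self_adjointZ (-1)); congr self_adjoint; apply: emb_mx_inj.
by rewrite emb_ofRZ rmorphN rmorph1 scaleN1r map_mxN.
Qed.

Hypothesis d0 : (0 < d)%N.

(** Bounds the quadratic form on unit vectors. In particular the set in [sigma_star2] is bounded, so
    its [sup] is not the default value. *)
Definition quad_bound (A : 'M[F]_d) := `|lambda_min A| + `|lambda_min (- A)|.

Lemma quad_bound_ge0 A : 0 <= quad_bound A. Proof. exact: addr_ge0. Qed.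

Let norm_between (x y q : R) : x <= q -> y <= - q -> `|q| <= `|x| + `|y|.
Proof.
move=> xq yq; have := ler_norm (- x); have := ler_norm (- y); rewrite !normrN => n1 n2.
by have p1 := normr_ge0 x; have p2 := normr_ge0 y; rewrite ler_norml; apply/andP; split; lra.
Qed.

Lemma quad_le_bound A u : self_adjoint A -> unit_vec u -> `|quad u A| <= quad_bound A.
Proof.
move=> hA uu; have h1 := lambda_min_le d0 hA uu; have h2 := lambda_min_le d0 (self_adjointN hA) uu.
have E : reF ((adj u *m - A *m u) 0 0) = - quad u A.
  by rewrite /quad mulmxN mulNmx mxE -!Re_emb rmorphN raddfN.
by rewrite E in h2; exact: norm_between h1 h2.
Qed.

Lemma sigma_star2_ge n (H : 'I_n -> 'M[F]_d) u : (forall i, self_adjoint (H i)) -> unit_vec u ->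
  \sum_i quad u (H i) ^+ 2 <= sigma_star2 H.
Proof.
move=> hH uu; apply: ub_le_sup; last by exists u.
exists (\sum_i quad_bound (H i) ^+ 2) => _ [w uw <-]; apply: ler_sum => i _.
rewrite -[X in X <= _]real_normK ?num_real// lerXn2r ?nnegrE ?quad_bound_ge0//.
exact: quad_le_bound.
Qed.

Lemma lambda_minZ (c : R) (M : 'M[F]_d) : 0 <= c -> self_adjoint M ->
  lambda_min (ofR k c *: M) = c * lambda_min M.
Proof.
move=> c0 hM; have hcM := self_adjointZ c hM; apply/eqP; rewrite eq_le; apply/andP; split.
  have [u uu <-] := lambda_min_attained d0 hM.
  by have := lambda_min_le d0 hcM uu; rewrite -/(quad u _) quadZ.
have [u uu <-] := lambda_min_attained d0 hcM.
by rewrite -/(quad u _) quadZ ler_wpM2l// lambda_min_le.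
Qed.

Lemma trexp_lambda_min (M : 'M[F]_d) : self_adjoint M ->
  expR (- lambda_min M) <= trexp (map_mx emb M) <= d%:R * expR (- lambda_min M).
Proof.
move=> hM; have [U [lam [i0 [sM lE lamP]]]] := lambda_minP d0 hM.
rewrite (trexpE sM); apply/andP; split.
  by rewrite (bigD1 i0)//= -lE lerDl sumr_ge0// => i _; exact: expR_ge0.
apply: (@le_trans _ _ (\sum_(i < d) expR (- lambda_min M))).
  by apply: ler_sum => i _; rewrite ler_expR lerN2.
by rewrite sumr_const card_ord (mulr_natl _ d).
Qed.

Section Family.
Variables (n : nat) (H : 'I_n -> 'M[F]_d) (B : 'M[F]_d).
Hypotheses (hB : self_adjoint B) (hH : forall i, self_adjoint (H i)).

Let M (c : 'I_n -> R) := B + \sum_i ofR k (c i) *: H i.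

Let hM c : self_adjoint (M c). Proof. exact: self_adjoint_comb. Qed.

Let quadM u c : quad u (M c) = quad u B + \sum_i c i * quad u (H i).
Proof. by rewrite /M quadD quad_sum. Qed.

(** A unit eigenvector [u] at [c] gives the slopes [quad u (H i)] of an affine majorant that touches
    at [c]. *)
Lemma lambda_min_support (c : 'I_n -> R) : exists2 h : 'I_n -> R, \sum_i h i ^+ 2 <= sigma_star2 H &
  forall c', lambda_min (M c') <= lambda_min (M c) + \sum_i (c' i - c i) * h i.
Proof.
have [u uu uE] := lambda_min_attained d0 (hM c); exists (fun i => quad u (H i)).
  exact: sigma_star2_ge.
move=> c'; apply: (le_trans (lambda_min_le d0 (hM c') uu)); rewrite -uE -!/(quad u _) !quadM.
rewrite -addrA -big_split/= lerD2l ler_sum// => i _.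
by rewrite -mulrDl addrC subrK.
Qed.

Definition growth_const := quad_bound B + \sum_i quad_bound (H i).

Lemma growth_const_ge0 : 0 <= growth_const.
Proof. by rewrite addr_ge0 ?quad_bound_ge0// sumr_ge0// => i _; exact: quad_bound_ge0. Qed.

Lemma lambda_min_growth (c : 'I_n -> R) : `|lambda_min (M c)| <= growth_const * (1 + \sum_i `|c i|).
Proof.
have [u uu <-] := lambda_min_attained d0 (hM c); rewrite -/(quad u _) quadM.
apply: (le_trans (ler_normD _ _)); rewrite mulrDr mulr1.
have c0 : 0 <= \sum_i `|c i| by apply: sumr_ge0.
have S0 : 0 <= \sum_i quad_bound (H i) by apply: sumr_ge0 => i _; exact: quad_bound_ge0.
apply: lerD.
  by apply: (le_trans (quad_le_bound hB uu)); rewrite /growth_const lerDl.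
apply: (le_trans (ler_norm_sum _ _ _)); rewrite mulr_sumr; apply: ler_sum => i _.
rewrite normrM mulrC ler_wpM2r//; apply: (le_trans (quad_le_bound (hH i) uu)).
rewrite /growth_const (bigD1 i)//= addrCA lerDl addr_ge0 ?quad_bound_ge0// sumr_ge0// => j _.
exact: quad_bound_ge0.
Qed.

(** With [j] a positive integer, [- ln (trexp (j M)) / j] is measurable and lies between
    [lambda_min M - ln d / j] and [lambda_min M]. *)
Lemma measurable_lambda_min dS (S : measurableType dS) (c : 'I_n -> S -> Rm) :
  (forall i, measurable_fun setT (c i)) ->
  measurable_fun setT (fun s => lambda_min (M (c ^~ s)) : Rm).
Proof.
move=> mc; pose T j s := trexp (j.+1%:R%:C%C *: map_mx emb (M (c ^~ s))).
have hT j s : self_adjoint (ofR k j.+1%:R *: M (c ^~ s)) by exact: self_adjointZ.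
have TE j s : T j s = trexp (map_mx emb (ofR k j.+1%:R *: M (c ^~ s))) by rewrite /T emb_ofRZ.
have mT j : measurable_fun setT (T j : S -> Rm).
  apply: measurable_trexp; last by move=> s; rewrite -emb_ofRZ emb_self_adjoint.
  apply: measurable_mxZ; first exact: measurable_cplx_cst.
  rewrite (_ : (fun _ => _) = fun s => map_mx emb B + \sum_i (c i s)%:C%C *: map_mx emb (H i)).
    by apply: measurable_comb => //; exact: measurable_mx_cst.
  by apply/funext => s; exact: emb_comb.
apply: (measurable_fun_cvg (h := fun j s => - ln (T j s) * j.+1%:R^-1)) => [j|s _].
  apply: measurable_funM => //; apply: measurableT_comp => //.
  exact: (measurableT_comp (@measurable_ln R) (mT j)).
have bnds j : lambda_min (M (c ^~ s)) - ln d%:R * j.+1%:R^-1 <= - ln (T j s) * j.+1%:R^-1 <= lambda_min (M (c ^~ s)).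
  have j0 : 0 < j.+1%:R :> R by rewrite ltr0n.
  have dR : 0 < d%:R :> R by rewrite ltr0n.
  have := trexp_lambda_min (hT j s); rewrite -TE lambda_minZ ?ler0n// => /andP[lo hi].
  have T0 : 0 < T j s by apply: lt_le_trans lo; exact: expR_gt0.
  have lo' : - (j.+1%:R * lambda_min (M (c ^~ s))) <= ln (T j s) by rewrite -ler_expR lnK.
  have hi' : ln (T j s) <= ln d%:R - j.+1%:R * lambda_min (M (c ^~ s)).
    by rewrite -ler_expR lnK// expRD lnK.
  apply/andP; split; last by rewrite ler_pdivrMr// mulrC; lra.
  by rewrite lerBlDr -mulrDl ler_pdivlMr// mulrC; lra.
apply: (@squeeze_cvgr _ _ _ _ (fun j => lambda_min (M (c ^~ s)) - ln d%:R * j.+1%:R^-1) (fun=> lambda_min (M (c ^~ s)))).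
- exact: nearW.
- rewrite -[X in _ --> X]subr0 -[X in _ - X](mulr0 (ln d%:R)); apply: cvgB; first exact: cvg_cst.
  by apply: cvgM; [exact: cvg_cst|exact: cvg_harmonic].
- exact: cvg_cst.
Qed.

End Family.

End AffineMatrixFamily.

Section RealRandomVariables.
Variables (R : realType) (dT : measure_display) (T : measurableType dT) (P : probability T R).
Local Notation Rm := (measurableTypeR R).

Lemma measurable_rvm (X : {RV P >-> R}) : measurable_fun (U := Rm) setT X.
Proof. exact: (measurable_funPT X). Qed.

(* [R] and [measurableTypeR R] carry the same Borel sets but different displays. *)
Definition rvm (X : {RV P >-> R}) : {mfun T >-> Rm} :=
  @mfun_Sub _ _ T Rm X (mem_set (measurable_rvm X)).

Lemma independent_rvm n (X : 'I_n -> {RV P >-> R}) : independent_rvs X ->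
  forall B : 'I_n -> set Rm, (forall i, measurable (B i)) ->
  P [set t | forall i, B i (rvm (X i) t)] = (\prod_i P (rvm (X i) @^-1` B i))%E.
Proof.
move=> ind B mB; have := ind [set: 'I_n]%SET B mB.
rewrite [X in P X = _](_ : _ = [set t | forall i, B i (rvm (X i) t)]); last first.
  apply/seteqP; split=> t /= h i; first by apply: h; rewrite /= finset.in_setT.
  by move=> _; exact: h.
by move=> ->; apply: eq_bigl => i; rewrite finset.in_setT.
Qed.

End RealRandomVariables.

Section GaussianVector.
Variable R : realType.
Local Notation Rm := (measurableTypeR R).
Local Notation gauss := (@normal_prob R 0 1).

(** The laws agree as set functions but are different bundled probabilities, so equality is carried
    through the iterated integrals. *)
Lemma ge0_eq_prodP n (nu nu' : 'I_n -> probability Rm R) (h : rspace R n -> \bar R) :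
  (forall i, nu i = nu' i :> (set Rm -> \bar R)) -> measurable_fun setT h -> (forall x, 0 <= h x)%E ->
  (\int[prodP nu]_x h x = \int[prodP nu']_x h x)%E.
Proof.
elim: n nu nu' h => [//|n IH] nu nu' h nuE mh h0.
have mslice x : measurable_fun setT (fun y : rspace R n => (x, y) : Rm * rspace R n).
  by apply: (@measurable_fun_pair _ _ _ (rspace R n) Rm (rspace R n) (cst x) id).
rewrite [LHS](fubini_tonelli1 (m1 := nu ord0) (m2 := prodP (fun i => nu (lift ord0 i))) _ mh h0).
rewrite [RHS](fubini_tonelli1 (m1 := nu' ord0) (m2 := prodP (fun i => nu' (lift ord0 i))) _ mh h0).
transitivity (\int[nu ord0]_x fubini_F (prodP (fun i => nu' (lift ord0 i))) h x)%E.
  apply: eq_integral => x _; apply: (IH _ _ (fun y => h (x, y))) => //.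
  exact: (measurableT_comp mh (mslice x)).
by apply: eq_measure_integral => A mA _; exact: (congr1 (fun f : set Rm -> \bar R => f A) (nuE ord0)).
Qed.

Lemma integral_gaussian_vector n (dT : measure_display) (T : measurableType dT) (P : probability T R)
    (gam : 'I_n -> {RV P >-> R}) (h : rspace R n -> \bar R) : independent_rvs gam ->
  (forall i, distribution P (gam i) = gauss :> (set R -> \bar R)) -> measurable_fun setT h ->
  (\int[P]_t h (rvec (fun i => gam i t)) = \int[gaussn R n]_x h x)%E.
Proof.
move=> ind law mh.
have ge0 (f : rspace R n -> \bar R) : measurable_fun setT f -> (forall x, 0 <= f x)%E ->
    (\int[P]_t f (rvec (fun i => gam i t)) = \int[gaussn R n]_x f x)%E.
  move=> mf f0; rewrite -(ge0_eq_prodP (nu := fun i => distribution P (rvm (gam i))) law mf f0).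
  exact: (ge0_integral_joint (independent_rvm ind) mf f0).
have mp : measurable_fun setT (funepos h) by exact: measurable_funepos.
have mn : measurable_fun setT (funeneg h) by exact: measurable_funeneg.
have Ep := ge0 _ mp (fun x => funepos_ge0 h x); have En := ge0 _ mn (fun x => funeneg_ge0 h x).
rewrite [LHS]integralE [RHS]integralE -Ep -En.
by congr (_ - _)%E; apply: eq_integral => t _; rewrite ?funeposE ?funenegE.
Qed.

Variables (k : scalars) (d n : nat) (H : 'I_n -> 'M[Fld R k]_d) (B : 'M[Fld R k]_d).
Hypotheses (d0 : (0 < d)%N) (hB : self_adjoint B) (hH : forall i, self_adjoint (H i)).

Definition gaussian_lambda_min (x : rspace R n) : R :=
  lambda_min (B + \sum_i ofR k (coord x i) *: H i).

Local Notation glam := gaussian_lambda_min.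

Lemma measurable_gaussian_lambda_min : measurable_fun setT glam.
Proof.
exact: (measurable_lambda_min d0 hB hH (c := fun i (x : rspace R n) => coord x i) (fun i => measurable_coord i)).
Qed.

Lemma integrable_gaussian_lambda_min : (gaussn R n).-integrable setT (EFin \o glam).
Proof.
apply: (integrable_linear_growth measurable_gaussian_lambda_min (growth_const_ge0 H B)).
by move=> x; exact: lambda_min_growth.
Qed.

Let chain (t x y S Q X e : R) : t * y <= t * x + t * S -> t * S <= Q + X -> X <= e ->
  - (t * x) + - e <= - t * y + Q.
Proof. by move=> *; lra. Qed.

(** Infimum-convolution for [g = - t lambda_min] with [1 - s = q^-1]: the affine majorant and
    Young's inequality bound the difference of two values of [g] by the quadratic cost plus
    [q * (t ^+ 2 * s2 / 2)]. Then [q] decreases to 1. *)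
Lemma gaussian_lambda_min_mgf (t : R) : 0 < t ->
  (\int[gaussn R n]_x (expR (- (t * glam x)))%:E <=
   (expR (- (t * \int[gaussn R n]_x glam x) + t ^+ 2 * sigma_star2 H / 2))%:E)%E.
Proof.
move=> t0; set G := \int[gaussn R n]_x glam x; set s2 := sigma_star2 H.
have mL := measurable_gaussian_lambda_min.
have s20 : 0 <= s2.
  have [h hs _] := lambda_min_support d0 hB hH (fun=> 0).
  by apply: le_trans hs; apply: sumr_ge0 => i _; exact: sqr_ge0.
have bound q : 1 < q -> (\int[gaussn R n]_x (expR (- (t * glam x)))%:E <=
    (expR (- (t * G) + q * (t ^+ 2 * s2 / 2)))%:E)%E.
  move=> q1; have q0 : 0 < q by rewrite (lt_trans ltr01).
  pose s := 1 - q^-1; have s01 : 0 < s < 1.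
    by rewrite subr_gt0 invf_lt1// q1/= ltrBlDr ltrDl invr_gt0.
  have cE : 1 - s = q^-1 by rewrite /s opprB addrCA subrr addr0.
  pose e := q * (t ^+ 2 * s2 / 2).
  pose phi x := expR (- (t * glam x)) * expR (- e).
  pose g x := - t * glam x.
  have mexp : measurable_fun setT (fun x => expR (- (t * glam x))).
    apply: measurableT_comp => //; apply: measurableT_comp => //; exact: measurable_funM.
  have mphi : measurable_fun setT phi by exact: measurable_funM.
  have mg : measurable_fun setT g by exact: measurable_funM.
  have K0 : 0 <= t * growth_const H B by rewrite mulr_ge0 ?growth_const_ge0// ltW.
  have phi0 x : 0 <= phi x by rewrite /phi mulr_ge0 ?expR_ge0.
  have := gaussn_infconv (n := n) (phi := phi) (g := g) s01 mphi mg phi0 K0.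
  have -> : \int[gaussn R n]_y g y = - (t * G).
    by rewrite /g (RintegralZl _ measurableT integrable_gaussian_lambda_min) mulNr.
  have -> : (\int[gaussn R n]_x (phi x)%:E = (\int[gaussn R n]_x (expR (- (t * glam x)))%:E) * (expR (- e))%:E)%E.
    transitivity ((expR (- e))%:E * \int[gaussn R n]_x (expR (- (t * glam x)))%:E)%E; last exact: muleC.
    have mexpE : measurable_fun setT (fun x => (expR (- (t * glam x)))%:E) by apply/measurable_EFinP; exact: mexp.
    have exp0 x : (0 <= (expR (- (t * glam x)))%:E)%E by rewrite lee_fin expR_ge0.
    have e0 : (0 <= (expR (- e))%:E)%E by rewrite lee_fin expR_ge0.
    rewrite -(@ge0_integralZl _ (rspace R n) R (gaussn R n) setT measurableT _ mexpE _ (fun x _ => exp0 x) e0).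
    by apply: eq_integral => x _; rewrite -EFinM mulrC.
  rewrite cE => Hic; suff Hle : (\int[gaussn R n]_x (expR (- (t * glam x)))%:E * (expR (- e))%:E <= (expR (- (t * G)))%:E)%E.
    have ee0 : (0 <= (expR e)%:E)%E by rewrite lee_fin expR_ge0.
    have := lee_wpmul2r ee0 Hle; rewrite -muleA -!EFinM -!expRD addNr expR0 mule1.
    exact.
  apply: Hic => [x|x y].
    rewrite /g normrM normrN (gtr0_norm t0) -mulrA ler_wpM2l ?(ltW t0)//.
    exact: lambda_min_growth.
  rewrite /phi /g -expRD ler_expR.
  have [h hs hle] := lambda_min_support d0 hB hH (coord x); have := hle (coord y); rewrite -/(glam x) -/(glam y) => le.
  have amgm i : t * ((coord y i - coord x i) * h i) <=
      q^-1 / 2 * (coord x i - coord y i) ^+ 2 + q * (t ^+ 2 / 2) * h i ^+ 2.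
    rewrite -subr_ge0 [X in 0 <= X](_ : _ =
      q / 2 * (q^-1 * (coord x i - coord y i) + t * h i) ^+ 2); first by rewrite mulr_ge0 ?sqr_ge0// divr_ge0// ltW.
    by field; rewrite gt_eqF.
  have S : t * \sum_i (coord y i - coord x i) * h i <=
      q^-1 / 2 * \sum_i (coord x i - coord y i) ^+ 2 + q * (t ^+ 2 / 2) * \sum_i h i ^+ 2.
    by rewrite !mulr_sumr -big_split/=; apply: ler_sum => i _; exact: amgm.
  have hs' : q * (t ^+ 2 / 2) * \sum_i h i ^+ 2 <= e.
    rewrite /e (_ : q * (t ^+ 2 * s2 / 2) = q * (t ^+ 2 / 2) * s2); last by ring.
    by rewrite ler_wpM2l// mulr_ge0 ?divr_ge0 ?sqr_ge0// ltW.
  have tle := ler_wpM2l (ltW t0) le; rewrite mulrDr in tle.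
  exact: (chain tle S hs').
have [I|I] := ltP (\int[gaussn R n]_x (expR (- (t * glam x)))%:E)%E +oo%E; last first.
  by have := le_trans I (bound 2 _); rewrite ltr1n leye_eq => /(_ isT).
have I0 : (0 <= \int[gaussn R n]_x (expR (- (t * glam x)))%:E)%E.
  by apply: integral_ge0 => x _; rewrite lee_fin expR_ge0.
move: I0 I bound; case: (\int[gaussn R n]_x (expR (- (t * glam x)))%:E)%E => // i; rewrite !lee_fin => i0 _ bound.
have [i1|i1] := ltP 0 i; last by apply: (le_trans i1); exact: expR_ge0.
rewrite -(@lnK _ i) ?posrE// ler_expR; apply/ler_addgt0Pr => e e0.
set a := t ^+ 2 * s2 / 2 in bound *; have a0 : 0 <= a by rewrite divr_ge0// mulr_ge0 ?sqr_ge0.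
have a1 : 0 < a + 1 by rewrite ltr_wpDl.
(* With this [q] the excess is [e * a / (a + 1)], at most [e]; the added 1 covers [a = 0]. *)
have := bound (1 + e / (a + 1)) _; rewrite ltrDl divr_gt0// => /(_ isT).
rewrite lee_fin -{1}(@lnK _ i) ?posrE// ler_expR => /le_trans; apply.
rewrite -addrA lerD2l mulrDl mul1r lerD2l mulrAC ler_pdivrMr// ler_wpM2l ?(ltW e0)// lerDl//.
Qed.

End GaussianVector.

Lemma psdC_scale (R : realType) (d : nat) (c : R) (A : 'M[R[i]]_d) : 0 <= c -> psdC A -> psdC (c%:C%C *: A).
Proof.
move=> c0 [hA pA]; split=> [|u].
  apply/matrixP => i j; rewrite -[in RHS]hA !mxE rmorphM; congr (_ * _).
  exact: conjc_real.
by rewrite -scalemxAr -scalemxAl mxE mulr_ge0// lecR.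
Qed.

Lemma integrable_Rsum (R : realType) (dT : measure_display) (T : measurableType dT) (P : probability T R)
    (I : Type) (r : seq I) (f : I -> T -> R) : (forall i, P.-integrable setT (EFin \o f i)) ->
  P.-integrable setT (EFin \o (fun t => \sum_(i <- r) f i t)).
Proof.
move=> fi; elim: r => [|i r IH].
  rewrite (_ : _ \o _ = EFin \o (fun _ : T => 0 : R)); last by apply/funext => t /=; rewrite big_nil.
  exact: finite_measure_integrable_cst.
have := integrableD measurableT (fi i) IH; congr (P.-integrable setT _).
by apply/funext => t /=; rewrite big_cons.
Qed.

(** * Moment bound, tail and expectation for the random matrix *)

Section RandomMatrix.
Variables (R : realType) (k : scalars) (d n : nat) (A : 'I_n -> 'M[Fld R k]_d) (Delta : 'M[Fld R k]_d).
Variables (dT : measure_display) (T : measurableType dT) (P : probability T R) (W : 'I_n -> {RV P >-> R}).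
Local Notation Rm := (measurableTypeR R).
Local Notation emb := (@emb R k).
Hypotheses (d0 : (0 < d)%N) (pA : forall i, psd (A i)) (hD : self_adjoint Delta).
Hypotheses (ind : independent_rvs W) (W0 : forall i w, 0 <= W i w).
Hypothesis W2 : forall i, ('E_P[fun w => (W i w ^+ 2)%R] < +oo)%E.

Let m i : R := fine ('E_P[W i])%E.
Let v i : R := fine ('E_P[fun w => (W i w ^+ 2)%R])%E.
Let H i := ofR k (Num.sqrt (v i)) *: A i.
Let hA i : self_adjoint (A i). Proof. by case: (pA i). Qed.
Let hH i : self_adjoint (H i). Proof. exact: self_adjointZ. Qed.
Let s2 := sigma_star2 H.
Let G : R := \int[gaussn R n]_x gaussian_lambda_min H Delta x.

Let mW i : measurable_fun setT (W i : T -> R).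
Proof. exact: (measurable_funPT (W i)). Qed.

Let iW2 i : P.-integrable setT (EFin \o (fun t => W i t ^+ 2)).
Proof.
apply/integrableP; split; first by apply/measurable_EFinP; exact: measurable_funX.
have := W2 i; rewrite unlock; apply: le_lt_trans; rewrite le_eqVlt; apply/orP; left; apply/eqP.
by apply: eq_integral => t _; rewrite /= ger0_norm ?sqr_ge0.
Qed.

Let iW i : P.-integrable setT (EFin \o (W i : T -> R)).
Proof.
have i1 : P.-integrable setT (EFin \o (fun t => 1 + W i t ^+ 2)).
  have ic : P.-integrable setT (EFin \o (fun _ : T => 1 : R)) by exact: finite_measure_integrable_cst.
  exact: (integrableD measurableT ic (iW2 i)).
apply: (le_integrable measurableT _ _ i1); first exact/measurable_EFinP.
move=> t _; rewrite lee_fin /= !ger0_norm ?W0 ?addr_ge0 ?sqr_ge0//.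
by have := sqr_ge0 (W i t - 1); have := sqr_ge0 (W i t); nra.
Qed.

Let lam t := lambda_min (Delta + \sum_i ofR k (W i t - m i) *: A i).

Let mlam : measurable_fun setT lam.
Proof.
apply: (measurable_lambda_min d0 hD hA (c := fun i t => W i t - m i)) => i.
exact: (measurable_funB (mW i) (measurable_cst _)).
Qed.

Let mexp (t : R) : measurable_fun setT (fun w => (expR (- (t * lam w)))%:E).
Proof.
apply/measurable_EFinP; apply: measurableT_comp => //; apply: measurableT_comp => //.
exact: measurable_funM.
Qed.

(** The parameter [t] is absorbed into [A'] and [B'] so that [vector_comparison] applies as it
    stands. The factor [d] enters once, on the Gaussian side, when [trexp] is bounded by the minimum
    eigenvalue. *)
Let lam_mgf (t : R) : 0 < t ->
  (\int[P]_w (expR (- (t * lam w)))%:E <= (d%:R * expR (- (t * G) + t ^+ 2 * s2 / 2))%:E)%E.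
Proof.
move=> t0; have t0' := ltW t0.
pose B' := t%:C%C *: map_mx emb Delta; pose A' i := t%:C%C *: map_mx emb (A i).
have embE (c : 'I_n -> R) : map_mx emb (ofR k t *: (Delta + \sum_i ofR k (c i) *: A i)) =
    B' + \sum_i (c i)%:C%C *: A' i.
  rewrite emb_ofRZ emb_comb scalerDr scaler_sumr; congr (_ + _); apply: eq_bigr => i _.
  by rewrite !scalerA mulrC.
have hB' : B'^t* = B' by rewrite /B' -emb_ofRZ emb_self_adjoint//; exact: self_adjointZ.
have pA' i : psdC (A' i) by apply: psdC_scale => //; exact: emb_psd.
have hA' i : (A' i)^t* = A' i by case: (pA' i).
have scomb c : self_adjoint (Delta + \sum_i ofR k (c i) *: A i) by exact: self_adjoint_comb.
pose h (x : rspace R n) := (trexp (B' + \sum_i (coord x i - m i)%:C%C *: A' i))%:E.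
have mh : measurable_fun setT h.
  apply/measurable_EFinP; apply: measurable_trexp; last by move=> x; exact: adj_comb.
  apply: measurable_comb; first exact: measurable_mx_cst.
  by move=> i; apply: measurable_funB => //; exact: measurable_coord.
have h0 x : (0 <= h x)%E by rewrite lee_fin trexp_ge0// adj_comb.
apply: (@le_trans _ _ (\int[P]_w h (rvec (fun i => rvm (W i) w)))%E).
  apply: (@ge0_le_integral _ T R P setT measurableT).
  - by move=> w _; rewrite lee_fin expR_ge0.
  - exact: mexp.
  - exact: (measurableT_comp mh (measurable_rvec (fun i => measurable_funPT (rvm (W i))))).
  - move=> w _; rewrite lee_fin.
    have := trexp_lambda_min d0 (self_adjointZ t (scomb (fun i => W i w - m i))).
    rewrite lambda_minZ// embE => /andP[le _]; apply: (le_trans le).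
    rewrite le_eqVlt; apply/orP; left; apply/eqP; congr (trexp (_ + _)).
    by apply: eq_bigr => i _; rewrite coord_rvec.
rewrite (ge0_integral_joint (independent_rvm ind) mh h0).
have EW i : \int[P]_w rvm (W i) w = m i by rewrite /m unlock.
have EW2 i : \int[P]_w (rvm (W i) w ^+ 2) = v i by rewrite /v unlock.
apply: (le_trans (vector_comparison (W := fun i => rvm (W i)) W0 iW iW2 EW EW2 pA' hB')).
have dE : (0 <= d%:R%:E :> \bar R)%E by rewrite lee_fin.
have mL := measurable_gaussian_lambda_min d0 hD hH.
have mgE : measurable_fun setT (fun x => (expR (- (t * gaussian_lambda_min H Delta x)))%:E).
  apply/measurable_EFinP; apply: measurableT_comp => //; apply: measurableT_comp => //.
  exact: measurable_funM.
have g0 x : (0 <= (expR (- (t * gaussian_lambda_min H Delta x)))%:E)%E by rewrite lee_fin expR_ge0.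
apply: (@le_trans _ _ (d%:R%:E * \int[gaussn R n]_x (expR (- (t * gaussian_lambda_min H Delta x)))%:E)%E); last first.
  by rewrite EFinM lee_wpmul2l// gaussian_lambda_min_mgf.
rewrite -(@ge0_integralZl _ (rspace R n) R (gaussn R n) setT measurableT _ mgE _ (fun x _ => g0 x) dE).
apply: (@ge0_le_integral _ (rspace R n) R (gaussn R n) setT measurableT).
- by move=> x _; rewrite lee_fin trexp_ge0// adj_comb.
- apply/measurable_EFinP; apply: measurable_trexp; last by move=> x; exact: adj_comb.
  apply: measurable_comb; first exact: measurable_mx_cst.
  by move=> i; apply: measurable_funM => //; exact: measurable_coord.
- exact: emeasurable_funM.
- move=> x _; rewrite -EFinM lee_fin.
  have := trexp_lambda_min d0 (self_adjointZ t (scomb (fun i => Num.sqrt (v i) * coord x i))).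
  rewrite lambda_minZ// embE => /andP[_]; rewrite /gaussian_lambda_min.
  congr (_ <= _ * expR (- (_ * lambda_min (_ + _)))).
  by apply: eq_bigr => i _; rewrite /H scalerA ofRM mulrC.
Qed.

Let s20 : 0 <= s2.
Proof.
have [h hs _] := lambda_min_support d0 hD hH (fun=> 0).
by apply: le_trans hs; apply: sumr_ge0 => i _; exact: sqr_ge0.
Qed.

Let d1 : 1 <= d%:R :> R. Proof. by rewrite ler1n. Qed.

Lemma lambda_min_tail (t : R) : 0 <= t ->
  (P [set w | (lam w <= G - t)%R] <= (d%:R * expR (- (t ^+ 2) / (2 * s2)))%:E)%E.
Proof.
move=> t0; have mS : measurable [set w | lam w <= G - t].
  rewrite (_ : mkset _ = lam @^-1` `]-oo, (G - t)]%classic).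
    by rewrite -[X in measurable X]setTI; apply: mlam => //; exact: measurable_itv.
  by apply/seteqP; split=> w; rewrite /= in_itv.
have triv : (1 <= d%:R * expR 0 :> R) by rewrite expR0 mulr1.
(* Division by zero gives 0, so here the claimed bound is [d] and hence trivial. *)
have [s0|s0] := eqVneq s2 0.
  rewrite s0 mulr0 invr0 mulr0; apply: (le_trans (probability_le1 P mS)).
  by rewrite lee_fin.
have sp : 0 < s2 by rewrite lt_neqAle eq_sym s0.
have [t00|tn0] := eqVneq t 0.
  by apply: (le_trans (probability_le1 P mS)); rewrite lee_fin t00 expr0n oppr0 mul0r.
have tp : 0 < t by rewrite lt_neqAle eq_sym tn0.
(* Minimizer of [- th * t + th ^+ 2 * s2 / 2], the exponent left by Markov's inequality and
   [lam_mgf]. *)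
pose th := t / s2; have th0 : 0 < th by rewrite divr_gt0.
have eE : (0 <= (expR (th * (G - t)))%:E)%E by rewrite lee_fin expR_ge0.
have exp0 w : (0 <= (expR (- (th * lam w)))%:E)%E by rewrite lee_fin expR_ge0.
apply: (@le_trans _ _ (\int[P]_w ((expR (th * (G - t)))%:E * (expR (- (th * lam w)))%:E))%E).
  rewrite -[X in P X]setIT -integral_indic//.
  apply: (@ge0_le_integral _ T R P setT measurableT).
  - by move=> w _; rewrite lee_fin indicE ler0n.
  - by apply/measurable_EFinP; exact: measurable_indic.
  - exact: emeasurable_funM.
  - move=> w _; rewrite -EFinM lee_fin indicE -expRD.
    case: (boolP (w \in _)) => [|_]; last exact: expR_ge0.
    rewrite inE /= => le; rewrite -expR0 ler_expR.
    by have := ler_wpM2l (ltW th0) le; lra.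
rewrite (@ge0_integralZl _ T R P setT measurableT _ (mexp th) _ (fun w _ => exp0 w) eE).
apply: (le_trans (lee_wpmul2l eE (lam_mgf th0))); rewrite -EFinM lee_fin mulrCA ler_wpM2l//.
rewrite -expRD ler_expR le_eqVlt; apply/orP; left; apply/eqP.
by rewrite /th; field.
Qed.

Lemma lambda_min_expectation : ((G - Num.sqrt (2 * s2 * ln d%:R))%R%:E <= \int[P]_w (lam w)%:E)%E.
Proof.
have ilam : P.-integrable setT (EFin \o lam).
  have iB : P.-integrable setT (EFin \o (fun w => growth_const A Delta * (1 + \sum_i `|W i w - m i|))).
    have ic (r : R) : P.-integrable setT (EFin \o (fun _ : T => r)) by exact: finite_measure_integrable_cst.
    have iS : P.-integrable setT (EFin \o (fun w => \sum_i `|W i w - m i|)).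
      apply: integrable_Rsum => i; have iD := integrableB measurableT (iW i) (ic (m i)).
      exact: (integrable_abse iD).
    exact: (integrableZl measurableT (growth_const A Delta) (integrableD measurableT (ic 1) iS)).
  apply: (le_integrable measurableT _ _ iB); first exact/measurable_EFinP.
  move=> w _; rewrite lee_fin [leRHS]ger0_norm; first exact: lambda_min_growth.
  by rewrite mulr_ge0 ?growth_const_ge0// addr_ge0// sumr_ge0.
rewrite -[leRHS](fineK (integrable_fin_num measurableT ilam)) lee_fin.
rewrite -[fine _]/(\int[P]_w lam w); set y := \int[P]_w lam w.
have L0 : 0 <= ln d%:R :> R by rewrite ln_ge0.
have key t : 0 < t -> t * (G - y) <= ln d%:R + t ^+ 2 * s2 / 2.
  move=> t0; have := le_trans (jensen_expR t mlam ilam) (lam_mgf t0).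
  have dE : d%:R = expR (ln d%:R) :> R by rewrite lnK// posrE ltr0n.
  rewrite lee_fin -/y {1}dE -expRD ler_expR; lra.
rewrite lerBlDl -lerBlDr; set D := G - y in key *.
have [D0|D0] := leP D 0; first by apply: (le_trans D0); exact: sqrtr_ge0.
have [s0|s0] := eqVneq s2 0.
  (* For [s2 = 0] the bound [key] has no quadratic term; this [t] makes it read
     [ln d + 1 <= ln d]. *)
  exfalso; have L1 : 0 < ln d%:R + 1 :> R by exact: ltr_wpDl.
  have := key _ (divr_gt0 L1 D0); rewrite s0 mulr0 mul0r addr0.
  by rewrite -mulrA mulVf ?gt_eqF// mulr1; lra.
have sp : 0 < s2 by rewrite lt_neqAle eq_sym s0.
(* [t = D / s2] maximizes [t * D - t ^+ 2 * s2 / 2]; it is positive even for [d = 1], where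
   [ln d = 0]. *)
have kD := key _ (divr_gt0 D0 sp).
rewrite -[D]ger0_norm ?(ltW D0)// -sqrtr_sqr ler_wsqrtr//.
have {}kD : D ^+ 2 / s2 <= 2 * ln d%:R.
  have e1 : D / s2 * D = D ^+ 2 / s2 by rewrite expr2 mulrAC.
  have e2 : (D / s2) ^+ 2 * s2 / 2 = D ^+ 2 / s2 / 2 by field.
  by rewrite e1 e2 in kD; lra.
by move: kD; rewrite ler_pdivrMr// => kD; rewrite mulrAC.
Qed.

End RandomMatrix.

Theorem theorem8p1
  (R : realType) (k : scalars) (d n : nat)
  (A : 'I_n -> 'M[Fld R k]_d) (Delta : 'M[Fld R k]_d)
  (dT : measure_display) (T : measurableType dT) (P : probability T R)
  (W : 'I_n -> {RV P >-> R})
  (dT' : measure_display) (T' : measurableType dT') (P' : probability T' R)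
  (gam : 'I_n -> {RV P' >-> R}) :
  (0 < d)%N ->
  (forall i, psd (A i)) ->
  self_adjoint Delta ->
  independent_rvs W ->
  (forall i w, 0 <= W i w) ->
  (forall i, ('E_P[fun w => (W i w ^+ 2)%R] < +oo)%E) ->
  independent_rvs gam ->
  (forall i, distribution P' (gam i) = normal_prob 0 1 :> (set R -> \bar R)) ->
  let X := fun w => \sum_(i < n) ofR k (W i w) *: A i in
  let EX := \sum_(i < n) ofR k (fine ('E_P[W i])%E) *: A i in
  let H := fun i => ofR k (Num.sqrt (fine ('E_P[fun w => (W i w ^+ 2)%R])%E)) *: A i in
  let Z := fun w' => \sum_(i < n) ofR k (gam i w') *: H i in
  let s2 := sigma_star2 H in
  let EZ := ('E_P'[fun w' => lambda_min (Z w' + Delta)])%E in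
  ('E_P[fun w => lambda_min (X w - EX + Delta)]
     >= EZ - (Num.sqrt (2 * s2 * ln d%:R))%:E)%E /\
  (forall t : R, 0 <= t ->
     (P [set w | (lambda_min (X w - EX + Delta))%:E <= EZ - t%:E]
       <= (d%:R * expR (- (t ^+ 2) / (2 * s2)))%:E)%E).
Proof.
move=> d0 pA hD ind W0 W2 indg lawg X EX H Z s2 EZ.
have hH i : self_adjoint (H i) by apply: self_adjointZ; case: (pA i).
have XE w : X w - EX + Delta = Delta + \sum_i ofR k (W i w - fine ('E_P[W i])%E) *: A i.
  rewrite addrC -sumrB; congr (_ + _); apply: eq_bigr => i _.
  by rewrite -scalerBl; congr (_ *: _); case: (k) => //=; rewrite rmorphB.
(* The Gaussian expectation is finite, so the extended-real subtractions are subtractions of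
   reals. *)
have EZE : EZ = (\int[gaussn R n]_x gaussian_lambda_min H Delta x)%:E.
  rewrite /EZ unlock.
  have iL := integrable_gaussian_lambda_min d0 hD hH.
  have mL : measurable_fun setT (fun x => (gaussian_lambda_min H Delta x)%:E).
    by apply/measurable_EFinP; exact: measurable_gaussian_lambda_min.
  rewrite /Rintegral fineK; last exact: (integrable_fin_num measurableT iL).
  rewrite -(integral_gaussian_vector indg lawg mL); apply: eq_integral => w _.
  rewrite /gaussian_lambda_min addrC; congr (lambda_min (_ + _))%:E.
  by apply: eq_bigr => i _; rewrite coord_rvec.
split.
  rewrite EZE -EFinB unlock; apply: (le_trans (lambda_min_expectation d0 pA hD ind W0 W2)).
  rewrite le_eqVlt; apply/orP; left; apply/eqP.
  by apply: eq_integral => w _; rewrite /= XE.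
move=> t t0; rewrite EZE -EFinB; apply: (le_trans _ (lambda_min_tail d0 pA hD ind W0 W2 t0)).
rewrite le_eqVlt; apply/orP; left; apply/eqP; congr (P _).
by apply/seteqP; split=> w /=; rewrite lee_fin XE.
Qed.
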